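(* For every $|s\rangle\in\Sigma$, the Hamiltonian $H_2$ possesses the following spin eigenfunctions with zero total momentum: \begin{gather*} \Psi_0=\mu\,\Phi^{(0)},\qquad \Psi_1=\mu\sum_i\cos\big(2(x_i-\bar x)\big)|s_i\rangle,\qquad \Psi_2=\mu\sum_i\sin\big(2(x_i-\bar x)\big)|s_i\rangle,\\ \Psi_3=\mu\Big[\frac{2a}{2a+1}\Phi^{(0)}+\sum_{i\ne j}\cos\big(2(x_i-x_j)\big)|s_j\rangle\Big],\qquad \Psi_4=\mu\sum_{i\ne j}\sin\big(2(x_i-x_j)\big)|s_j\rangle, \end{gather*} where $\bar x=\frac1N\sum_ix_i$ and $\Phi^{(0)}=\Lambda|s\rangle$. Their energies (eigenvalues of $H_2$) are respectively $$E_0=2Na^2,\qquad E_{1,2}=E_0+4\Big(2a+1-\frac1N\Big),\qquad E_{3,4}=E_0+8(2a+1).$$ Any algebraic eigenfunction of $H_2$ with well-defined total momentum is equivalent to a linear combination of the eigenfunctions $\Psi_0,\Psi_1,\Psi_2,\Psi_3,\Psi_4$ (with possibly different spin states $|s\rangle$).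
   Context: $N\ge3$ is an integer, $a>1/2$ is real; sums and products run over $1,\dots,N$ with cyclic indices ($x_0\equiv x_N$, $x_{N+1}\equiv x_1$, $S_{N,N+1}\equiv S_{N,1}$). The particles are ordered as $x_1<\dots<x_N$ with $x_{i+1}-x_i<\pi$, and functions are considered where the potential is nonsingular. Spin space: for a fixed $M\in\frac12\mathbb N$, $\Sigma$ is the complex vector space with basis $|s_1\dots s_N\rangle$, $s_i\in\{-M,\dots,M\}$; $S_N$ acts by permuting spin components ($\pi$ moves the component in position $k$ to position $\pi(k)$) and $S_{ij}$ is the transposition of spins $i,j$. $\Lambda$ is the projector onto states totally symmetric under simultaneous permutations of coordinates and spins (average over $S_N$). For $|s\rangle\in\Sigma$, $|s_i\rangle=\frac1{N!}\sum_{\pi\in S_N,\ \pi(1)=i}\pi|s\rangle$. Hamiltonian, on $\Sigma$-valued smooth functions of $\mathbf x$: $$H_2=-\sum_i\partial_{x_i}^2+2a^2\sum_i\cot(x_i-x_{i-1})\cot(x_i-x_{i+1})+2a\sum_i\csc^2(x_i-x_{i+1})(a-S_{i,i+1}).$$ Gauge factor: $\mu(\mathbf x)=\prod_i|\sin(x_i-x_{i+1})|^a$. Total momentum operator: $P=-\mathrm i\sum_k\partial_{x_k}$; a function has well-defined total momentum if it is an eigenfunction of $P$, and zero momentum means eigenvalue $0$. Algebraic eigenfunctions: let $\mathbf z=(z_1,\dots,z_N)$, $\partial_i=\partial/\partial z_i$, $\sigma_1=\sum_iz_i$, $\tau_k=\sum_{i_1<\dots<i_k}z_{i_1}\cdots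 z_{i_k}$, $J^0=\sum_iz_i\partial_i$, $K_{ij}$ the exchange of $z_i$ and $z_j$, $$T_2=\sum_iz_i^2\partial_i^2+2a\sum_i\frac{z_i^2\partial_i-z_{i+1}^2\partial_{i+1}}{z_i-z_{i+1}}-2a\sum_i\frac{z_iz_{i+1}}{(z_i-z_{i+1})^2}(1-K_{i,i+1}),\qquad \overline H_2=4T_2+4(1-2a)J^0+2Na^2.$$ For $n=0,1,\dots$ let $\mathcal H^n_2$ be the ($\overline H_2$-invariant) span of all $f(\sigma_1,\tau_{N-1},\tau_N)\Lambda|s\rangle$, $g(\tau_{N-1},\tau_N)\Lambda(z_1|s\rangle)$, $\tau_Nq(\sigma_1,\tau_N)\Lambda(z_1^{-1}|s\rangle)$ with $|s\rangle\in\Sigma$, $f,g,q$ polynomials of total degrees in $\mathbf z$ at most $n$, $n-1$, $n-N+1$ respectively, where $f$ has degree at most one in $\sigma_1$ and at most one in $\tau_{N-1}$, $g$ has degree at most one in $\tau_{N-1}$, and $q$ has degree at most one in $\sigma_1$. An algebraic eigenfunction of $H_2$ is a function $\Psi(\mathbf x)=\mu(\mathbf x)\Phi(\mathbf z)|_{z_k=e^{\pm2\mathrm ix_k}}$ (either choice of sign, the same for all $k$), with $\Phi\in\mathcal H^n_2$ for some $n$ an eigenfunction of $\overline H_2$. Two eigenfunctions are called equivalent if they differ by a factor which is a (real) power of $\tau_N$, i.e. by a factor $e^{2\mathrm i\lambda\sum_kx_k}$ with $\lambda\in\mathbb R$. A listed function may vanish identically for special $|s\rangle$; it is an eigenfunction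 when nonzero. *)

(* Defs.v *)
From HB Require Import structures.
From mathcomp Require Import all_boot all_order all_fingroup all_algebra.
From mathcomp Require Import complex.
From mathcomp Require Import all_classical all_reals all_analysis.
(* The notations of mpoly clash with those of mathcomp-analysis. *)
From mathcomp Require Import -(notations) mpoly.

Set Implicit Arguments.
Unset Strict Implicit.
Unset Printing Implicit Defensive.

Import Order.TTheory GRing.Theory Num.Theory.
Import numFieldNormedType.Exports.

Local Open Scope ring_scope.
Local Open Scope complex_scope.

(* The number of particles is N = n.+1, and they are labelled by 'I_n.+1, so
   that the first particle is ord0; [ordS] and [ord_pred] are the cyclic
   successor and predecessor.  The spin is M = m / 2: the spin value
   s_i \in {-M, ..., M} is encoded as the element s_i + M of 'I_m.+1. *)

Definition config (n m : nat) : finType := {ffun 'I_n.+1 -> 'I_m.+1}.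

(* A spin vector is given by its coordinates in the basis |s_1 ... s_N>. *)
Definition spin (R : realType) (n m : nat) := {ffun config n m -> R[i]}.

Section SpinSpace.
Variables (R : realType) (n m : nat).
Local Notation N := n.+1.
Local Notation C := (R[i]).
Local Notation spin := (spin R n m).

(* p |s_1 ... s_N> has s_k in position p k, i.e. it is the basis vector
   s \o p^-1; hence the coordinates of p v are c |-> v (c \o p). *)
Definition spin_perm (p : 'S_N) (v : spin) : spin :=
  [ffun c : config n m => v [ffun k => c (p k)]].

Definition spin_exch (i j : 'I_N) (v : spin) : spin := spin_perm (tperm i j) v.

(* [col_perm p x] has entries x_(p k). With this convention the projector maps
   z_1 |s> to the sum of the z_i |s_i>.  The coordinates are in any type T: it
   is used for both real (x) and complex (z) coordinates. *)
Definition Lambda (T : Type) (F : 'rV[T]_N -> spin) (x : 'rV[T]_N) : spin :=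
  (N`!%:R : C)^-1 *: \sum_(p : 'S_N) spin_perm p (F (col_perm p x)).

Definition spin_at (s : spin) (i : 'I_N) : spin :=
  (N`!%:R : C)^-1 *: \sum_(p : 'S_N | p ord0 == i) spin_perm p s.

End SpinSpace.

Section Model.
Variables (R : realType) (n m : nat).
Local Notation N := n.+1.
Local Notation C := (R[i]).
Local Notation spin := (spin R n m).
Local Notation wavefun := ('rV[R]_N -> spin).

Definition cot (t : R) : R := cos t / sin t.
Definition csc2 (t : R) : R := (sin t ^+ 2)^-1.

Definition gap (x : 'rV[R]_N) (i : 'I_N) : R := x 0 i - x 0 (ordS i).

(* The ordering of the particles does not exclude x_N - x_1 = k pi, which is
   the singularity of the potential coming from the pair (N, 1). *)
Definition domain (x : 'rV[R]_N) : Prop :=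
  [/\ forall i j : 'I_N, (i < j)%N -> x 0 i < x 0 j,
      forall i : 'I_N, (i.+1 < N)%N -> x 0 (ordS i) - x 0 i < pi &
      forall i : 'I_N, sin (gap x i) != 0].

Definition rpartial (i : 'I_N) (f : 'rV[R]_N -> R) : 'rV[R]_N -> R :=
  fun x => 'D_(delta_mx 0 i) f x.

(* All iterated partial derivatives exist and are differentiable. *)
Definition rsmooth (f : 'rV[R]_N -> R) : Prop :=
  forall (l : seq 'I_N) (x : 'rV[R]_N), domain x ->
    differentiable (foldr rpartial f l) x.

Definition smooth (F : wavefun) : Prop :=
  forall c : config n m,
    rsmooth (fun x => complex.Re (F x c)) /\ rsmooth (fun x => complex.Im (F x c)).

Definition partial (i : 'I_N) (F : wavefun) : wavefun := fun x =>
  [ffun c : config n m =>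
     rpartial i (fun y => complex.Re (F y c)) x +i*
     rpartial i (fun y => complex.Im (F y c)) x].

Definition H2 (a : R) (F : wavefun) : wavefun := fun x =>
  - (\sum_i partial i (partial i F) x)
  + (2 * a ^+ 2 * \sum_i cot (x 0 i - x 0 (ord_pred i)) *
                         cot (x 0 i - x 0 (ordS i)))%:C *: F x
  + (2 * a)%:C *: \sum_i (csc2 (gap x i))%:C *:
                         (a%:C *: F x - spin_exch i (ordS i) (F x)).

Definition momentum (F : wavefun) : wavefun := fun x =>
  (- 'i : C) *: \sum_k partial k F x.

Definition nonzero (F : wavefun) : Prop := exists2 x, domain x & F x != 0.

Definition eigenfunction (op : wavefun -> wavefun) (E : C) (F : wavefun) :=
  [/\ smooth F, nonzero F & forall x, domain x -> op F x = E *: F x].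

Definition mu (a : R) (x : 'rV[R]_N) : R := \prod_i (`|sin (gap x i)| `^ a).

Definition xbar (x : 'rV[R]_N) : R := N%:R^-1 * \sum_i x 0 i.

Definition Phi0 (s : spin) : wavefun := Lambda (fun _ : 'rV[R]_N => s).

Definition Psi0 (a : R) (s : spin) : wavefun := fun x =>
  (mu a x)%:C *: Phi0 s x.

Definition Psi1 (a : R) (s : spin) : wavefun := fun x =>
  (mu a x)%:C *: \sum_i (cos (2 * (x 0 i - xbar x)))%:C *: spin_at s i.

Definition Psi2 (a : R) (s : spin) : wavefun := fun x =>
  (mu a x)%:C *: \sum_i (sin (2 * (x 0 i - xbar x)))%:C *: spin_at s i.

Definition Psi3 (a : R) (s : spin) : wavefun := fun x =>
  (mu a x)%:C *:
  ((2 * a / (2 * a + 1))%:C *: Phi0 s x +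
   \sum_i \sum_(j | i != j) (cos (2 * (x 0 i - x 0 j)))%:C *: spin_at s j).

Definition Psi4 (a : R) (s : spin) : wavefun := fun x =>
  (mu a x)%:C *:
   \sum_i \sum_(j | i != j) (sin (2 * (x 0 i - x 0 j)))%:C *: spin_at s j.

Definition E0 (a : R) : R := 2 * N%:R * a ^+ 2.
Definition E12 (a : R) : R := E0 a + 4 * (2 * a + 1 - N%:R^-1).
Definition E34 (a : R) : R := E0 a + 8 * (2 * a + 1).

(* Functions of the complex variables z are considered where all the z_i are
   nonzero and cyclically adjacent ones are distinct. *)
Local Notation zfun := ('rV[C]_N -> spin).

Definition zdomain (z : 'rV[C]_N) : Prop :=
  (forall i, z 0 i != 0) /\ (forall i, z 0 i != z 0 (ordS i)).

(* Complex partial derivative, of a vector with components in C. *)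
Definition zpartial (i : 'I_N) (F : zfun) : zfun := fun z =>
  [ffun c : config n m => 'D_(delta_mx 0 i) (fun w : 'rV[C]_N => F w c : C^o) z].

Definition J0 (F : zfun) : zfun := fun z => \sum_i z 0 i *: zpartial i F z.

Definition exch (i j : 'I_N) (F : zfun) : zfun := fun z => F (xcol i j z).

Definition T2 (a : R) (F : zfun) : zfun := fun z =>
  \sum_i z 0 i ^+ 2 *: zpartial i (zpartial i F) z
  + (2 * a)%:C *: \sum_i (z 0 i - z 0 (ordS i))^-1 *:
      (z 0 i ^+ 2 *: zpartial i F z
       - z 0 (ordS i) ^+ 2 *: zpartial (ordS i) F z)
  - (2 * a)%:C *: \sum_i (z 0 i * z 0 (ordS i) / (z 0 i - z 0 (ordS i)) ^+ 2) *:
      (F z - exch i (ordS i) F z).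

Definition H2bar (a : R) (F : zfun) : zfun := fun z =>
  4%:R *: T2 a F z + (4 * (1 - 2 * a))%:C *: J0 F z + (E0 a)%:C *: F z.

Definition H2bar_eigenfunction (a : R) (E : C) (F : zfun) : Prop :=
  (exists2 z, zdomain z & F z != 0) /\
  (forall z, zdomain z -> H2bar a F z = E *: F z).

Definition sigma1 : mpoly N C := \sum_(i < N) mpolyX C (mnm1 i).
Definition tau (k : nat) : mpoly N C := mesym N C k.

Definition peval (p : mpoly N C) (z : 'rV[C]_N) : C :=
  meval (fun i => z 0 i) p.

(* The degree of f in its variable i is at most one. *)
Definition deg_le1 (k : nat) (i : 'I_k) (f : mpoly k C) : Prop :=
  forall e, e \in msupp f -> (fun_of_multinom e i <= 1)%N.

(* As msize is the degree plus one (and 0 for the zero polynomial), degree at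
   most d reads msize <= d + 1; where the bound d is negative, only the zero
   polynomial is allowed. *)
Inductive Hgen (k : nat) : zfun -> Prop :=
| Hgen_f (f : mpoly 3 C) (s : spin) :
    let p := comp_mpoly [tuple sigma1; tau N.-1; tau N] f in
    (msize p <= k.+1)%N ->
    deg_le1 (inord 0 : 'I_3) f -> deg_le1 (inord 1 : 'I_3) f ->
    Hgen k (fun z => peval p z *: Lambda (fun _ : 'rV[C]_N => s) z)
| Hgen_g (g : mpoly 2 C) (s : spin) :
    let p := comp_mpoly [tuple tau N.-1; tau N] g in
    (msize p <= k)%N ->
    deg_le1 (inord 0 : 'I_2) g ->
    Hgen k (fun z => peval p z *: Lambda (fun w : 'rV[C]_N => w 0 ord0 *: s) z)
| Hgen_q (q : mpoly 2 C) (s : spin) :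
    let p := comp_mpoly [tuple sigma1; tau N] q in
    (msize p <= k.+2 - N)%N ->
    deg_le1 (inord 0 : 'I_2) q ->
    Hgen k (fun z => (peval (tau N) z * peval p z) *:
                     Lambda (fun w : 'rV[C]_N => (w 0 ord0)^-1 *: s) z).

Definition Hspace (k : nat) (F : zfun) : Prop :=
  exists (r : nat) (c : 'I_r -> C) (G : 'I_r -> zfun),
    (forall l, Hgen k (G l)) /\
    (forall z, zdomain z -> F z = \sum_l c l *: G l z).

(* exp (i t) *)
Definition cis (t : R) : C := cos t +i* sin t.

Definition expz (b : bool) (x : 'rV[R]_N) : 'rV[C]_N :=
  \row_k cis ((-1) ^+ b * (2 * x 0 k)).

Definition algebraic_eigenfunction (a : R) (F : wavefun) : Prop :=
  exists (b : bool) (k : nat) (E : C) (Phi : zfun),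
    [/\ Hspace k Phi, H2bar_eigenfunction a E Phi &
        forall x, domain x -> F x = (mu a x)%:C *: Phi (expz b x)].

Definition has_momentum (F : wavefun) : Prop :=
  exists p : C, eigenfunction momentum p F.

Definition H2_eigenfunction (a : R) (F : wavefun) : Prop :=
  exists E : C, eigenfunction (H2 a) E F.

Definition equivalent (a : R) (F G : wavefun) : Prop :=
  [/\ H2_eigenfunction a F, H2_eigenfunction a G &
      exists lambda : R, forall x, domain x ->
        F x = cis (2 * lambda * \sum_k x 0 k) *: G x].

End Model.

(* Main.v *)
(* Conjugating by mu replaces the singular scalar potential of H_2 by the
   constant E_0: H_2 (mu G) = mu H G, where H is the Laplacian plus, for each
   bond (i, i+1), the operator - 2a cot (d_i - d_(i+1)) + 2a csc^2 (1 - S_(i,i+1)).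
   On \sum_k z_k s_k and on (\sum_j z_j) (\sum_k s_k / z_k) the poles of each
   bond term cancel, so that H acts on these sums as a scalar, up to a multiple
   of Lambda s in the second case; this gives Psi_0, ..., Psi_4.

   Conversely, up to powers of tau_N the invariant spaces are spanned by
   Lambda s, \sum z_i s_i, \sum s_i / z_i, \sum (z_i / z_j) s_i and
   \sum (z_i / z_j) s_j, which are homogeneous. A state with well-defined
   momentum only involves terms of a single degree d; removing the phase
   exp (2i d xbar) turns all of them into combinations of Psi_0, ..., Psi_4.
   This factor changes the energy by a constant, since the momentum is
   well-defined, and so the combination is itself an eigenfunction. *)

Require Import Defs.
From mathcomp Require Import all_boot all_order all_fingroup all_algebra.
From mathcomp Require Import complex ring lra.
From mathcomp Require Import all_classical all_reals all_analysis.
From mathcomp Require Import -(notations) mpoly.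
Import Order.TTheory GRing.Theory Num.Theory.
Import numFieldNormedType.Exports.
Set Implicit Arguments.
Unset Strict Implicit.
Unset Printing Implicit Defensive.
Local Open Scope ring_scope.
Local Open Scope complex_scope.

(** * Real calculus *)


(** [H2] differentiates real and imaginary parts in the real variables x, [H2bar] takes complex
    derivatives in z. No chain rule links the two: each operator is evaluated in closed form on
    finite sums of monomials, which are plane waves at z_k = exp(+-2i x_k), and the results are
    compared term by term. The constants arise as follows. A wave exp(2i q.x) has kinetic energy 4
    |q|^2, which is 4 (1 - 1/N) for x_j - xbar and 8 for x_j - x_k with j != k. The bonds add 8a and
    16a, since every particle lies on two bonds. In the full pair sum the terms j = k have kinetic
    energy 0 instead of 8, which leaves - 8 Lambda s; as E_34 - E_0 = 8 (2a + 1), subtracting Lambda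
    s / (2a + 1) repairs this. In the converse, terms of different elements may cancel each other,
    so the momentum does not determine the single terms but only their total in each degree. A
    common translation of the particles isolates these totals: it multiplies degree d by the d-th
    power of a point of the unit circle. *)

Lemma near_eq_differentiable (K : numFieldType) (V W : normedModType K)
    (f g : V -> W) (x : V) :
  (\forall y \near x, f y = g y) -> differentiable f x -> differentiable g x.
Proof.
move=> fg d.
have [dc de] := (diff_locallyP _ _).1 d.
have fg0 : \forall h \near (0 : V), f (h + x) = g (h + x).
  have := fg; rewrite (near_shift 0 x).
  by apply: filterS => h /=; rewrite subr0.
(* The expansion of f serves for g as well, so ['d f x] is a differential of g; [diff_unique] then
   identifies it with ['d g x]. *)
have de' : g \o shift x = cst (g x) + 'd f x +o_ 0 id.
  apply/eqaddoP => eps eps0.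
  have /eqaddoP/(_ eps eps0) := de.
  apply: filterS2 fg0 => h /=.
  by rewrite -![(_ - _) _]/(_ - (_ + _)) /= => <-; rewrite -(nbhs_singleton fg).
by apply/diff_locallyP; rewrite (diff_unique dc de'); split.
Qed.

Lemma near_forall (K : numFieldType) (n : nat) (I : finType)
    (P : I -> 'rV[K]_n -> Prop) (z : 'rV[K]_n) :
  (forall i, \forall y \near z, P i y) -> \forall y \near z, forall i, P i y.
Proof. by move=> h; have := @filter_forall _ I P (nbhs z) _ h; exact. Qed.

Lemma derive_coord (K : numFieldType) (n : nat) (i k : 'I_n) (z : 'rV[K]_n) :
  'D_(delta_mx 0 i) (fun w : 'rV[K]_n => w 0 k : K^o) z = (k == i)%:R.
Proof.
rewrite deriveE; last exact: differentiable_coord.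
have @f : {linear 'rV[K]_n -> K^o}.
  by exists (fun w : 'rV[K]_n => w 0 k); do 2![eexists]; do ?[constructor];
     rewrite ?mxE// => ? *; rewrite ?mxE//; move=> ?; rewrite !mxE.
rewrite (_ : (fun w : 'rV_n => w 0 k) = f) // diff_lin; last exact: coord_continuous.
by rewrite /= mxE eqxx.
Qed.

Section RealCalculus.
Variables (R : realType) (n : nat).
Local Notation N := n.+1.
Implicit Types (f g : 'rV[R]_N -> R) (x : 'rV[R]_N) (q : 'I_N -> R).

(** Differentiability is carried along with the partial derivatives because [rsmooth] asks for it at
    every order and the product and chain rules rely on it. *)
Definition has_grad f x (df : 'I_N -> R) :=
  differentiable f x /\ forall i, rpartial i f x = df i.

Lemma has_grad_eq f x df df' : has_grad f x df -> df =1 df' -> has_grad f x df'.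
Proof. by case=> d e ee; split=> // i; rewrite e ee. Qed.

Lemma has_grad_near f g x df :
  (\forall y \near x, f y = g y) -> has_grad f x df -> has_grad g x df.
Proof.
move=> fg [d e]; split; last first.
  by move=> i; rewrite -e /rpartial; apply/esym/near_eq_derive.
exact: near_eq_differentiable fg d.
Qed.

Lemma has_grad_cst (c : R) x : has_grad (fun=> c) x (fun=> 0).
Proof. by split=> [|i]; [exact: differentiable_cst|exact: derive_cst]. Qed.

Lemma has_grad_coord (j : 'I_N) x :
  has_grad (fun y => y 0 j) x (fun i => (i == j)%:R).
Proof.
split=> [|i]; first exact: differentiable_coord.
by rewrite /rpartial derive_coord eq_sym.
Qed.

Lemma has_gradD f g x df dg : has_grad f x df -> has_grad g x dg ->
  has_grad (fun y => f y + g y) x (fun i => df i + dg i).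
Proof.
move=> [d e] [d' e']; split=> [|i]; first exact: differentiableD.
by rewrite -e -e' -deriveD //; exact: diff_derivable.
Qed.

Lemma has_gradM f g x df dg : has_grad f x df -> has_grad g x dg ->
  has_grad (fun y => f y * g y) x (fun i => df i * g x + f x * dg i).
Proof.
move=> [d e] [d' e']; split=> [|i]; first exact: differentiableM.
rewrite -e -e' /rpartial deriveM; [|exact: diff_derivable..].
by rewrite addrC mulrC.
Qed.

Lemma has_grad_comp f (h : R -> R) x df dh :
  has_grad f x df -> is_derive (f x) 1 h dh ->
  has_grad (fun y => h (f y)) x (fun i => dh * df i).
Proof.
move=> [d e] [e1 e2].
have d2 : differentiable h (f x) by apply/derivable1_diffP.
split=> [|i]; first exact: differentiable_comp.
rewrite /rpartial deriveE; last exact: differentiable_comp.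
rewrite diff_comp //= -e /rpartial deriveE // -e2 deriv1E //= derive1E mulrC.
done.
Qed.

Lemma has_grad_sum (I : Type) (r : seq I) (F : I -> 'rV[R]_N -> R) x dF :
  (forall i, has_grad (F i) x (dF i)) ->
  has_grad (fun y => \sum_(i <- r) F i y) x (fun k => \sum_(i <- r) dF i k).
Proof.
move=> h; elim: r => [|i r IH].
  have -> : (fun y => \sum_(i <- [::]) F i y) = (fun=> 0 : R).
    by apply/funext => y; rewrite big_nil.
  by apply: has_grad_eq (has_grad_cst _ _) _ => k; rewrite big_nil.
have -> : (fun y => \sum_(j <- i :: r) F j y) = (fun y => F i y + \sum_(j <- r) F j y).
  by apply/funext => y; rewrite big_cons.
by apply: has_grad_eq (has_gradD (h i) IH) _ => k; rewrite big_cons.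
Qed.

Definition lin q x : R := \sum_k q k * x 0 k.

Lemma has_grad_lin q x : has_grad (lin q) x q.
Proof.
apply: has_grad_eq (has_grad_sum _ (fun k =>
  has_gradM (has_grad_cst (q k) x) (has_grad_coord k x))) _ => i /=.
rewrite (bigD1 i) //= eqxx mul0r add0r mulr1 big1 ?addr0 // => j ji.
by rewrite eq_sym (negbTE ji) mul0r mulr0 addr0.
Qed.

Lemma sum_delta (A : pzRingType) (F : 'I_N -> A) i : \sum_k (k == i)%:R * F k = F i.
Proof.
rewrite (bigD1 i) //= eqxx mul1r big1 ?addr0 // => j ji.
by rewrite (negbTE ji) mul0r.
Qed.

Definition gap_form (i k : 'I_N) : R := (k == i)%:R - (k == ordS i)%:R.

Lemma gapE x i : gap x i = lin (gap_form i) x.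
Proof.
rewrite /lin /gap_form /gap; under eq_bigr do rewrite mulrBl.
by rewrite sumrB !sum_delta.
Qed.

Lemma linD q q' x : lin (fun k => q k + q' k) x = lin q x + lin q' x.
Proof. by rewrite /lin -big_split; apply: eq_bigr => k _; rewrite mulrDl. Qed.

(** The domain is open, being cut out by finitely many strict conditions on continuous functions.
    Functions that agree on it therefore have the same derivatives there. *)
Lemma domain_nbhs x : domain x -> \forall y \near x, domain y.
Proof.
have cc i : {for x, continuous (fun y : 'rV[R]_N => y 0 i)}.
  exact: coord_continuous.
move=> [d1 d2 d3].
have h1 : \forall y \near x, forall i j : 'I_N, (i < j)%N -> (y : 'rV[R]_N) 0 i < y 0 j.
  apply: (@near_forall R N 'I_N (fun i y => forall j : 'I_N, (i < j)%N -> y 0 i < y 0 j)) => i.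
  apply: (@near_forall R N 'I_N (fun j y => (i < j)%N -> y 0 i < y 0 j)) => j.
  case: (boolP (i < j)%N) => [ij|_]; last by apply: (@filterE _ (nbhs x)).
  have c : {for x, continuous (fun y : 'rV[R]_N => y 0 j - y 0 i)} by exact: continuousB.
  have c0 : 0 < x 0 j - x 0 i by rewrite subr_gt0 d1.
  apply: (@filterS _ (nbhs x) _ _ _ _ (cvgr_gt _ c _ c0)) => y.
  by rewrite subr_gt0.
have h2 : \forall y \near x, forall i : 'I_N, (i.+1 < N)%N -> (y : 'rV[R]_N) 0 (ordS i) - y 0 i < pi.
  apply: (@near_forall R N 'I_N (fun i y => (i.+1 < N)%N -> y 0 (ordS i) - y 0 i < pi)) => i.
  case: (boolP (i.+1 < N)%N) => [ij|_]; last by apply: (@filterE _ (nbhs x)).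
  have c : {for x, continuous (fun y : 'rV[R]_N => y 0 (ordS i) - y 0 i)} by exact: continuousB.
  exact: (@filterS _ (nbhs x) _ _ _ _ (cvgr_lt _ c _ (d2 i ij))).
have h3 : \forall y \near x, forall i : 'I_N, sin (gap (y : 'rV[R]_N) i) != 0.
  apply: (@near_forall R N 'I_N (fun i y => sin (gap y i) != 0)) => i.
  have c : {for x, continuous (fun y : 'rV[R]_N => sin (gap y i))}.
    apply: (@continuous_comp _ _ _ (fun y : 'rV[R]_N => gap y i) sin); last exact: continuous_sin.
    exact: continuousB.
  exact: (cvgr_neq0 _ c (d3 i)).
by apply: (@filterS3 _ (nbhs x) _ _ _ _ _ _ h1 h2 h3) => y ? ? ?; split.
Qed.

(** Writing |t|^a as (t^2)^(a/2) avoids a case distinction on the sign of t. *)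
Lemma is_derive_norm_powR (a s : R) : s != 0 ->
  is_derive s 1 (fun t : R => `|t| `^ a) (a * `|s| `^ a / s).
Proof.
move=> s0.
have -> : (fun t : R => `|t| `^ a) = (fun u => u `^ (a / 2)) \o (fun t : R => t ^+ 2).
  apply/funext => t /=; rewrite -real_normK ?num_real // -powR_mulrn //.
  by rewrite -powRrM mulrC divfK // pnatr_eq0.
have s2 : 0 < s ^+ 2 by rewrite exprn_even_gt0.
have e : is_derive s 1 (fun t : R => t ^+ 2) (2 * s).
  have := is_deriveX 2 (is_derive_id s (1 : R)).
  by rewrite /= expr1 [_ *: _]mulr1.
have [e1 e2] := e.
have [e3 e4] := is_derive1_powR (a / 2) s2.
split.
  by apply/derivable1_diffP/differentiable_comp; apply/derivable1_diffP.
rewrite -derive1E derive1_comp // !derive1E e2 e4.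
rewrite powRB; last by apply/implyP => _; rewrite gt_eqF.
rewrite powRr1 ?(ltW s2) //.
have -> : (s ^+ 2) `^ (a / 2) = `|s| `^ a.
  rewrite -real_normK ?num_real // -powR_mulrn // -powRrM mulrC divfK //.
by field.
Qed.

(** Logarithmic differentiation: each bond contributes a cot times the gradient of its gap. The
    induction runs over lists of bonds. *)
Lemma has_grad_mu a x : domain x ->
  has_grad (mu a) x (fun k => mu a x * (a * \sum_i gap_form i k * cot (gap x i))).
Proof.
move=> [_ _ d].
have h1 i : has_grad (fun y => `|sin (gap y i)| `^ a) x
   (fun k => `|sin (gap x i)| `^ a * (a * (gap_form i k * cot (gap x i)))).
  have -> : (fun y => `|sin (gap y i)| `^ a) = (fun y => `|sin (lin (gap_form i) y)| `^ a).
    by apply/funext => y; rewrite gapE.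
  apply: has_grad_eq (has_grad_comp (has_grad_comp (has_grad_lin _ x) (is_derive_sin _))
     (is_derive_norm_powR a _)) _.
    by rewrite -gapE.
  by move=> k; rewrite -!gapE /cot; field; exact: d.
suff h2 (r : seq 'I_N) : has_grad (fun y => \prod_(i <- r) `|sin (gap y i)| `^ a) x
   (fun k => (\prod_(i <- r) `|sin (gap x i)| `^ a) *
             (a * \sum_(i <- r) gap_form i k * cot (gap x i))) by exact: h2.
elim: r => [|i r IH].
  have -> : (fun y : 'rV[R]_N => \prod_(i <- [::]) `|sin (gap y i)| `^ a) = (fun=> 1 : R).
    by apply/funext => y; rewrite big_nil.
  by apply: has_grad_eq (has_grad_cst _ _) _ => k; rewrite !big_nil !mulr0.
have -> : (fun y => \prod_(j <- i :: r) `|sin (gap y j)| `^ a) =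
  (fun y => `|sin (gap y i)| `^ a * \prod_(j <- r) `|sin (gap y j)| `^ a).
  by apply/funext => y; rewrite big_cons.
by apply: has_grad_eq (has_gradM (h1 i) IH) _ => k; rewrite !big_cons /=; ring.
Qed.

(* Being closed under partial derivatives, this class consists of smooth
   functions as soon as its members are differentiable. *)
Inductive Sm : ('rV[R]_N -> R) -> Prop :=
| Sm_cst c : Sm (fun=> c)
| Sm_cos q : Sm (fun x => cos (lin q x))
| Sm_sin q : Sm (fun x => sin (lin q x))
| Sm_isin i : Sm (fun x => (sin (gap x i))^-1)
| Sm_mu a : Sm (mu a)
| Sm_add f g : Sm f -> Sm g -> Sm (fun x => f x + g x)
| Sm_mul f g : Sm f -> Sm g -> Sm (fun x => f x * g x)
| Sm_ext f g : (forall x, domain x -> f x = g x) -> Sm f -> Sm g.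

Lemma Sm_sum (I : Type) (r : seq I) (F : I -> 'rV[R]_N -> R) :
  (forall i, Sm (F i)) -> Sm (fun x => \sum_(i <- r) F i x).
Proof.
move=> h; elim: r => [|i r IH].
  by apply: Sm_ext (Sm_cst 0) => x _; rewrite big_nil.
by apply: Sm_ext (Sm_add (h i) IH) => x _; rewrite big_cons.
Qed.

Lemma Sm_cot i : Sm (fun x => cot (gap x i)).
Proof.
by apply: Sm_ext (Sm_mul (Sm_cos (gap_form i)) (Sm_isin i)) => x _; rewrite -gapE.
Qed.

Lemma has_grad_cos q x :
  has_grad (fun y => cos (lin q y)) x (fun i => - q i * sin (lin q x)).
Proof.
by apply: has_grad_eq (has_grad_comp (has_grad_lin q x) (is_derive_cos _)) _ => i; ring.
Qed.

Lemma has_grad_sin q x :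
  has_grad (fun y => sin (lin q y)) x (fun i => q i * cos (lin q x)).
Proof.
by apply: has_grad_eq (has_grad_comp (has_grad_lin q x) (is_derive_sin _)) _ => i; ring.
Qed.

Lemma is_derive_inv (s : R) : s != 0 -> is_derive s 1 (fun t : R => t^-1) (- (s ^+ 2)^-1).
Proof.
move=> s0; have e : derivable (id : R -> R) s 1 by exact: derivable_id.
split; first exact: (derivableV s0 e).
by have := deriveV s0 e; rewrite derive_id /= [X in _ = X]mulr1.
Qed.

Lemma has_grad_isin i x : domain x ->
  has_grad (fun y => (sin (gap y i))^-1) x
    (fun k => - (gap_form i k * cos (gap x i)) / sin (gap x i) ^+ 2).
Proof.
move=> [_ _ d].
have -> : (fun y => (sin (gap y i))^-1) = (fun y => (sin (lin (gap_form i) y))^-1).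
  by apply/funext => y; rewrite gapE.
apply: has_grad_eq (has_grad_comp (has_grad_sin _ x) (is_derive_inv _)) _.
  by rewrite -gapE.
by move=> k; rewrite -!gapE; ring.
Qed.

(** The class contains 1/sin of the gaps because differentiating [mu] produces cot. The gradient
    formulas hold on the domain only, so the class is closed under equality there; in that case
    openness makes the two functions agree near x. *)
Lemma Sm_grad f : Sm f ->
  exists2 df : 'I_N -> 'rV[R]_N -> R, forall i, Sm (df i) &
    forall x, domain x -> has_grad f x (df ^~ x).
Proof.
elim=> {f}.
- by move=> c; exists (fun _ _ => 0) => [i|x _]; [exact: Sm_cst|exact: has_grad_cst].
- move=> q; exists (fun i x => - q i * sin (lin q x)) => [i|x _]; last exact: has_grad_cos.
  by apply: Sm_mul; [exact: Sm_cst|exact: Sm_sin].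
- move=> q; exists (fun i x => q i * cos (lin q x)) => [i|x _]; last exact: has_grad_sin.
  by apply: Sm_mul; [exact: Sm_cst|exact: Sm_cos].
- move=> i; exists (fun k x => - (gap_form i k * cos (gap x i)) / sin (gap x i) ^+ 2) => [k|x].
    apply: Sm_ext (Sm_mul (Sm_cst (- gap_form i k)) (Sm_mul (Sm_cos (gap_form i))
       (Sm_mul (Sm_isin i) (Sm_isin i)))) => x [_ _ d].
    by rewrite -gapE; field; exact: d.
  exact: has_grad_isin.
- move=> a; exists (fun k x => mu a x * (a * \sum_i gap_form i k * cot (gap x i))) => [k|x]; last exact: has_grad_mu.
  apply: Sm_mul; first exact: Sm_mu.
  apply: Sm_mul; first exact: Sm_cst.
  by apply: Sm_sum => i; apply: Sm_mul; [exact: Sm_cst|exact: Sm_cot].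
- move=> f g _ [df sf hf] _ [dg sg hg].
  exists (fun i x => df i x + dg i x) => [i|x dx]; first exact: Sm_add.
  exact: has_gradD (hf x dx) (hg x dx).
- move=> f g Sf [df sf hf] Sg [dg sg hg].
  exists (fun i x => df i x * g x + f x * dg i x) => [i|x dx].
    by apply: Sm_add; exact: Sm_mul.
  exact: has_gradM (hf x dx) (hg x dx).
- move=> f g fg _ [df sf hf]; exists df => // x dx.
  apply: has_grad_near (hf x dx).
  by apply: filterS (domain_nbhs dx) => y /fg.
Qed.

Lemma Sm_partial f i : Sm f -> Sm (rpartial i f).
Proof.
by move=> /Sm_grad[df sf hf]; apply: Sm_ext (sf i) => x /hf[_ ->].
Qed.

Lemma Sm_diff f x : Sm f -> domain x -> differentiable f x.
Proof. by move=> /Sm_grad[df _ hf] /hf[]. Qed.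

Lemma Sm_rsmooth f : Sm f -> rsmooth f.
Proof.
move=> sf l x dx; apply: Sm_diff dx.
by elim: l => //= i l IH; exact: Sm_partial.
Qed.

Lemma has_grad_Sm f x : Sm f -> domain x -> has_grad f x (fun i => rpartial i f x).
Proof. by move=> sf dx; split=> //; exact: Sm_diff. Qed.

End RealCalculus.

(** * The gauge transformation *)


Section ComplexCalculus.
Variables (R : realType) (n : nat).
Local Notation N := n.+1.
Local Notation C := (R[i]).
Implicit Types (f g : 'rV[R]_N -> C) (x : 'rV[R]_N) (q : 'I_N -> R).

Lemma complexP (u v : C) : complex.Re u = complex.Re v -> complex.Im u = complex.Im v -> u = v.
Proof. by case: u v => [? ?] [? ?] /= -> ->. Qed.

Lemma ReM (u v : C) :
  complex.Re (u * v) = complex.Re u * complex.Re v - complex.Im u * complex.Im v.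
Proof. by case: u v => [? ?] [? ?]. Qed.

Lemma ImM (u v : C) :
  complex.Im (u * v) = complex.Re u * complex.Im v + complex.Im u * complex.Re v.
Proof. by case: u v => [? ?] [? ?]. Qed.

Definition SmC f := Sm (fun x => complex.Re (f x)) /\ Sm (fun x => complex.Im (f x)).

(** One component of [partial]: the operators are computed on scalar functions, configuration by
    configuration. *)
Definition cpart i f x : C :=
  rpartial i (fun y => complex.Re (f y)) x +i* rpartial i (fun y => complex.Im (f y)) x.

Lemma SmC_cst (c : C) : SmC (fun=> c).
Proof. by split; exact: Sm_cst. Qed.

Lemma SmC_real (f : 'rV[R]_N -> R) : Sm f -> SmC (fun x => (f x)%:C).
Proof. by split=> //; exact: Sm_cst. Qed.

Lemma SmC_ext f g : (forall x, domain x -> f x = g x) -> SmC f -> SmC g.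
Proof.
by move=> fg [h1 h2]; split; [apply: Sm_ext h1|apply: Sm_ext h2] => x /fg ->.
Qed.

Lemma SmCD f g : SmC f -> SmC g -> SmC (fun x => f x + g x).
Proof.
move=> [f1 f2] [g1 g2]; split.
  by apply: Sm_ext (Sm_add f1 g1) => x _; rewrite raddfD.
by apply: Sm_ext (Sm_add f2 g2) => x _; rewrite raddfD.
Qed.

Lemma SmCM f g : SmC f -> SmC g -> SmC (fun x => f x * g x).
Proof.
move=> [f1 f2] [g1 g2]; split.
  apply: Sm_ext (Sm_add (Sm_mul f1 g1) (Sm_mul (Sm_cst n (-1)) (Sm_mul f2 g2))) => x _.
  by rewrite ReM mulN1r.
by apply: Sm_ext (Sm_add (Sm_mul f1 g2) (Sm_mul f2 g1)) => x _; rewrite ImM.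
Qed.

Lemma SmC_sum (I : Type) (r : seq I) (F : I -> 'rV[R]_N -> C) :
  (forall i, SmC (F i)) -> SmC (fun x => \sum_(i <- r) F i x).
Proof.
move=> h; elim: r => [|i r IH].
  by apply: SmC_ext (SmC_cst 0) => x _; rewrite big_nil.
by apply: SmC_ext (SmCD (h i) IH) => x _; rewrite big_cons.
Qed.

Lemma SmC_cpart i f : SmC f -> SmC (cpart i f).
Proof. by move=> [f1 f2]; split; exact: Sm_partial. Qed.

Lemma cpart_ext i f g x : domain x -> (forall y, domain y -> f y = g y) ->
  cpart i f x = cpart i g x.
Proof.
move=> dx fg; have fg' : \forall y \near x, f y = g y.
  by apply: (@filterS _ (nbhs x) _ _ _ _ (domain_nbhs dx)) => y; exact: fg.
by congr (_ +i* _); apply: near_eq_derive;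
  apply: (@filterS _ (nbhs x) _ _ _ _ fg') => y ->.
Qed.

Lemma cpart_cst i (c : C) x : cpart i (fun=> c) x = 0.
Proof.
by rewrite /cpart !(has_grad_cst _ _).2.
Qed.

Lemma cpart_real i (f : 'rV[R]_N -> R) x : cpart i (fun y => (f y)%:C) x = (rpartial i f x)%:C.
Proof. by rewrite /cpart (has_grad_cst _ _).2. Qed.

Lemma cpartD i f g x : SmC f -> SmC g -> domain x ->
  cpart i (fun y => f y + g y) x = cpart i f x + cpart i g x.
Proof.
move=> [f1 f2] [g1 g2] dx; apply: complexP; rewrite raddfD /=.
  under [in X in rpartial _ X _]eq_fun do rewrite raddfD.
  by rewrite (has_gradD (has_grad_Sm f1 dx) (has_grad_Sm g1 dx)).2.
under [in X in rpartial _ X _]eq_fun do rewrite raddfD.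
by rewrite (has_gradD (has_grad_Sm f2 dx) (has_grad_Sm g2 dx)).2.
Qed.

Lemma cpartM i f g x : SmC f -> SmC g -> domain x ->
  cpart i (fun y => f y * g y) x = cpart i f x * g x + f x * cpart i g x.
Proof.
move=> [f1 f2] [g1 g2] dx.
have [Gf1 Gf2 Gg1 Gg2] := And4 (has_grad_Sm f1 dx) (has_grad_Sm f2 dx)
  (has_grad_Sm g1 dx) (has_grad_Sm g2 dx).
apply: complexP; rewrite raddfD /= !(ReM, ImM) /=.
  have -> : (fun y => complex.Re (f y * g y)) = (fun y => complex.Re (f y) * complex.Re (g y)
     + (-1) * (complex.Im (f y) * complex.Im (g y))).
    by apply/funext => y; rewrite ReM mulN1r.
  rewrite (has_gradD (has_gradM Gf1 Gg1) (has_gradM (has_grad_cst (-1) x) (has_gradM Gf2 Gg2))).2 /=.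
  by ring.
have -> : (fun y => complex.Im (f y * g y)) = (fun y => complex.Re (f y) * complex.Im (g y)
     + (complex.Im (f y) * complex.Re (g y))).
  by apply/funext => y; rewrite ImM.
rewrite (has_gradD (has_gradM Gf1 Gg2) (has_gradM Gf2 Gg1)).2 /=.
by ring.
Qed.

Lemma cpart_sum i (I : Type) (r : seq I) (F : I -> 'rV[R]_N -> C) x :
  (forall i, SmC (F i)) -> domain x ->
  cpart i (fun x => \sum_(j <- r) F j x) x = \sum_(j <- r) cpart i (F j) x.
Proof.
move=> h dx; elim: r => [|j r IH].
  rewrite big_nil -[RHS](cpart_cst i 0 x); apply: cpart_ext => // y _.
  by rewrite big_nil.
rewrite big_cons -IH -cpartD //; last exact: SmC_sum.
by apply: cpart_ext => // y _; rewrite big_cons.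
Qed.

Lemma cisD (s t : R) : cis (s + t) = cis s * cis t.
Proof.
by rewrite /cis cosD sinD; apply: complexP; rewrite ?ReM ?ImM //= addrC.
Qed.

Lemma cis0 : cis (0 : R) = 1.
Proof. by rewrite /cis cos0 sin0. Qed.

Lemma cisX (t : R) k : cis t ^+ k = cis (k%:R * t).
Proof.
elim: k => [|k IH]; first by rewrite mul0r cis0 expr0.
by rewrite exprS IH -cisD -[k.+1]add1n natrD mulrDl mul1r.
Qed.

Lemma cis_sum (I : Type) (r : seq I) (f : I -> R) :
  cis (\sum_(i <- r) f i) = \prod_(i <- r) cis (f i).
Proof. by apply: (big_morph (@cis R)); [exact: cisD|exact: cis0]. Qed.

(** The factor 2 turns integer q into monomials in z_k = exp(2i x_k); real q also allow fractional
    powers of tau_N, such as exp(2i xbar). *)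
Definition wave q x : C := cis (2 * lin q x).

Lemma waveD q q' x : wave (fun k => q k + q' k) x = wave q x * wave q' x.
Proof. by rewrite /wave linD mulrDr cisD. Qed.

Lemma lin_scale (c : R) q x : lin (fun k => c * q k) x = c * lin q x.
Proof. by rewrite /lin mulr_sumr; apply: eq_bigr => k _; rewrite mulrA. Qed.

Lemma wave_cos_sin q x : wave q x =
  cos (lin (fun k => 2 * q k) x) +i* sin (lin (fun k => 2 * q k) x).
Proof. by rewrite /wave /cis lin_scale. Qed.

Lemma SmC_wave q : SmC (wave q).
Proof.
split.
  by apply: Sm_ext (Sm_cos (fun k => 2 * q k)) => x _; rewrite wave_cos_sin.
by apply: Sm_ext (Sm_sin (fun k => 2 * q k)) => x _; rewrite wave_cos_sin.
Qed.

Lemma cpart_wave i q x : cpart i (wave q) x = (2 * q i)%:C * 'i * wave q x.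
Proof.
rewrite /cpart.
have -> : (fun y => complex.Re (wave q y)) = (fun y => cos (lin (fun k => 2 * q k) y)).
  by apply/funext => y; rewrite wave_cos_sin.
have -> : (fun y => complex.Im (wave q y)) = (fun y => sin (lin (fun k => 2 * q k) y)).
  by apply/funext => y; rewrite wave_cos_sin.
rewrite (has_grad_cos _ x).2 (has_grad_sin _ x).2 wave_cos_sin.
by apply: complexP => /=; ring.
Qed.

Lemma gap_form_sumr (F : 'I_N -> C) i :
  \sum_k (gap_form R i k)%:C * F k = F i - F (ordS i).
Proof.
rewrite /gap_form; under eq_bigr do rewrite rmorphB /= mulrBl !rmorph_nat.
by rewrite sumrB !sum_delta.
Qed.

Lemma gap_form_suml (F : 'I_N -> R) k :
  \sum_i gap_form R i k * F i = F k - F (ord_pred k).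
Proof.
rewrite /gap_form; under eq_bigr do rewrite mulrBl.
rewrite sumrB; congr (_ - _); rewrite -[RHS]sum_delta.
  by apply: eq_bigr => i _; rewrite eq_sym.
apply: eq_bigr => i _; congr (_%:R * _).
by congr nat_of_bool; apply/eqP/eqP => [->|->]; rewrite ?ordSK ?ord_predK.
Qed.

Lemma rpartial_cot i k x : domain x ->
  rpartial k (fun y => cot (gap y i)) x = - gap_form R i k * csc2 (gap x i).
Proof.
move=> dx; have [_ _ d] := dx.
have -> : (fun y : 'rV[R]_N => cot (gap y i)) =
    (fun y => cos (lin (gap_form R i) y) * (sin (gap y i))^-1).
  by apply/funext => y; rewrite -gapE.
rewrite (has_gradM (has_grad_cos _ x) (has_grad_isin i dx)).2 -gapE /csc2.
apply: (@mulIf _ (sin (gap x i) ^+ 2)); first by rewrite expf_neq0.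
rewrite mulfVK ?expf_neq0 //.
transitivity (- gap_form R i k * (cos (gap x i) ^+ 2 + sin (gap x i) ^+ 2)).
  by field; exact: d.
by rewrite cos2Dsin2 mulr1.
Qed.

(** The logarithmic derivative of [mu] with respect to x_k. *)
Definition Lmu (a : R) k x : R := a * \sum_i gap_form R i k * cot (gap x i).

Lemma Sm_Lmu a k : Sm (Lmu a k).
Proof.
apply: Sm_mul; first exact: Sm_cst.
by apply: Sm_sum => i; apply: Sm_mul; [exact: Sm_cst|exact: Sm_cot].
Qed.

Lemma rpartial_mu a k x : domain x -> rpartial k (mu a) x = mu a x * Lmu a k x.
Proof. by move=> dx; rewrite (has_grad_mu a dx).2. Qed.

Lemma rpartial_Lmu a k x : domain x ->
  rpartial k (Lmu a k) x = - a * \sum_i gap_form R i k ^+ 2 * csc2 (gap x i).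
Proof.
move=> dx; rewrite /Lmu.
have H i : has_grad (fun y => gap_form R i k * cot (gap y i)) x
   (fun l => 0 * cot (gap x i) + gap_form R i k * rpartial l (fun y => cot (gap y i)) x).
  apply: has_gradM (has_grad_cst _ _) (has_grad_Sm _ dx); exact: Sm_cot.
rewrite (has_gradM (has_grad_cst a x) (has_grad_sum _ H)).2 mul0r add0r mulNr -mulrN; congr (_ * _).
rewrite -sumrN; apply: eq_bigr => i _; rewrite rpartial_cot //; ring.
Qed.

(** [mu] depends on differences of coordinates only, so a common translation leaves it fixed. This
    is why the gauge factor commutes with the total momentum. *)
Lemma sum_Lmu a x : \sum_k Lmu a k x = 0.
Proof.
rewrite -mulr_sumr exchange_big big1 ?mulr0 // => i _; rewrite -mulr_suml.
under eq_bigr do rewrite -[gap_form R i _]mulr1.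
have := @gap_form_sumr (fun=> 1) i; rewrite subrr => h.
have -> : \sum_k gap_form R i k * 1 = 0.
  apply: (@complexI R); rewrite rmorph_sum -[RHS]h; apply: eq_bigr => k _.
  by rewrite !mulr1.
by rewrite mul0r.
Qed.

Hypothesis n_gt0 : (0 < n)%N.

Lemma ordS_neq (i : 'I_N) : ordS i != i.
Proof.
apply/eqP => /(congr1 val) /=.
have := ltn_ord i; rewrite leq_eqVlt => /orP[/eqP [->]|h].
  by rewrite modnn => h; move: n_gt0; rewrite h ltnn.
rewrite modn_small // => /eqP; by rewrite eqn_leq ltnn.
Qed.

Lemma sum_gap_form_sq (i : 'I_N) : \sum_k gap_form R i k ^+ 2 = 2.
Proof.
apply: (@complexI R); rewrite rmorph_sum.
under eq_bigr do rewrite expr2 rmorphM.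
rewrite gap_form_sumr -rmorphB; congr (_%:C); rewrite /gap_form !eqxx.
by rewrite [i == _]eq_sym (negbTE (ordS_neq i)) /=; ring.
Qed.

Lemma cot_sq (t : R) : sin t != 0 -> cot t ^+ 2 = csc2 t - 1.
Proof.
move=> s0; rewrite /cot /csc2; apply: (@mulIf _ (sin t ^+ 2)); first by rewrite expf_neq0.
rewrite mulrBl mulVf ?expf_neq0 // mul1r -[X in _ = X - _](cos2Dsin2 t).
by field.
Qed.

Lemma cotN (t : R) : cot (- t) = - cot t.
Proof. by rewrite /cot cosN sinN invrN mulrN. Qed.

(** Here L_k = a (cot g_k - cot g_(k-1)) with g_k the gap of bond k. In L_k^2 the cross term is the
    three-body potential of H_2, and each of the two squares is csc^2 - 1; the 2N terms -1 add up to
    - E_0. *)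
Lemma gauge_potential a x : domain x ->
  \sum_k (Lmu a k x ^+ 2 + rpartial k (Lmu a k) x) =
  2 * a ^+ 2 * (\sum_i cot (x 0 i - x 0 (ord_pred i)) * cot (x 0 i - x 0 (ordS i)))
  + 2 * a ^+ 2 * (\sum_i csc2 (gap x i)) - E0 n a - 2 * a * (\sum_i csc2 (gap x i)).
Proof.
move=> dx; have [_ _ d] := dx; rewrite big_split /=.
have -> : \sum_k rpartial k (Lmu a k) x = - (2 * a * \sum_i csc2 (gap x i)).
  under eq_bigr do rewrite rpartial_Lmu //.
  rewrite -mulr_sumr exchange_big /= mulNr -mulrA mulrCA; congr (- (_ * _)).
  rewrite mulr_sumr; apply: eq_bigr => i _.
  by rewrite -mulr_suml sum_gap_form_sq.
congr (_ - _).
have e k : Lmu a k x ^+ 2 = a ^+ 2 * cot (gap x k) ^+ 2 + a ^+ 2 * cot (gap x (ord_pred k)) ^+ 2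
   + 2 * a ^+ 2 * (cot (x 0 k - x 0 (ord_pred k)) * cot (x 0 k - x 0 (ordS k))).
  have -> : cot (x 0 k - x 0 (ord_pred k)) = - cot (gap x (ord_pred k)).
    by rewrite -cotN /gap ord_predK opprB.
  by rewrite /Lmu gap_form_suml -/(gap x k); ring.
under eq_bigr do rewrite e.
rewrite !big_split /= -!mulr_sumr [X in a ^+ 2 * _ + a ^+ 2 * X](reindex_inj (can_inj (@ordSK N))) /=.
under [X in a ^+ 2 * _ + a ^+ 2 * X]eq_bigr do rewrite ordSK.
have -> : \sum_i cot (gap x i) ^+ 2 = \sum_i csc2 (gap x i) - N%:R.
  under eq_bigr do rewrite cot_sq //.
  by rewrite sumrB sumr_const card_ord.
by rewrite /E0; ring.
Qed.

Lemma SmC_mu a f : SmC f -> SmC (fun x => (mu a x)%:C * f x).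
Proof. by move=> sf; apply: SmCM => //; apply: SmC_real; exact: Sm_mu. Qed.

Lemma cpart_muM a k f x : SmC f -> domain x ->
  cpart k (fun y => (mu a y)%:C * f y) x = (mu a x)%:C * ((Lmu a k x)%:C * f x + cpart k f x).
Proof.
move=> sf dx; rewrite cpartM //; last by apply: SmC_real; exact: Sm_mu.
by rewrite cpart_real rpartial_mu // rmorphM /=; ring.
Qed.

Lemma cpart2_muM a k f x : SmC f -> domain x ->
  cpart k (cpart k (fun y => (mu a y)%:C * f y)) x =
  (mu a x)%:C * ((Lmu a k x ^+ 2 + rpartial k (Lmu a k) x)%:C * f x
                 + 2 * (Lmu a k x)%:C * cpart k f x + cpart k (cpart k f) x).
Proof.
move=> sf dx; have sL : SmC (fun y => (Lmu a k y)%:C) by apply: SmC_real; exact: Sm_Lmu.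
have sL' := SmCM sL sf; have sp := SmC_cpart k sf.
rewrite (cpart_ext k dx (fun y dy => cpart_muM a k sf dy)) cpart_muM //; last exact: SmCD.
rewrite cpartD // cpartM // cpart_real rmorphD rmorphXn /=; ring.
Qed.

Lemma sum_Lmu_cpart a f x :
  \sum_k (Lmu a k x)%:C * cpart k f x =
  a%:C * \sum_i (cot (gap x i))%:C * (cpart i f x - cpart (ordS i) f x).
Proof.
rewrite /Lmu; under eq_bigr do rewrite rmorphM rmorph_sum -mulrA mulr_suml /=.
rewrite -mulr_sumr exchange_big; congr (_ * _); apply: eq_bigr => i _ /=.
have -> : cpart i f x - cpart (ordS i) f x = \sum_k (gap_form R i k)%:C * cpart k f x.
  by rewrite gap_form_sumr.
rewrite mulr_sumr; apply: eq_bigr => k _; rewrite rmorphM /=; ring.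
Qed.

End ComplexCalculus.

(** * Conjugation by mu on spin-valued functions *)

Section Gauge.
Variables (R : realType) (n m : nat).
Local Notation N := n.+1.
Local Notation C := (R[i]).
Local Notation wavefun := ('rV[R]_N -> spin R n m).
Implicit Types (F G : wavefun) (c : config n m).

(** The coordinates of an exchanged spin vector are its coordinates at swapped configurations, which
    lets S act on scalar components. *)
Definition swapc (i j : 'I_N) c : config n m := [ffun k => c (tperm i j k)].

Definition SmF F := forall c, SmC (fun x => F x c).

Lemma spinP (u v : spin R n m) : (forall c, u c = v c) -> u = v.
Proof. by move=> h; apply/ffunP. Qed.

Lemma scalE (k : C) (u : spin R n m) c : (k *: u) c = k * u c.
Proof. by rewrite ffunE. Qed.

Lemma SmF_smooth F : SmF F -> smooth F.
Proof. by move=> h c; have [h1 h2] := h c; split; exact: Sm_rsmooth. Qed.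

Lemma partialE i F x c : partial i F x c = cpart i (fun y => F y c) x.
Proof. by rewrite ffunE. Qed.

Lemma partial2E i F x c :
  partial i (partial i F) x c = cpart i (cpart i (fun y => F y c)) x.
Proof.
rewrite partialE; congr cpart; apply/funext => y; exact: partialE.
Qed.

Lemma H2E a F x c : H2 a F x c =
  - (\sum_i cpart i (cpart i (fun y => F y c)) x)
  + (2 * a ^+ 2 * \sum_i cot (x 0 i - x 0 (ord_pred i)) *
                         cot (x 0 i - x 0 (ordS i)))%:C * F x c
  + (2 * a)%:C * \sum_i (csc2 (gap x i))%:C * (a%:C * F x c - F x (swapc i (ordS i) c)).
Proof.
rewrite /H2 !ffunE; congr (- _ + _ * _ + _ * _).
  by rewrite sum_ffunE; apply: eq_bigr => i _; rewrite partial2E.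
rewrite sum_ffunE; apply: eq_bigr => i _; by rewrite !ffunE.
Qed.

Lemma momentumE F x c :
  momentum F x c = - 'i * \sum_k cpart k (fun y => F y c) x.
Proof.
rewrite /momentum ffunE sum_ffunE; congr (_ * _).
by apply: eq_bigr => i _; rewrite partialE.
Qed.

Lemma H2_mu a G x c : (0 < n)%N -> SmF G -> domain x ->
  H2 a (fun y => (mu a y)%:C *: G y) x c =
  (mu a x)%:C * (- (\sum_i cpart i (cpart i (fun y => G y c)) x)
    - (2 * a)%:C * (\sum_i (cot (gap x i))%:C *
        (cpart i (fun y => G y c) x - cpart (ordS i) (fun y => G y c) x))
    + (E0 n a)%:C * G x c
    + (2 * a)%:C * \sum_i (csc2 (gap x i))%:C * (G x c - G x (swapc i (ordS i) c))).
Proof.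
move=> n0 sG dx; rewrite H2E scalE.
have -> : (fun y => ((mu a y)%:C *: G y) c) = (fun y => (mu a y)%:C * G y c).
  by apply/funext => y; rewrite scalE.
under eq_bigr do rewrite (cpart2_muM a _ (sG c) dx) -[2 * _ * _]mulrA.
rewrite -mulr_sumr !big_split /= -mulr_suml -rmorph_sum -mulr_sumr sum_Lmu_cpart (gauge_potential n0 a dx).
(* Split a - S = (a - 1) + (1 - S): the first part cancels the csc^2 terms of the gauge potential,
   and only 1 - S survives. *)
have -> : \sum_i (csc2 (gap x i))%:C * (a%:C * ((mu a x)%:C * G x c) -
      ((mu a x)%:C *: G x) (swapc i (ordS i) c)) =
   (mu a x)%:C * ((a%:C - 1) * (\sum_i (csc2 (gap x i))%:C) * G x c +
      \sum_i (csc2 (gap x i))%:C * (G x c - G x (swapc i (ordS i) c))).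
  rewrite mulr_sumr mulr_suml -big_split mulr_sumr /=; apply: eq_bigr => i _.
  by rewrite scalE; ring.
rewrite !(rmorphB, rmorphD, rmorphM, rmorphXn, rmorph1, rmorph_nat) /= -!rmorph_sum /=.
by ring.
Qed.

Lemma momentum_mu a G x c : SmF G -> domain x ->
  momentum (fun y => (mu a y)%:C *: G y) x c = (mu a x)%:C * momentum G x c.
Proof.
move=> sG dx; rewrite !momentumE.
have -> : (fun y => ((mu a y)%:C *: G y) c) = (fun y => (mu a y)%:C * G y c).
  by apply/funext => y; rewrite scalE.
under eq_bigr do rewrite (cpart_muM a _ (sG c) dx).
rewrite -mulr_sumr big_split -mulr_suml -rmorph_sum /= sum_Lmu mul0r add0r.
by rewrite mulrCA.
Qed.

End Gauge.

(** * Spins and plane waves *)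


Section SpinAlgebra.
Variables (R : realType) (n m : nat).
Local Notation N := n.+1.
Local Notation C := (R[i]).
Local Notation spin := (spin R n m).
Implicit Types (s : spin) (c : config n m).

(** A left action: the product [q * p] of permutations applies q first. *)
Lemma spin_perm_comp (p q : 'S_N) s : spin_perm p (spin_perm q s) = spin_perm (q * p)%g s.
Proof.
apply/ffunP => c; rewrite !ffunE; congr (s _); apply/ffunP => k.
by rewrite !ffunE permM.
Qed.

Lemma spin_permZ (p : 'S_N) (k : C) s : spin_perm p (k *: s) = k *: spin_perm p s.
Proof. by apply/ffunP => c; rewrite !ffunE. Qed.

Lemma spin_permD (p : 'S_N) s t : spin_perm p (s + t) = spin_perm p s + spin_perm p t.
Proof. by apply/ffunP => c; rewrite !ffunE. Qed.

Lemma spin_perm_sum (p : 'S_N) (I : Type) (r : seq I) (P : pred I) (F : I -> spin) :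
  spin_perm p (\sum_(i <- r | P i) F i) = \sum_(i <- r | P i) spin_perm p (F i).
Proof.
apply: (big_morph (spin_perm p)) => [u v|]; first exact: spin_permD.
by apply/ffunP => c; rewrite !ffunE.
Qed.

Lemma spin_atZ k s i : spin_at (k *: s) i = k *: spin_at s i.
Proof.
rewrite /spin_at; under eq_bigr do rewrite spin_permZ.
by rewrite -scaler_sumr !scalerA mulrC.
Qed.

Lemma spin_atD s t i : spin_at (s + t) i = spin_at s i + spin_at t i.
Proof.
rewrite /spin_at; under eq_bigr do rewrite spin_permD.
by rewrite big_split scalerDr.
Qed.

(** Spin permutations move the s_i in the same way as coordinate permutations move the z_i; hence
    sums of f(z_i) s_i are symmetric. *)
Lemma spin_perm_at (p : 'S_N) s i : spin_perm p (spin_at s i) = spin_at s (p i).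
Proof.
rewrite /spin_at spin_permZ spin_perm_sum; congr (_ *: _).
under eq_bigr do rewrite spin_perm_comp.
rewrite [RHS](reindex_inj (mulIg p)) /=; apply: eq_bigl => q.
by rewrite permM (inj_eq perm_inj).
Qed.

Lemma spin_at_swap s i j k c :
  spin_at s k (swapc i j c) = spin_at s (tperm i j k) c.
Proof. by rewrite -spin_perm_at [RHS]ffunE. Qed.

(** This is Lambda s: in the average over S_N the permutations are grouped by the image i of
    particle 1, and each group gives s_i. *)
Definition symm s : spin := \sum_i spin_at s i.

Lemma symmZ k s : symm (k *: s) = k *: symm s.
Proof. by rewrite /symm scaler_sumr; apply: eq_bigr => i _; exact: spin_atZ. Qed.

Lemma symmD s t : symm (s + t) = symm s + symm t.
Proof. by rewrite /symm -big_split; apply: eq_bigr => i _; exact: spin_atD. Qed.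

Lemma symm_perm (p : 'S_N) s : spin_perm p (symm s) = symm s.
Proof.
rewrite /symm spin_perm_sum [RHS](reindex_inj (@perm_inj _ p)) /=.
by apply: eq_bigr => i _; rewrite spin_perm_at.
Qed.

Lemma symm_swap s i j c : symm s (swapc i j c) = symm s c.
Proof. by rewrite -[in RHS](symm_perm (tperm i j)) [RHS]ffunE. Qed.

Lemma Lambda_cst (T : Type) s (x : 'rV[T]_N) : Lambda (fun=> s) x = symm s.
Proof.
rewrite /Lambda /symm /spin_at -scaler_sumr; congr (_ *: _).
by rewrite (partition_big (fun p : 'S_N => p ord0) predT).
Qed.

Lemma Lambda_scal (f : C -> C) s (z : 'rV[C]_N) :
  Lambda (fun w => f (w 0 ord0) *: s) z = \sum_i f (z 0 i) *: spin_at s i.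
Proof.
rewrite /Lambda (partition_big (fun p : 'S_N => p ord0) predT) //= scaler_sumr.
apply: eq_bigr => i _; rewrite /spin_at scalerA mulrC -scalerA; congr (_ *: _).
rewrite scaler_sumr; apply: eq_bigr => p /eqP pi.
by rewrite spin_permZ mxE pi.
Qed.

(** Lambda s is fixed by all permutations, so only the proportion 1/N of permutations with p(1) = i
    is left. It allows a sum of f(z_i) times Lambda s to be written as a sum of f(z_i) (N Lambda
    s)_i. *)
Lemma spin_at_symm s i : spin_at (symm s) i = N%:R^-1 *: symm s.
Proof.
(* The fibres of p -> p(1) have equal size: right multiplication by a transposition exchanges
   them. *)
have ce k : (\sum_(p : 'S_N | p ord0 == k) 1 = \sum_(p : 'S_N | p ord0 == i) 1)%N.
  rewrite (reindex_inj (mulIg (tperm k i))) /=; apply: eq_bigl => p.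
  by rewrite permM; apply/eqP/eqP => [h|->]; [rewrite -[p _](tpermK k i) h tpermL|rewrite tpermR].
have cN : (N`! = N * \sum_(p : 'S_N | p ord0 == i) 1)%N.
  rewrite -card_Sn -sum1_card.
  rewrite (partition_big (fun p : 'S_N => p ord0) predT) //=.
  rewrite (eq_bigr (fun=> (\sum_(p : 'S_N | p ord0 == i) 1)%N)); last first.
    move=> k _; rewrite -(ce k); apply: eq_bigl => p.
    by [].
  by rewrite sum_nat_const card_ord.
rewrite /spin_at; under eq_bigr do rewrite symm_perm.
rewrite sumr_const -[symm s *+ _]scaler_nat scalerA; congr (_ *: _).
rewrite cN natrM invfM -mulrA sum1_card mulVf ?mulr1 //.
rewrite pnatr_eq0 -sum1_card; apply/eqP => h.
by have := fact_gt0 N; rewrite cN h muln0.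
Qed.

Lemma sum_tperm (f w : 'I_N -> C) (i j : 'I_N) : i != j ->
  \sum_k f k * (w k - w (tperm i j k)) = (f i - f j) * (w i - w j).
Proof.
move=> ij; rewrite (bigD1 i) // (bigD1 j) /=; last by rewrite eq_sym.
rewrite tpermL tpermR big1 => [|k /andP[ki kj]]; first by ring.
by rewrite tpermD ?subrr ?mulr0 // eq_sym.
Qed.

(** Only k = i and k = j contribute to 1 - S_ij. The factor f i - f j lowers the double pole of
    csc^2 to a simple one, which can then cancel against the cot term. *)
Lemma sum_swap (f : 'I_N -> C) s (i j : 'I_N) c : i != j ->
  \sum_k f k * (spin_at s k c - spin_at s k (swapc i j c)) =
  (f i - f j) * (spin_at s i c - spin_at s j c).
Proof.
move=> ij; rewrite -(sum_tperm f (fun k => spin_at s k c)) //.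
by apply: eq_bigr => k _; congr (_ * (_ - _)); exact: spin_at_swap.
Qed.

End SpinAlgebra.

(** * Finite sums of plane waves with spin coefficients *)

Section Waves.
Variables (R : realType) (n m : nat).
Local Notation N := n.+1.
Local Notation C := (R[i]).
Local Notation spin := (spin R n m).
Local Notation wavefun := ('rV[R]_N -> spin).
Implicit Types (s : spin) (c : config n m) (F G : wavefun) (x : 'rV[R]_N).

(** The index type is arbitrary, as the sums run over particles, over pairs of particles and over
    the monomials of an element of the invariant spaces. *)
Definition wsum (I : Type) (r : seq I) (q : I -> 'I_N -> R) (v : I -> spin) : wavefun :=
  fun x => \sum_(l <- r) wave (q l) x *: v l.

Lemma wsumE I (r : seq I) q v x c : wsum r q v x c = \sum_(l <- r) wave (q l) x * v l c.
Proof. by rewrite /wsum sum_ffunE; apply: eq_bigr => l _; rewrite scalE. Qed.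

Lemma SmF_wsum I (r : seq I) q v : SmF (wsum r q v).
Proof.
move=> c; apply: (@SmC_ext _ _ (fun x => \sum_(l <- r) wave (q l) x * v l c)).
  by move=> x _; rewrite wsumE.
by apply: SmC_sum => l; apply: SmCM; [exact: SmC_wave|exact: SmC_cst].
Qed.

Lemma cpart_wave_scal i q (k : C) x : domain x ->
  cpart i (fun y => wave q y * k) x = wave q x * ((2 * q i)%:C * 'i * k).
Proof.
move=> dx; rewrite cpartM //; [|exact: SmC_wave|exact: SmC_cst].
by rewrite cpart_cst cpart_wave mulr0 addr0; ring.
Qed.

Lemma cpart_wsum i I (r : seq I) q v x c : domain x ->
  cpart i (fun y => wsum r q v y c) x =
  \sum_(l <- r) wave (q l) x * ((2 * q l i)%:C * 'i * v l c).
Proof.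
move=> dx.
rewrite (@cpart_ext _ _ i _ (fun y => \sum_(l <- r) wave (q l) y * v l c)) //; last first.
  by move=> y _; rewrite wsumE.
rewrite cpart_sum //; first by apply: eq_bigr => l _; rewrite cpart_wave_scal.
by move=> l; apply: SmCM; [exact: SmC_wave|exact: SmC_cst].
Qed.

Lemma cpart2_wsum i I (r : seq I) q v x c : domain x ->
  cpart i (cpart i (fun y => wsum r q v y c)) x =
  \sum_(l <- r) (- (4 * q l i ^+ 2))%:C * (wave (q l) x * v l c).
Proof.
move=> dx.
rewrite (cpart_ext i dx (fun y dy => cpart_wsum i r q v c dy)).
rewrite cpart_sum //; last by move=> l; apply: SmCM; [exact: SmC_wave|exact: SmC_cst].
apply: eq_bigr => l _; rewrite cpart_wave_scal //.
have ii : 'i * 'i = -1 :> C by apply: complexP => /=; ring.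
have -> : (- (4 * q l i ^+ 2))%:C = - (4 * (q l i)%:C ^+ 2) :> C.
  by apply: complexP => /=; ring.
have -> : (2 * q l i)%:C = 2 * (q l i)%:C :> C by apply: complexP => /=; ring.
have -> : forall u w t : C, w * (2 * u * 'i * (2 * u * 'i * t)) = 4 * u ^+ 2 * w * t * ('i * 'i).
  by move=> *; ring.
by rewrite ii; ring.
Qed.

(** Each derivative becomes a factor 2i q. The factor i is kept next to the cot, since - i cot is,
    up to the sign of the exponents, the rational function (z + z') / (z - z'). *)
Lemma H2_wsum a I (r : seq I) q v x c : (0 < n)%N -> domain x ->
  H2 a (fun y => (mu a y)%:C *: wsum r q v y) x c =
  (mu a x)%:C * (\sum_(l <- r) (4 * \sum_i q l i ^+ 2)%:C * (wave (q l) x * v l c)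
    + (4 * a)%:C * (\sum_i (- 'i * (cot (gap x i))%:C) *
        \sum_(l <- r) (q l i - q l (ordS i))%:C * (wave (q l) x * v l c))
    + (E0 n a)%:C * wsum r q v x c
    + (2 * a)%:C * \sum_i (csc2 (gap x i))%:C *
        (wsum r q v x c - wsum r q v x (swapc i (ordS i) c))).
Proof.
move=> n0 dx; rewrite H2_mu //; last exact: SmF_wsum.
congr (_ * (_ + _ + _ + _)).
  under eq_bigr do rewrite cpart2_wsum //.
  rewrite exchange_big -sumrN; apply: eq_bigr => l _ /=.
  rewrite -mulr_suml -mulNr; congr (_ * _); rewrite -rmorph_sum -rmorphN; congr (_%:C).
  by rewrite mulr_sumr -sumrN; apply: eq_bigr => i _; rewrite opprK.
rewrite -mulrN -sumrN !mulr_sumr; apply: eq_bigr => i _.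
rewrite !cpart_wsum // -sumrB !mulr_sumr -sumrN mulr_sumr; apply: eq_bigr => l _.
by rewrite !(rmorphM, rmorphB, rmorph_nat) /=; ring.
Qed.

Lemma momentum_wsum a I (r : seq I) q v x c : domain x ->
  momentum (fun y => (mu a y)%:C *: wsum r q v y) x c =
  (mu a x)%:C * \sum_(l <- r) (2 * \sum_i q l i)%:C * (wave (q l) x * v l c).
Proof.
move=> dx; rewrite momentum_mu //; last exact: SmF_wsum.
congr (_ * _); rewrite momentumE; under eq_bigr do rewrite cpart_wsum //.
rewrite exchange_big mulr_sumr; apply: eq_bigr => l _ /=.
have ii : - 'i * 'i = 1 :> C by apply: complexP => /=; ring.
rewrite mulr_sumr mulr_sumr rmorph_sum mulr_suml; apply: eq_bigr => i _.
transitivity ((2 * q l i)%:C * (wave (q l) x * v l c) * (- 'i * 'i)); first by ring.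
by rewrite ii mulr1.
Qed.

End Waves.

(** * Action of the Hamiltonian on the elementary sums *)


Section Families.
Variables (R : realType) (n m : nat).
Local Notation N := n.+1.
Local Notation C := (R[i]).
Local Notation spin := (spin R n m).
Local Notation wavefun := ('rV[R]_N -> spin).
Implicit Types (s : spin) (c : config n m) (F G : wavefun) (x : 'rV[R]_N) (b : bool).

Lemma cis_neq0 (t : R) : cis t != 0.
Proof.
apply/eqP => h; have := cisD t (- t); rewrite subrr cis0 h mul0r => /eqP.
by rewrite oner_eq0.
Qed.

Lemma cisN (t : R) : cis (- t) = (cis t)^-1.
Proof.
apply: (mulfI (cis_neq0 t)); rewrite -cisD subrr cis0 mulfV //.
exact: cis_neq0.
Qed.

Lemma cis_sign b (t : R) : cis ((-1) ^+ b * t) = (cos t)%:C + ((-1) ^+ b)%:C * 'i * (sin t)%:C.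
Proof.
by case: b; rewrite ?expr1 ?expr0 ?mulN1r ?mul1r /cis ?cosN ?sinN; apply: complexP => /=; ring.
Qed.

Lemma expz_neq0 b x k : expz b x 0 k != 0.
Proof. by rewrite mxE cis_neq0. Qed.

Lemma mulii : 'i * 'i = -1 :> C.
Proof. by apply: complexP => /=; ring. Qed.

Lemma signr_sq b : ((-1) ^+ b)%:C * ((-1) ^+ b)%:C = 1 :> C.
Proof. by rewrite -rmorphM -expr2 sqrr_sign. Qed.

(** This is exp(2it) - 1 = 2i sin t exp(it) for u = cos t, v = sin t, with E the sign of the
    exponent; the relations among u, v, E and I are hypotheses so that the rest is polynomial
    algebra. *)
Lemma double_angleB (z u v E I : C) : I * I = -1 -> E * E = 1 -> u * u = 1 - v * v ->
  z * (u + E * I * v) * (u + E * I * v) - z = 2 * E * I * v * (z * (u + E * I * v)).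
Proof.
move=> ii ee cs.
transitivity (z * (u * u + 2 * u * (E * I * v) + (E * E) * (I * I) * (v * v) - 1)); first by ring.
transitivity (2 * E * I * v * (z * u) + 2 * ((E * E) * (I * I)) * (v * v) * z); last by ring.
by rewrite ee ii cs; ring.
Qed.

Lemma double_angleD (z u v E I : C) : I * I = -1 -> E * E = 1 -> u * u = 1 - v * v ->
  z * (u + E * I * v) * (u + E * I * v) + z = 2 * u * (z * (u + E * I * v)).
Proof.
move=> ii ee cs.
transitivity (z * (u * u + 2 * u * (E * I * v) + (E * E) * (I * I) * (v * v) + 1)); first by ring.
rewrite ee ii.
transitivity (z * (u * u + 2 * u * (E * I * v) + (1 - v * v))); first by ring.
by rewrite -cs; ring.
Qed.

Lemma expz_gap b x i : exists p : C, [/\ p != 0,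
  expz b x 0 i - expz b x 0 (ordS i) =
    2 * ((-1) ^+ b)%:C * 'i * (sin (gap x i))%:C * (expz b x 0 (ordS i) * p),
  expz b x 0 i + expz b x 0 (ordS i) =
    2 * (cos (gap x i))%:C * (expz b x 0 (ordS i) * p) &
  expz b x 0 i = expz b x 0 (ordS i) * p * p].
Proof.
(* p is a square root of z_i / z_(i+1), needed because the gap is half the difference of the
   arguments of z_i and z_(i+1). *)
exists (cis ((-1) ^+ b * gap x i)).
have e : expz b x 0 i = expz b x 0 (ordS i) * cis ((-1) ^+ b * gap x i) * cis ((-1) ^+ b * gap x i).
  by rewrite !mxE -!cisD; congr cis; rewrite /gap; ring.
split => //; first exact: cis_neq0.
all: rewrite e cis_sign; move: (expz b x 0 (ordS i)) => z.
all: have cs : (cos (gap x i))%:C * (cos (gap x i))%:C = 1 - (sin (gap x i))%:C * (sin (gap x i))%:C :> C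
  by rewrite -!rmorphM -!expr2 -[X in _ = X - _](rmorph1 (@real_complex R)) -rmorphB -(cos2Dsin2 (gap x i)) addrK.
  exact: double_angleB mulii (signr_sq b) cs.
exact: double_angleD mulii (signr_sq b) cs.
Qed.

Lemma expz_neq b x i : sin (gap x i) != 0 -> expz b x 0 i != expz b x 0 (ordS i).
Proof.
move=> s0; rewrite -subr_eq0; have [p [p0 -> _ _]] := expz_gap b x i.
rewrite !mulf_neq0 ?expz_neq0 ?p0 ?pnatr_eq0 //.
- by rewrite -(rmorph0 (@real_complex R)) (inj_eq (@complexI R)) signr_eq0.
- by apply/eqP => /(congr1 (@complex.Im _)) /= /eqP; rewrite oner_eq0.
- by rewrite -(rmorph0 (@real_complex R)) (inj_eq (@complexI R)).
Qed.

Lemma cot_algebra (u v E I t : C) : v != 0 -> I * I = -1 ->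
  - I * (u / v) * (2 * E * I * v * t) = E * (2 * u * t).
Proof.
move=> v0 ii; transitivity (- (I * I) * (u / v * v) * 2 * E * t); first by ring.
by rewrite ii mulfVK //; ring.
Qed.

Lemma csc2_algebra (v E I z p : C) : v != 0 -> I * I = -1 -> E * E = 1 ->
  (v ^+ 2)^-1 * (2 * E * I * v * (z * p)) ^+ 2 = - 4 * (z * p * p * z).
Proof.
move=> v0 ii ee.
transitivity ((I * I) * (E * E) * 4 * (z * p) ^+ 2 * ((v ^+ 2)^-1 * v ^+ 2)); first by ring.
by rewrite ii ee mulVf ?expf_neq0 //; ring.
Qed.

Lemma cot_expz b x i : sin (gap x i) != 0 ->
  - 'i * (cot (gap x i))%:C = ((-1) ^+ b)%:C *
    ((expz b x 0 i + expz b x 0 (ordS i)) / (expz b x 0 i - expz b x 0 (ordS i))).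
Proof.
move=> s0; have zz := expz_neq b s0; move: zz; rewrite -subr_eq0 => zz.
have [p [p0 e1 e2 _]] := expz_gap b x i.
apply: (mulIf zz); rewrite -[RHS]mulrA mulfVK // e1 e2 /cot fmorph_div /=.
have s1 : (sin (gap x i))%:C != 0 :> C by rewrite -(rmorph0 (@real_complex R)) (inj_eq (@complexI R)).
exact: cot_algebra mulii.
Qed.

Lemma csc2_expz b x i : sin (gap x i) != 0 ->
  (csc2 (gap x i))%:C = - 4 * (expz b x 0 i * expz b x 0 (ordS i) /
    (expz b x 0 i - expz b x 0 (ordS i)) ^+ 2).
Proof.
move=> s0; have zz := expz_neq b s0; move: zz; rewrite -subr_eq0 => zz.
have [p [p0 e1 _ e3]] := expz_gap b x i.
apply: (mulIf (expf_neq0 2 zz)); rewrite -[RHS]mulrA mulfVK ?expf_neq0 //.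
rewrite e1 [in RHS]e3 /csc2 fmorphV rmorphXn /=.
have s1 : (sin (gap x i))%:C != 0 :> C by rewrite -(rmorph0 (@real_complex R)) (inj_eq (@complexI R)).
by rewrite csc2_algebra ?mulii ?signr_sq.
Qed.

(* The contribution of one bond (z, z') to the gauged Hamiltonian: in
   [- 2a cot (d - d') + 2a csc^2 (1 - S)] applied to \sum_k z_k w_k, and to
   Z \sum_k w_k / z_k with Z = \sum_j z_j, the poles at z = z' cancel. *)
Lemma bond1 (a z z' w w' : C) : z != z' ->
  4 * a * ((z + z') / (z - z')) * (z * w - z' * w')
  + 2 * a * (- 4 * (z * z' / (z - z') ^+ 2)) * ((z - z') * (w - w'))
  = 4 * a * (z * w + z' * w').
Proof. by rewrite -subr_eq0 => h; field. Qed.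

(** The sign E of the exponents enters once through the cot and once through the derivatives, so it
    disappears from the product. *)
Lemma bond1_sign (a E U z z' w w' : C) : E * E = 1 -> z != z' ->
  4 * a * (E * ((z + z') / (z - z')) * (E * U * (z * w - z' * w')))
  + 2 * a * (- 4 * (z * z' / (z - z') ^+ 2) * (U * ((z - z') * (w - w'))))
  = U * (4 * a * (z * w + z' * w')).
Proof.
move=> ee zz; rewrite -bond1 //.
transitivity (U * (E * E * (4 * a * ((z + z') / (z - z')) * (z * w - z' * w'))
  + 2 * a * (- 4 * (z * z' / (z - z') ^+ 2)) * ((z - z') * (w - w')))); first by ring.
by rewrite ee mul1r.
Qed.

Lemma bond2 (a z z' w w' Z S : C) : z != z' -> z != 0 -> z' != 0 ->
  4 * a * ((z + z') / (z - z')) * ((z - z') * S - Z * (w / z - w' / z'))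
  + 2 * a * (- 4 * (z * z' / (z - z') ^+ 2)) * (Z * ((z^-1 - z'^-1) * (w - w')))
  = 4 * a * ((z + z') * S + Z * (w / z + w' / z')).
Proof. by rewrite -subr_eq0 => h h1 h2; field; rewrite h h1 h2. Qed.

Lemma bond2_sign (a E z z' w w' Z S : C) : E * E = 1 -> z != z' -> z != 0 -> z' != 0 ->
  4 * a * (E * ((z + z') / (z - z')) * (E * ((z - z') * S - Z * (w / z - w' / z'))))
  + 2 * a * (- 4 * (z * z' / (z - z') ^+ 2) * (Z * ((z^-1 - z'^-1) * (w - w'))))
  = 4 * a * ((z + z') * S + Z * (w / z + w' / z')).
Proof.
move=> ee zz z0 z0'; rewrite -bond2 //.
transitivity (E * E * (4 * a * ((z + z') / (z - z')) * ((z - z') * S - Z * (w / z - w' / z')))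
  + 2 * a * (- 4 * (z * z' / (z - z') ^+ 2)) * (Z * ((z^-1 - z'^-1) * (w - w')))); first by ring.
by rewrite ee mul1r.
Qed.

Lemma sum_ordS (F : 'I_N -> C) : \sum_i F (ordS i) = \sum_i F i.
Proof. by rewrite [RHS](reindex_inj (can_inj (@ordSK N))). Qed.

(* [wave (q1 b j)] and [wave (q2 b (j, k))] are exp (2i (x_j - xbar)) and
   exp (2i (x_j - x_k)), with the sign of the exponent chosen by b. *)
Definition q1 b (j k : 'I_N) : R := (-1) ^+ b * ((k == j)%:R - N%:R^-1).

Definition q2 b (p : 'I_N * 'I_N) (k : 'I_N) : R :=
  (-1) ^+ b * ((k == p.1)%:R - (k == p.2)%:R).

Lemma sumr_delta (j : 'I_N) : \sum_(k < N) (k == j)%:R = 1 :> R.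
Proof. by rewrite -[RHS](sum_delta (fun=> 1 : R) j); apply: eq_bigr => k _; rewrite mulr1. Qed.

Lemma sum_q1 b j : \sum_k q1 b j k = 0.
Proof.
rewrite -mulr_sumr sumrB sumr_delta sumr_const card_ord -[_ *+ _]mulr_natr.
by rewrite mulVf ?pnatr_eq0 // subrr mulr0.
Qed.

Lemma sum_q2 b p : \sum_k q2 b p k = 0.
Proof. by rewrite -mulr_sumr sumrB !sumr_delta subrr mulr0. Qed.

(** Source of the kinetic energy 4 (1 - 1/N) in E_12: removing the centre of mass costs the 1/N. *)
Lemma sum_q1_sq b j : \sum_k q1 b j k ^+ 2 = 1 - N%:R^-1.
Proof.
have e k : q1 b j k ^+ 2 = (k == j)%:R * (1 - 2 * N%:R^-1) + N%:R^-1 ^+ 2.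
  by rewrite /q1 exprMn sqrr_sign; case: (k == j) => /=; ring.
under eq_bigr do rewrite e.
rewrite big_split /= sum_delta sumr_const card_ord -[_ *+ N]mulr_natr.
have N0 : N%:R != 0 :> R by rewrite pnatr_eq0.
by field.
Qed.

(** Pairs of distinct particles have kinetic energy 4 * 2 = 8, while the pairs j = k are constant
    functions. *)
Lemma sum_q2_sq b p : \sum_k q2 b p k ^+ 2 = 2 - 2 * (p.1 == p.2)%:R.
Proof.
have e k : q2 b p k ^+ 2 = (k == p.1)%:R * 1 + (k == p.2)%:R * (1 - 2 * (k == p.1)%:R).
  by rewrite /q2 exprMn sqrr_sign; case: (k == p.1); case: (k == p.2) => /=; ring.
under eq_bigr do rewrite e.
by rewrite big_split /= !sum_delta eq_sym; ring.
Qed.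

Lemma lin_q1 b j x : lin (q1 b j) x = (-1) ^+ b * (x 0 j - xbar x).
Proof.
rewrite /lin /q1 /xbar; under eq_bigr do rewrite -mulrA mulrBl.
by rewrite -mulr_sumr sumrB sum_delta -mulr_sumr.
Qed.

Lemma lin_q2 b p x : lin (q2 b p) x = (-1) ^+ b * (x 0 p.1 - x 0 p.2).
Proof.
rewrite /lin /q2; under eq_bigr do rewrite -mulrA mulrBl.
by rewrite -mulr_sumr sumrB !sum_delta.
Qed.

Lemma wave_q1 b j x : wave (q1 b j) x = cis ((-1) ^+ b * (- (2 * xbar x))) * expz b x 0 j.
Proof. by rewrite /wave lin_q1 mxE -cisD; congr cis; ring. Qed.

Lemma wave_q2 b p x : wave (q2 b p) x = expz b x 0 p.1 / expz b x 0 p.2.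
Proof. by rewrite /wave lin_q2 !mxE -cisN -cisD; congr cis; ring. Qed.

Definition fam0 s : wavefun := fun=> symm s.
Definition fam1 b s : wavefun := wsum (index_enum 'I_N) (q1 b) (spin_at s).
(** The pairs j = k are included so that the sum factorises as in [fam2E]; the price is the term in
    Lambda s of its energy equation. *)
Definition fam2 b s : wavefun :=
  wsum (index_enum ('I_N * 'I_N)%type) (q2 b) (fun p => spin_at s p.2).

Lemma fam2E b s x c : fam2 b s x c =
  (\sum_j expz b x 0 j) * (\sum_k (expz b x 0 k)^-1 * spin_at s k c).
Proof.
rewrite wsumE mulr_suml (eq_bigr (fun p => expz b x 0 p.1 * ((expz b x 0 p.2)^-1 * spin_at s p.2 c))).
  rewrite -(pair_bigA _ (fun j k => expz b x 0 j * ((expz b x 0 k)^-1 * spin_at s k c))) /=.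
  by apply: eq_bigr => j _; rewrite mulr_sumr.
by move=> p _; rewrite wave_q2 mulrA.
Qed.

Lemma H2_fam0 a s x c : (0 < n)%N -> domain x ->
  H2 a (fun y => (mu a y)%:C *: fam0 s y) x c = (E0 n a)%:C * ((mu a x)%:C * symm s c).
Proof.
move=> n0 dx; rewrite H2_mu //; last by move=> d; exact: SmC_cst.
have cc i : cpart i (fun y => fam0 s y c) = fun=> 0.
  by apply/funext => y; exact: cpart_cst.
have -> : \sum_i cpart i (cpart i (fun y => fam0 s y c)) x = 0.
  by rewrite big1 // => i _; rewrite cc cpart_cst.
have -> : \sum_i (cot (gap x i))%:C * (cpart i (fun y => fam0 s y c) x - cpart (ordS i) (fun y => fam0 s y c) x) = 0.
  by rewrite big1 // => i _; rewrite !cc subrr mulr0.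
have -> : \sum_i (csc2 (gap x i))%:C * (fam0 s x c - fam0 s x (swapc i (ordS i) c)) = 0.
  by rewrite big1 // => i _; rewrite /fam0 symm_swap subrr mulr0.
by rewrite /fam0; ring.
Qed.

Lemma H2_fam1 a b s x c : (0 < n)%N -> domain x ->
  H2 a (fun y => (mu a y)%:C *: fam1 b s y) x c =
  (E12 n a)%:C * ((mu a x)%:C * fam1 b s x c).
Proof.
move=> n0 dx; have [_ _ d] := dx; rewrite H2_wsum // mulrCA; congr (_ * _).
set U := cis ((-1) ^+ b * (- (2 * xbar x))).
pose Z := expz b x 0; pose w k := spin_at s k c.
have G1 : fam1 b s x c = U * \sum_k Z k * w k.
  by rewrite wsumE mulr_sumr; apply: eq_bigr => k _; rewrite wave_q1 -mulrA.
have -> : \sum_l (4 * \sum_i q1 b l i ^+ 2)%:C * (wave (q1 b l) x * spin_at s l c) =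
    (4 * (1 - N%:R^-1))%:C * fam1 b s x c.
  by rewrite wsumE mulr_sumr; apply: eq_bigr => l _; rewrite sum_q1_sq.
have cross i : \sum_l (q1 b l i - q1 b l (ordS i))%:C * (wave (q1 b l) x * spin_at s l c) =
    ((-1) ^+ b)%:C * U * (Z i * w i - Z (ordS i) * w (ordS i)).
  rewrite -(sum_delta (fun k => Z k * w k) i) -(sum_delta (fun k => Z k * w k) (ordS i)).
  rewrite -sumrB mulr_sumr; apply: eq_bigr => k _; rewrite wave_q1 -/U -/(Z k) -/(w k).
  rewrite /q1 ![_ == k]eq_sym -mulrBr !(rmorphM, rmorphB, rmorph_nat) /=; ring.
have csc i : fam1 b s x c - fam1 b s x (swapc i (ordS i) c) =
    U * ((Z i - Z (ordS i)) * (w i - w (ordS i))).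
  rewrite -sum_swap 1?eq_sym ?ordS_neq // !wsumE -sumrB mulr_sumr.
  by apply: eq_bigr => k _; rewrite wave_q1 -/U -/(Z k); move: (spin_at s k c) (spin_at s k _) => u v; ring.
under [X in _ + _ * X + _ + _]eq_bigr do rewrite cross (cot_expz b (d _)).
under [X in _ + _ * X]eq_bigr do rewrite csc (csc2_expz b (d _)).
(* By [bond1] the bond i leaves 4a (z_i w_i + z_(i+1) w_(i+1)); each particle is met on two bonds,
   which makes 8a. *)
have key : (4 * a)%:C * (\sum_i ((-1) ^+ b)%:C * ((Z i + Z (ordS i)) / (Z i - Z (ordS i)))
      * (((-1) ^+ b)%:C * U * (Z i * w i - Z (ordS i) * w (ordS i))))
   + (2 * a)%:C * (\sum_i - 4 * (Z i * Z (ordS i) / (Z i - Z (ordS i)) ^+ 2) *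
        (U * ((Z i - Z (ordS i)) * (w i - w (ordS i))))) = (8 * a)%:C * fam1 b s x c.
  rewrite G1; clearbody w; rewrite !mulr_sumr -big_split /=.
  transitivity (\sum_i (4 * a%:C * (U * (Z i * w i)) + 4 * a%:C * (U * (Z (ordS i) * w (ordS i))))).
    apply: eq_bigr => i _.
    transitivity (U * (4 * a%:C * (Z i * w i + Z (ordS i) * w (ordS i)))); last by ring.
    rewrite -(@bond1_sign _ ((-1) ^+ b)%:C); [|exact: signr_sq|exact: expz_neq].
    by rewrite !rmorphM !rmorph_nat.
  rewrite big_split (sum_ordS (fun i => 4 * a%:C * (U * (Z i * w i)))) -big_split.
  by apply: eq_bigr => i _; rewrite !rmorphM !rmorph_nat /=; ring.
rewrite addrAC -[X in X + _]addrA key /E12 !(rmorphD, rmorphM, rmorphB, rmorph1, rmorph_nat) /=; ring.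
Qed.

(** The equation is only triangular: counting the pairs j = k with kinetic energy 8 like the others
    is corrected by - 8 times their sum, Lambda s. *)
Lemma H2_fam2 a b s x c : (0 < n)%N -> domain x ->
  H2 a (fun y => (mu a y)%:C *: fam2 b s y) x c =
  (E34 n a)%:C * ((mu a x)%:C * fam2 b s x c) - 8 * ((mu a x)%:C * symm s c).
Proof.
move=> n0 dx; have [_ _ d] := dx; rewrite H2_wsum //.
have -> : forall e M f g : C, e * (M * f) - 8 * (M * g) = M * (e * f - 8 * g) by move=> *; ring.
congr (_ * _).
pose Z := expz b x 0; pose w k := spin_at s k c; pose ZS := \sum_j Z j.
pose S := \sum_k (Z k)^-1 * w k.
have G2 : fam2 b s x c = ZS * S by exact: fam2E.
have -> : \sum_l (4 * \sum_i q2 b l i ^+ 2)%:C * (wave (q2 b l) x * spin_at s l.2 c) =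
    8 * fam2 b s x c - 8 * symm s c.
  rewrite wsumE mulr_sumr.
  have -> : symm s c = \sum_(l : 'I_N * 'I_N) (l.1 == l.2)%:R * spin_at s l.2 c.
    rewrite -(pair_bigA _ (fun j k => (j == k)%:R * spin_at s k c)) /= /symm sum_ffunE.
    rewrite exchange_big; apply: eq_bigr => k _ /=.
    by rewrite (sum_delta (fun=> spin_at s k c) k).
  rewrite mulr_sumr -sumrB; apply: eq_bigr => -[j k] _ /=; rewrite sum_q2_sq wave_q2 /=.
  have [->|jk] := eqVneq j k; last by rewrite !(rmorphM, rmorphB, rmorph_nat) /=; ring.
  rewrite mulfV ?expz_neq0 // !(rmorphM, rmorphB, rmorph_nat) /=; ring.
have cross i : \sum_l (q2 b l i - q2 b l (ordS i))%:C * (wave (q2 b l) x * spin_at s l.2 c) =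
    ((-1) ^+ b)%:C * ((Z i - Z (ordS i)) * S - ZS * (w i / Z i - w (ordS i) / Z (ordS i))).
  transitivity (((-1) ^+ b)%:C * \sum_j \sum_k (((j == i)%:R - (j == ordS i)%:R) * (Z j * ((Z k)^-1 * w k))
     - Z j * (((k == i)%:R - (k == ordS i)%:R) * ((Z k)^-1 * w k)))).
    rewrite (pair_bigA _ (fun j k => ((j == i)%:R - (j == ordS i)%:R) * (Z j * ((Z k)^-1 * w k))
     - Z j * (((k == i)%:R - (k == ordS i)%:R) * ((Z k)^-1 * w k)))) mulr_sumr /=.
    apply: eq_bigr => -[j k] _ /=; rewrite wave_q2 -/(w k) -/(Z j) -/(Z k) /q2 /=.
    rewrite ![_ == j]eq_sym ![_ == k]eq_sym -mulrBr !(rmorphM, rmorphB, rmorph_nat) /=; ring.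
  congr (_ * _); under eq_bigr do rewrite sumrB -!mulr_sumr.
  rewrite sumrB -mulr_suml; congr (_ - _).
    under eq_bigr do rewrite mulrA; rewrite -mulr_suml; congr (_ * _).
    by under eq_bigr do rewrite mulrBl; rewrite sumrB !sum_delta.
  congr (_ * _); under eq_bigr do rewrite mulrBl; rewrite sumrB !sum_delta.
  by congr (_ - _); exact: mulrC.
have csc i : fam2 b s x c - fam2 b s x (swapc i (ordS i) c) =
    ZS * (((Z i)^-1 - (Z (ordS i))^-1) * (w i - w (ordS i))).
  rewrite -(@sum_swap _ _ _ (fun k => (Z k)^-1)) 1?eq_sym ?ordS_neq // !fam2E -mulrBr -sumrB.
  by congr (_ * _); apply: eq_bigr => k _; rewrite -mulrBr.
under [X in _ + _ * X + _ + _]eq_bigr do rewrite cross (cot_expz b (d _)).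
under [X in _ + _ * X]eq_bigr do rewrite csc (csc2_expz b (d _)).
(* Summed over the bonds, both terms left by [bond2] give 4a * 2 * Z S, hence 16a in total. *)
have key : (4 * a)%:C * (\sum_i ((-1) ^+ b)%:C * ((Z i + Z (ordS i)) / (Z i - Z (ordS i)))
      * (((-1) ^+ b)%:C * ((Z i - Z (ordS i)) * S - ZS * (w i / Z i - w (ordS i) / Z (ordS i)))))
   + (2 * a)%:C * (\sum_i - 4 * (Z i * Z (ordS i) / (Z i - Z (ordS i)) ^+ 2) *
        (ZS * (((Z i)^-1 - (Z (ordS i))^-1) * (w i - w (ordS i))))) = (16 * a)%:C * fam2 b s x c.
  rewrite G2; clear G2 csc cross; clearbody w; rewrite !mulr_sumr -big_split /=.
  transitivity (\sum_i 4 * a%:C * (Z i * S + Z (ordS i) * S + (ZS * ((Z i)^-1 * w i) + ZS * ((Z (ordS i))^-1 * w (ordS i))))).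
    apply: eq_bigr => i _.
    transitivity (4 * a%:C * ((Z i + Z (ordS i)) * S + ZS * (w i / Z i + w (ordS i) / Z (ordS i)))); last by ring.
    rewrite -(@bond2_sign _ ((-1) ^+ b)%:C) ?expz_neq0 ?expz_neq ?signr_sq //.
    by rewrite !rmorphM !rmorph_nat.
  rewrite -mulr_sumr !big_split /= -!mulr_suml -!mulr_sumr -/ZS -/S.
  rewrite (sum_ordS Z) (sum_ordS (fun k => (Z k)^-1 * w k)) -/ZS -/S.
  by rewrite !rmorphM !rmorph_nat /=; ring.
rewrite addrAC -[X in X + _]addrA key /E34 !(rmorphD, rmorphM, rmorph1, rmorph_nat) /=; ring.
Qed.

Lemma momentum_fam0 a s x c : domain x ->
  momentum (fun y => (mu a y)%:C *: fam0 s y) x c = 0.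
Proof.
move=> dx; rewrite momentum_mu //; last by move=> d; exact: SmC_cst.
rewrite momentumE big1 ?mulr0 // => i _; exact: cpart_cst.
Qed.

Lemma momentum_fam1 a b s x c : domain x ->
  momentum (fun y => (mu a y)%:C *: fam1 b s y) x c = 0.
Proof.
move=> dx; rewrite momentum_wsum // big1 ?mulr0 // => l _.
by rewrite sum_q1 mulr0 mul0r.
Qed.

Lemma momentum_fam2 a b s x c : domain x ->
  momentum (fun y => (mu a y)%:C *: fam2 b s y) x c = 0.
Proof.
move=> dx; rewrite momentum_wsum // big1 ?mulr0 // => l _.
by rewrite sum_q2 mulr0 mul0r.
Qed.

End Families.

(** * The exact eigenfunctions *)


Section ExactStates.
Variables (R : realType) (n m : nat) (a : R).
Hypotheses (n_gt0 : (0 < n)%N) (a_gt0 : 0 < a).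
Local Notation N := n.+1.
Local Notation C := (R[i]).
Local Notation spin := (spin R n m).
Local Notation wavefun := ('rV[R]_N -> spin).
Implicit Types (s : spin) (c : config n m) (F G : wavefun) (x : 'rV[R]_N) (b : bool).

Lemma cpart_comb i (k l : C) (f g : 'rV[R]_N -> C) x : SmC f -> SmC g -> domain x ->
  cpart i (fun y => k * f y + l * g y) x = k * cpart i f x + l * cpart i g x.
Proof.
move=> sf sg dx; have sc (u : C) : SmC (fun _ : 'rV[R]_N => u) by exact: SmC_cst.
rewrite cpartD //; [|exact: SmCM|exact: SmCM].
by rewrite !cpartM // !cpart_cst !mul0r !add0r.
Qed.

Lemma SmF_comb (k l : C) F G : SmF F -> SmF G -> SmF (fun x => k *: F x + l *: G x).
Proof.
move=> sF sG c; apply: (@SmC_ext _ _ (fun x => k * F x c + l * G x c)).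
  by move=> x _; rewrite !ffunE.
by apply: SmCD; apply: SmCM => //; exact: SmC_cst.
Qed.

Lemma combE (k l : C) (u v : spin) c : (k *: u + l *: v) c = k * u c + l * v c.
Proof. by rewrite ffunE !scalE. Qed.

Lemma comb_eq (A B r1 r2 k l : C) : A = r1 -> B = r2 -> k * A + l * B = k * r1 + l * r2.
Proof. by move=> -> ->. Qed.

Lemma H2_comb_eq (A A1 A2 B B1 B2 X X1 X2 P Q k l : C) :
  A = k * A1 + l * A2 -> B = k * B1 + l * B2 -> X = k * X1 + l * X2 ->
  - A + P * X + Q * B = k * (- A1 + P * X1 + Q * B1) + l * (- A2 + P * X2 + Q * B2).
Proof. by move=> -> -> ->; ring. Qed.

Lemma H2_comb (k l : C) F G x c : SmF F -> SmF G -> domain x ->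
  H2 a (fun y => k *: F y + l *: G y) x c = k * H2 a F x c + l * H2 a G x c.
Proof.
move=> sF sG dx.
apply: etrans (H2E a _ x c) _; apply: esym.
apply: etrans (comb_eq k l (H2E a F x c) (H2E a G x c)) _; apply: esym.
apply: H2_comb_eq.
- rewrite !mulr_sumr -big_split; apply: eq_bigr => i _ /=.
  have -> : (fun y => (k *: F y + l *: G y) c) = (fun y => k * F y c + l * G y c).
    by apply/funext => y; rewrite !ffunE.
  apply: etrans (cpart_ext i dx (fun y dy => cpart_comb i k l (sF c) (sG c) dy)) _.
  by apply: cpart_comb dx; exact: SmC_cpart.
- rewrite !mulr_sumr -big_split; apply: eq_bigr => i _ /=.
  rewrite !combE; move: (F x c) (G x c) (F x _) (G x _) => *; ring.
- exact: combE.
Qed.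

Lemma momentum_comb (k l : C) F G x c : SmF F -> SmF G -> domain x ->
  momentum (fun y => k *: F y + l *: G y) x c = k * momentum F x c + l * momentum G x c.
Proof.
move=> sF sG dx.
apply: etrans (momentumE _ x c) _; apply: esym.
apply: etrans (comb_eq k l (momentumE F x c) (momentumE G x c)) _; apply: esym.
have -> : (fun y => (k *: F y + l *: G y) c) = (fun y => k * F y c + l * G y c).
  by apply/funext => y; rewrite !ffunE.
under eq_bigr do rewrite cpart_comb //.
by rewrite big_split -!mulr_sumr /=; ring.
Qed.

(** Nonvanishing is left out, so that for fixed E these functions are closed under linear
    combinations. *)
Definition stationary (E : C) F :=
  [/\ SmF F, forall x c, domain x -> H2 a F x c = E * F x c &
      forall x c, domain x -> momentum F x c = 0].

Lemma stationary_comb E (k l : C) F G : stationary E F -> stationary E G ->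
  stationary E (fun x => k *: F x + l *: G x).
Proof.
move=> [sF hF pF] [sG hG pG]; split; first exact: SmF_comb.
  move=> x c dx; apply: etrans (H2_comb k l c sF sG dx) _.
  apply: etrans (comb_eq k l (hF x c dx) (hG x c dx)) _.
  by rewrite combE; move: (F x c) (G x c) => *; ring.
move=> x c dx; apply: etrans (momentum_comb k l c sF sG dx) _.
apply: etrans (comb_eq k l (pF x c dx) (pG x c dx)) _.
by rewrite !mulr0 addr0.
Qed.

Lemma stationary_eigen E F : stationary E F -> nonzero F ->
  eigenfunction (H2 a) E F /\ eigenfunction (@momentum R n m) 0 F.
Proof.
move=> [sF hF pF] nF; split; split => //; try exact: SmF_smooth.
  by move=> x dx; apply/spinP => c; rewrite hF // scalE.
by move=> x dx; apply/spinP => c; rewrite pF // scale0r ffunE.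
Qed.

Lemma SmF_mu F : SmF F -> SmF (fun x => (mu a x)%:C *: F x).
Proof.
move=> sF c; apply: (@SmC_ext _ _ (fun x => (mu a x)%:C * F x c)).
  by move=> x _; rewrite scalE.
exact: SmC_mu.
Qed.

Lemma stationary0 s : stationary (E0 n a)%:C (fun x => (mu a x)%:C *: fam0 s x).
Proof.
split; first by apply: SmF_mu => c; exact: SmC_cst.
  by move=> x c dx; rewrite H2_fam0 // scalE.
by move=> x c dx; exact: momentum_fam0.
Qed.

Lemma stationary1 b s : stationary (E12 n a)%:C (fun x => (mu a x)%:C *: fam1 b s x).
Proof.
split; first by apply: SmF_mu; exact: SmF_wsum.
  by move=> x c dx; rewrite H2_fam1 // scalE.
by move=> x c dx; exact: momentum_fam1.
Qed.

(** By [H2_fam2], subtracting t Lambda s gives an eigenfunction exactly for t (E_34 - E_0) = 8, that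
    is, t = 1 / (2a + 1). *)
Definition pairstate b s : wavefun := fun x =>
  1 *: ((mu a x)%:C *: fam2 b s x) + (- (1 / (2 * a + 1))%:C) *: ((mu a x)%:C *: fam0 s x).

Lemma stationary2 b s : stationary (E34 n a)%:C (pairstate b s).
Proof.
have s2 : SmF (fun x => (mu a x)%:C *: fam2 b s x) by apply: SmF_mu; exact: SmF_wsum.
have s0 : SmF (fun x => (mu a x)%:C *: fam0 s x) by apply: SmF_mu => c; exact: SmC_cst.
split; first exact: SmF_comb.
  move=> x c dx; apply: etrans (H2_comb _ _ c s2 s0 dx) _.
  apply: etrans (comb_eq _ _ (H2_fam2 a b s c n_gt0 dx) (H2_fam0 a s c n_gt0 dx)) _.
  have -> : pairstate b s x c = 1 * ((mu a x)%:C * fam2 b s x c) + (- (1 / (2 * a + 1))%:C) * ((mu a x)%:C * symm s c).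
    by rewrite /pairstate combE !scalE.
  have -> : (E34 n a)%:C = (E0 n a)%:C + 8 * (2 * a + 1)%:C :> C.
    by rewrite /E34 !(rmorphD, rmorphM, rmorph_nat).
  have e : (2 * a + 1)%:C * (1 / (2 * a + 1))%:C = 1 :> C.
    rewrite -rmorphM mulrC mul1r mulVf //; apply: lt0r_neq0; apply: addr_gt0 => //.
    exact: mulr_gt0.
  rewrite [RHS]mulrDl.
  set t := (1 / (2 * a + 1))%:C in e *; set u := (2 * a + 1)%:C in e *.
  move: (fam2 b s x c) (symm s c) ((mu a x)%:C) => f g M.
  transitivity (((E0 n a)%:C + 8 * u) * (M * f) - 8 * (u * t) * (M * g) - t * ((E0 n a)%:C * (M * g))).
    by rewrite e; ring.
  by ring.
move=> x c dx; apply: etrans (momentum_comb _ _ c s2 s0 dx) _.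
apply: etrans (comb_eq _ _ (momentum_fam2 a b s c dx) (momentum_fam0 a s c dx)) _.
by rewrite !mulr0 addr0.
Qed.

Lemma cos_cis (t : R) : (cos t)%:C = 2^-1 * (cis t + cis (- t)) :> C.
Proof.
rewrite /cis cosN sinN; have -> : (cos t +i* sin t + (cos t +i* - sin t)) = 2 * (cos t)%:C.
  by apply: complexP => /=; ring.
by rewrite mulrA mulVf ?mul1r ?pnatr_eq0.
Qed.

Lemma sin_cis (t : R) : (sin t)%:C = - 'i * 2^-1 * (cis t - cis (- t)) :> C.
Proof.
rewrite /cis cosN sinN; have -> : (cos t +i* sin t - (cos t +i* - sin t)) = 2 * 'i * (sin t)%:C.
  by apply: complexP => /=; ring.
transitivity (- ('i * 'i) * (2^-1 * 2) * (sin t)%:C); last by ring.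
by rewrite mulii mulVf ?pnatr_eq0 // opprK !mul1r.
Qed.

Lemma Psi0E s : Psi0 a s = fun x => (mu a x)%:C *: fam0 s x.
Proof. by apply/funext => x; rewrite /Psi0 /Phi0 Lambda_cst. Qed.

Lemma fam1E b s x c : fam1 b s x c =
  \sum_j cis ((-1) ^+ b * (2 * (x 0 j - xbar x))) * spin_at s j c.
Proof.
rewrite wsumE; apply: eq_bigr => j _; rewrite /wave lin_q1; congr (cis _ * _); ring.
Qed.

Lemma fam2E' b s x c : fam2 b s x c =
  symm s c + \sum_i \sum_(j | i != j) cis ((-1) ^+ b * (2 * (x 0 i - x 0 j))) * spin_at s j c.
Proof.
rewrite wsumE (eq_bigr (fun p => cis ((-1) ^+ b * (2 * (x 0 p.1 - x 0 p.2))) * spin_at s p.2 c)); last first.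
  by move=> p _; rewrite /wave lin_q2; congr (cis _ * _); ring.
rewrite -(pair_bigA _ (fun i j => cis ((-1) ^+ b * (2 * (x 0 i - x 0 j))) * spin_at s j c)) /=.
rewrite /symm sum_ffunE -big_split; apply: eq_bigr => i _ /=.
rewrite (bigD1 i) //= subrr !mulr0 cis0 mul1r; congr (_ + _).
by apply: eq_bigl => j; rewrite eq_sym.
Qed.

Lemma mu_fam1E b s x c : ((mu a x)%:C *: fam1 b s x) c =
  (mu a x)%:C * \sum_j cis ((-1) ^+ b * (2 * (x 0 j - xbar x))) * spin_at s j c.
Proof. by apply: etrans (scalE _ _ _) _; congr (_ * _); exact: fam1E. Qed.

Definition pair_sum b s x c : C :=
  \sum_i \sum_(j | i != j) cis ((-1) ^+ b * (2 * (x 0 i - x 0 j))) * spin_at s j c.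

Lemma pairstateE b s x c : pairstate b s x c =
  1 * ((mu a x)%:C * (symm s c + pair_sum b s x c)) +
  (- (1 / (2 * a + 1))%:C) * ((mu a x)%:C * symm s c).
Proof.
apply: etrans (combE _ _ _ _ _) _; apply: comb_eq; apply: etrans (scalE _ _ _) _ => //.
by congr (_ * _); exact: fam2E'.
Qed.

Lemma Psi1E s : Psi1 a s = fun x => 2^-1 *: ((mu a x)%:C *: fam1 false s x)
   + 2^-1 *: ((mu a x)%:C *: fam1 true s x).
Proof.
apply/funext => x; apply/spinP => c; apply: esym; apply: etrans (combE _ _ _ _ _) _.
apply: etrans (comb_eq _ _ (mu_fam1E _ _ _ _) (mu_fam1E _ _ _ _)) _.
apply: esym; apply: etrans (scalE _ _ _) _; rewrite !(mulrCA 2^-1) -mulrDr; congr (_ * _).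
rewrite sum_ffunE !mulr_sumr -big_split; apply: eq_bigr => j _ /=.
rewrite scalE cos_cis expr0 expr1 mul1r mulN1r; move: (spin_at s j c) => w; ring.
Qed.

Lemma Psi2E s : Psi2 a s = fun x => (- 'i * 2^-1) *: ((mu a x)%:C *: fam1 false s x)
   + ('i * 2^-1) *: ((mu a x)%:C *: fam1 true s x).
Proof.
apply/funext => x; apply/spinP => c; apply: esym; apply: etrans (combE _ _ _ _ _) _.
apply: etrans (comb_eq _ _ (mu_fam1E _ _ _ _) (mu_fam1E _ _ _ _)) _.
apply: esym; apply: etrans (scalE _ _ _) _; rewrite !(mulrCA (_ * 2^-1)) -mulrDr; congr (_ * _).
rewrite sum_ffunE !mulr_sumr -big_split; apply: eq_bigr => j _ /=.
rewrite scalE sin_cis expr0 expr1 mul1r mulN1r; move: (spin_at s j c) => w; ring.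
Qed.

Lemma pair_sumD (k l : C) (f : R -> R) s x c :
  (forall t, (f t)%:C = k * cis t + l * cis (- t)) ->
  (\sum_i \sum_(j | i != j) (f (2 * (x 0 i - x 0 j)))%:C *: spin_at s j) c =
  k * pair_sum false s x c + l * pair_sum true s x c.
Proof.
move=> fE; rewrite sum_ffunE !mulr_sumr -big_split; apply: eq_bigr => i _ /=.
rewrite sum_ffunE !mulr_sumr -big_split; apply: eq_bigr => j _ /=.
rewrite scalE fE expr0 expr1 mul1r mulN1r; move: (spin_at s j c) => w; ring.
Qed.

Lemma Psi3E s : Psi3 a s = fun x => 2^-1 *: pairstate false s x + 2^-1 *: pairstate true s x.
Proof.
apply/funext => x; apply/spinP => c; apply: esym; apply: etrans (combE _ _ _ _ _) _.
apply: etrans (comb_eq _ _ (pairstateE _ _ _ _) (pairstateE _ _ _ _)) _.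
apply: esym; apply: etrans (scalE _ _ _) _; rewrite /Phi0 Lambda_cst.
rewrite [X in _ * X]ffunE scalE (@pair_sumD 2^-1 2^-1); last by move=> t; rewrite cos_cis mulrDr.
(* Lambda s comes once from the pairs i = j and - 1 / (2a + 1) times from the correction: this is
   the coefficient in Psi_3. *)
have e : (2 * a / (2 * a + 1))%:C = 1 - (1 / (2 * a + 1))%:C :> C.
  rewrite -[X in _ = X - _](rmorph1 (@real_complex R)) -rmorphB; congr (_%:C); field.
  by apply: lt0r_neq0; apply: addr_gt0 => //; exact: mulr_gt0.
have h2 : 2^-1 * 2 = 1 :> C by rewrite mulVf ?pnatr_eq0.
rewrite e; move: (symm s c) (pair_sum _ _ _ _) (pair_sum _ _ _ _) ((mu a x)%:C) ((1 / (2 * a + 1))%:C) => g f f' M t.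
transitivity (M * ((2^-1 * 2) * (1 - t) * g + (2^-1 * f + 2^-1 * f'))); first by rewrite h2; ring.
by ring.
Qed.

(** The multiples of Lambda s are the same for both signs of the exponent and drop out of the
    difference. *)
Lemma Psi4E s : Psi4 a s = fun x =>
  (- 'i * 2^-1) *: pairstate false s x + ('i * 2^-1) *: pairstate true s x.
Proof.
apply/funext => x; apply/spinP => c; apply: esym; apply: etrans (combE _ _ _ _ _) _.
apply: etrans (comb_eq _ _ (pairstateE _ _ _ _) (pairstateE _ _ _ _)) _.
apply: esym; apply: etrans (scalE _ _ _) _.
rewrite (@pair_sumD (- 'i * 2^-1) ('i * 2^-1)); last by move=> t; rewrite sin_cis; ring.
move: (symm s c) (pair_sum _ _ _ _) (pair_sum _ _ _ _) ((mu a x)%:C) ((1 / (2 * a + 1))%:C) => g f f' M t.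
by ring.
Qed.

Lemma exact_states s :
     [/\ nonzero (Psi0 a s) ->
           eigenfunction (H2 a) (E0 n a)%:C (Psi0 a s) /\
           eigenfunction (@momentum R n m) 0 (Psi0 a s),
         nonzero (Psi1 a s) ->
           eigenfunction (H2 a) (E12 n a)%:C (Psi1 a s) /\
           eigenfunction (@momentum R n m) 0 (Psi1 a s),
         nonzero (Psi2 a s) ->
           eigenfunction (H2 a) (E12 n a)%:C (Psi2 a s) /\
           eigenfunction (@momentum R n m) 0 (Psi2 a s),
         nonzero (Psi3 a s) ->
           eigenfunction (H2 a) (E34 n a)%:C (Psi3 a s) /\
           eigenfunction (@momentum R n m) 0 (Psi3 a s) &
         nonzero (Psi4 a s) ->
           eigenfunction (H2 a) (E34 n a)%:C (Psi4 a s) /\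
           eigenfunction (@momentum R n m) 0 (Psi4 a s)].
Proof.
split; apply: stationary_eigen.
- rewrite Psi0E; exact: stationary0.
- rewrite Psi1E; apply: stationary_comb; exact: stationary1.
- rewrite Psi2E; apply: stationary_comb; exact: stationary1.
- rewrite Psi3E; apply: stationary_comb; exact: stationary2.
- rewrite Psi4E; apply: stationary_comb; exact: stationary2.
Qed.

End ExactStates.

(** * The algebraic Hamiltonian on monomials *)


(** The conditions are open, so a function known only where they hold can be replaced by its
    polynomial expression before differentiating. *)
Lemma derive_zdomain_eq (K : numFieldType) (n : nat) (z v : 'rV[K]_n.+1) (f g : 'rV[K]_n.+1 -> K^o) :
  (forall i, z 0 i != 0) -> (forall i, z 0 i != z 0 (ordS i)) ->
  (forall w : 'rV[K]_n.+1, (forall i, w 0 i != 0) -> (forall i, w 0 i != w 0 (ordS i)) -> f w = g w) ->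
  'D_v f z = 'D_v g z.
Proof.
move=> d1 d2 fg.
have cc i : {for z, continuous (fun y : 'rV[K]_n.+1 => y 0 i : K^o)} by exact: coord_continuous.
have h1 : \forall y \near z, forall i, (y : 'rV[K]_n.+1) 0 i != 0.
  apply: (@near_forall K n.+1 'I_n.+1 (fun i y => y 0 i != 0)) => i.
  exact: (cvgr_neq0 _ (cc i) (d1 i)).
have h2 : \forall y \near z, forall i, (y : 'rV[K]_n.+1) 0 i != y 0 (ordS i).
  apply: (@near_forall K n.+1 'I_n.+1 (fun i y => y 0 i != y 0 (ordS i))) => i.
  have c : {for z, continuous (fun y : 'rV[K]_n.+1 => y 0 i - y 0 (ordS i) : K^o)} by exact: continuousB.
  have c0 : z 0 i - z 0 (ordS i) != 0 by rewrite subr_eq0.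
  apply: (@filterS _ (nbhs z) _ _ _ _ (cvgr_neq0 _ c c0)) => y.
  by rewrite subr_eq0.
apply: near_eq_derive.
by apply: (@filterS2 _ (nbhs z) _ _ _ _ _ h1 h2) => y; exact: fg.
Qed.

Section Monomials.
Variables (R : realType) (n m : nat).
Local Notation N := n.+1.
Local Notation C := (R[i]).
Local Notation spin := (spin R n m).
Local Notation zfun := ('rV[C]_N -> spin).
Implicit Types (c : config n m) (z : 'rV[C]_N) (e : 'I_N -> nat) (F : zfun).

Lemma is_derive_coord i k z :
  is_derive z (delta_mx 0 i) (fun w : 'rV[C]_N => w 0 k : C^o) ((k == i)%:R : C^o).
Proof.
split; last exact: derive_coord.
by apply: diff_derivable; exact: (@differentiable_coord C 1 N z 0 k).
Qed.

Definition mon e z : C := \prod_k z 0 k ^+ e k.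

(** At exponent 0 the subtraction truncates; this is harmless because the derivative carries the
    factor [e i]. *)
Definition dec e (i k : 'I_N) : nat := (e k - (k == i))%N.

Lemma is_derive_others i e (r : seq 'I_N) z :
  is_derive z (delta_mx 0 i) (fun w : 'rV[C]_N => \prod_(k <- r | k != i) w 0 k ^+ e k : C^o) (0 : C^o).
Proof.
elim: r => [|k r IH].
  have -> : (fun w : 'rV[C]_N => \prod_(k <- [::] | k != i) w 0 k ^+ e k : C^o) = cst 1.
    by apply/funext => w; rewrite big_nil.
  exact: is_derive_cst.
have [->|ki] := eqVneq k i.
  have -> : (fun w : 'rV[C]_N => \prod_(j <- i :: r | j != i) w 0 j ^+ e j : C^o) =
    (fun w : 'rV[C]_N => \prod_(k <- r | k != i) w 0 k ^+ e k : C^o).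
    by apply/funext => w; rewrite big_cons eqxx.
  exact: IH.
have -> : (fun w : 'rV[C]_N => \prod_(j <- k :: r | j != i) w 0 j ^+ e j : C^o) =
    (fun w : 'rV[C]_N => w 0 k : C^o) ^+ e k * (fun w : 'rV[C]_N => \prod_(k <- r | k != i) w 0 k ^+ e k : C^o).
  by apply/funext => w; rewrite big_cons ki mulrfctE exprfctE.
have h := is_deriveM (is_deriveX (e k) (is_derive_coord i k z)) IH.
by apply: (is_derive_eq h); rewrite (negbTE ki) !scaler0 addr0.
Qed.

Lemma is_derive_mon i e z :
  is_derive z (delta_mx 0 i) (fun w : 'rV[C]_N => mon e w : C^o)
    ((e i)%:R * mon (dec e i) z : C^o).
Proof.
have -> : (fun w : 'rV[C]_N => mon e w : C^o) =
    (fun w : 'rV[C]_N => w 0 i : C^o) ^+ e i * (fun w : 'rV[C]_N => \prod_(k | k != i) w 0 k ^+ e k : C^o).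
  by apply/funext => w; rewrite /mon (bigD1 i) // mulrfctE exprfctE.
have hi := is_derive_coord i i z; rewrite eqxx in hi.
have h := is_deriveM (is_deriveX (e i) hi) (is_derive_others i e (index_enum 'I_N) z).
apply: (is_derive_eq h); rewrite scaler0 add0r /mon [in RHS](bigD1 i) //= /dec eqxx subn1.
rewrite -[LHS]/(\prod_(k < N | k != i) z 0 k ^+ e k * (((e i)%:R * z 0 i ^+ (e i).-1) * 1)).
rewrite mulr1 mulrC -mulrA; congr (_ * (_ * _)).
by apply: eq_bigr => k /negbTE ->; rewrite subn0.
Qed.

Definition mon_sum (I : Type) (r : seq I) (e : I -> 'I_N -> nat) (v : I -> spin) : zfun :=
  fun z => \sum_(l <- r) mon (e l) z *: v l.

Lemma mon_sumE (I : Type) (r : seq I) (e : I -> 'I_N -> nat) (v : I -> spin) z c : mon_sum r e v z c = \sum_(l <- r) mon (e l) z * v l c.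
Proof. by rewrite /mon_sum sum_ffunE; apply: eq_bigr => l _; rewrite scalE. Qed.

Lemma is_derive_msum (I : Type) (r : seq I) (e : I -> 'I_N -> nat) (v : I -> spin) i z c :
  is_derive z (delta_mx 0 i) (fun w : 'rV[C]_N => mon_sum r e v w c : C^o)
    (mon_sum r (fun l => dec (e l) i) (fun l => (e l i)%:R *: v l) z c : C^o).
Proof.
elim: r => [|l r IH].
  have -> : (fun w : 'rV[C]_N => mon_sum [::] e v w c : C^o) = cst 0.
    by apply/funext => w; rewrite mon_sumE big_nil.
  by rewrite mon_sumE big_nil; exact: is_derive_cst.
have -> : (fun w : 'rV[C]_N => mon_sum (l :: r) e v w c : C^o) =
    v l c *: (fun w : 'rV[C]_N => mon (e l) w : C^o) + (fun w : 'rV[C]_N => mon_sum r e v w c : C^o).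
  by apply/funext => w; rewrite addrfctE !mon_sumE big_cons mulrC.
have h := is_deriveD (is_deriveZ (v l c) (is_derive_mon i (e l) z)) IH.
apply: (is_derive_eq h); rewrite (mon_sumE (l :: r)) big_cons; congr (_ + _); last by rewrite mon_sumE.
apply: etrans _ (congr1 (fun t => _ * t) (esym (scalE _ _ _))).
rewrite -[LHS]/(v l c * ((e l i)%:R * mon (dec (e l) i) z)).
by move: (v l c) (mon _ _) => *; ring.
Qed.

(** The conclusion has the form of the hypothesis, so the lemma can be iterated for second
    derivatives. *)
Lemma zpartial_msum (I : Type) (r : seq I) (e : I -> 'I_N -> nat) (v : I -> spin) i F :
  (forall z, zdomain z -> F z = mon_sum r e v z) ->
  forall z, zdomain z ->
    zpartial i F z = mon_sum r (fun l => dec (e l) i) (fun l => (e l i)%:R *: v l) z.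
Proof.
move=> FE z dz; apply/ffunP => c; rewrite [LHS]ffunE.
have [d1 d2] := dz; have [_ <-] := is_derive_msum r e v i z c.
by apply: derive_zdomain_eq => // w w1 w2; rewrite FE.
Qed.

Lemma mon_dec e i z : z 0 i != 0 -> z 0 i * ((e i)%:R * mon (dec e i) z) = (e i)%:R * mon e z.
Proof.
move=> zi; case E : (e i) => [|k]; first by rewrite !mul0r mulr0.
rewrite mulrCA; congr (_ * _); rewrite /mon [in LHS](bigD1 i) //= [in RHS](bigD1 i) //=.
rewrite /dec eqxx subn1 E mulrA -exprS; congr (_ * _).
by apply: eq_bigr => j /negbTE ->; rewrite subn0.
Qed.

Lemma zpartial1 (I : Type) (r : seq I) (e : I -> 'I_N -> nat) (v : I -> spin) i F z c :
  (forall z, zdomain z -> F z = mon_sum r e v z) -> zdomain z ->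
  z 0 i * zpartial i F z c = \sum_(l <- r) (e l i)%:R * (mon (e l) z * v l c).
Proof.
move=> FE dz; have [z0 _] := dz; rewrite (zpartial_msum i FE dz) mon_sumE mulr_sumr.
apply: eq_bigr => l _; rewrite scalE.
transitivity (z 0 i * ((e l i)%:R * mon (dec (e l) i) z) * v l c).
  by move: (v l c) (mon _ _) (z 0 i) => *; ring.
by rewrite mon_dec // mulrA.
Qed.

Lemma zpartial2 (I : Type) (r : seq I) (e : I -> 'I_N -> nat) (v : I -> spin) i F z c :
  (forall z, zdomain z -> F z = mon_sum r e v z) -> zdomain z ->
  z 0 i ^+ 2 * zpartial i (zpartial i F) z c =
  \sum_(l <- r) ((e l i)%:R ^+ 2 - (e l i)%:R) * (mon (e l) z * v l c).
Proof.
move=> FE dz; have [z0 _] := dz; rewrite expr2 -mulrA.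
rewrite (zpartial1 i c (zpartial_msum i FE) dz) mulr_sumr.
apply: eq_bigr => l _; rewrite scalE.
transitivity ((dec (e l) i i)%:R * (z 0 i * ((e l i)%:R * mon (dec (e l) i) z) * v l c)).
  by move: (v l c) => u; ring.
rewrite mon_dec // /dec eqxx subn1; case: (e l i) => [|k]; first by ring.
by rewrite /= -[k.+1]addn1 natrD; ring.
Qed.

(** Each summand splits into half of (z + z') / (z - z') (D - D') and half of D + D'; around the
    cycle the second halves add up to the sum of the D i. This brings the first-order part of [T2]
    to the form of the cot terms. *)
Lemma bond_sum (z : 'rV[C]_N) (D : 'I_N -> C) : (forall i, z 0 i != z 0 (ordS i)) ->
  \sum_i (z 0 i - z 0 (ordS i))^-1 * (z 0 i * D i - z 0 (ordS i) * D (ordS i)) =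
  2^-1 * (\sum_i (z 0 i + z 0 (ordS i)) / (z 0 i - z 0 (ordS i)) * (D i - D (ordS i)))
  + \sum_i D i.
Proof.
move=> zz; have h2 : 2^-1 * 2 = 1 :> C by rewrite mulVf ?pnatr_eq0.
transitivity (2^-1 * (\sum_i (z 0 i + z 0 (ordS i)) / (z 0 i - z 0 (ordS i)) * (D i - D (ordS i)))
  + 2^-1 * \sum_i (D i + D (ordS i))).
  rewrite -mulrDr -big_split mulr_sumr; apply: eq_bigr => i _ /=.
  by have := zz i; rewrite -subr_eq0 => h; field.
rewrite big_split (sum_ordS D) /=; congr (_ + _).
transitivity (2^-1 * 2 * \sum_i D i); first by ring.
by rewrite h2 mul1r.
Qed.

(** The Euler terms cancel: - 4 J from z^2 d^2 = (z d)^2 - z d, 8a J from the bonds, and 4 (1 - 2a)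
    J, which explains the coefficient of [J0] in [H2bar]. *)
Lemma H2bar_comb_eq (a t1 t2 J t3 f E k1 k2 k3 : C) :
  t1 = k1 - J -> t2 = 2^-1 * k2 + J -> t3 = k3 ->
  4 * (t1 + (2 * a) * t2 - (2 * a) * t3) + (4 * (1 - 2 * a)) * J + E * f =
  4 * k1 + 4 * a * k2 + E * f + 2 * a * (- 4 * k3).
Proof.
have h2 : 2 * 2^-1 = 1 :> C by rewrite mulfV ?pnatr_eq0.
move=> -> -> ->.
transitivity (4 * k1 + 4 * a * (2 * 2^-1) * k2 + E * f + 2 * a * (- 4 * k3)); first by ring.
by rewrite h2 mulr1.
Qed.

Lemma lin3E (k1 k2 k3 : C) (u v w : spin) c :
  (k1 *: u + k2 *: v + k3 *: w) c = k1 * u c + k2 * v c + k3 * w c.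
Proof. by rewrite !ffunE. Qed.

Lemma lin3E' (k2 k3 : C) (u v w : spin) c :
  (u + k2 *: v - k3 *: w) c = u c + k2 * v c - k3 * w c.
Proof. by rewrite !ffunE. Qed.

Lemma H2barE a F z c : H2bar a F z c =
  4 * (\sum_i z 0 i ^+ 2 * zpartial i (zpartial i F) z c
    + (2 * a%:C) * (\sum_i (z 0 i - z 0 (ordS i))^-1 *
      (z 0 i ^+ 2 * zpartial i F z c - z 0 (ordS i) ^+ 2 * zpartial (ordS i) F z c))
    - (2 * a%:C) * (\sum_i (z 0 i * z 0 (ordS i) / (z 0 i - z 0 (ordS i)) ^+ 2) *
      (F z c - F (xcol i (ordS i) z) c)))
  + (4 * (1 - 2 * a%:C)) * (\sum_i z 0 i * zpartial i F z c) + (E0 n a)%:C * F z c.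
Proof.
apply: etrans (lin3E _ _ _ _ _ _ _) _; rewrite !(rmorphM, rmorphB, rmorph1, rmorph_nat).
congr (_ * _ + _ * _ + _); last by rewrite sum_ffunE; apply: eq_bigr => i _; rewrite scalE.
apply: etrans (lin3E' _ _ _ _ _ _) _; rewrite !(rmorphM, rmorphB, rmorph1, rmorph_nat).
congr (_ + _ * _ - _ * _); rewrite sum_ffunE; apply: eq_bigr => i _; rewrite scalE //.
- by congr (_ * _); rewrite ffunE scalE; congr (_ + _); rewrite ffunE scalE.
- by congr (_ * _); rewrite ffunE; congr (_ + _); rewrite ffunE.
Qed.

(** On symmetric functions the exchange K of coordinates acts as the exchange S of spins. This gives
    the right-hand side the shape of [H2_wsum]. *)
Lemma H2bar_msum a (I : Type) (r : seq I) (e : I -> 'I_N -> nat) (v : I -> spin) F z c :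
  (forall z, zdomain z -> F z = mon_sum r e v z) -> zdomain z ->
  (forall i, F (xcol i (ordS i) z) c = F z (swapc i (ordS i) c)) ->
  H2bar a F z c =
  \sum_(l <- r) (4 * \sum_i (e l i)%:R ^+ 2) * (mon (e l) z * v l c)
  + 4 * a%:C * (\sum_i (z 0 i + z 0 (ordS i)) / (z 0 i - z 0 (ordS i)) *
      \sum_(l <- r) ((e l i)%:R - (e l (ordS i))%:R) * (mon (e l) z * v l c))
  + (E0 n a)%:C * F z c
  + 2 * a%:C * \sum_i (- 4 * (z 0 i * z 0 (ordS i) / (z 0 i - z 0 (ordS i)) ^+ 2)) *
      (F z c - F z (swapc i (ordS i) c)).
Proof.
move=> FE dz FS; have [z0 zz] := dz.
pose D i := \sum_(l <- r) (e l i)%:R * (mon (e l) z * v l c).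
have hD i : z 0 i * zpartial i F z c = D i by exact: zpartial1.
apply: etrans (H2barE a F z c) _.
have -> : \sum_(l <- r) (4 * \sum_i (e l i)%:R ^+ 2) * (mon (e l) z * v l c) =
   4 * \sum_(l <- r) (\sum_i (e l i)%:R ^+ 2) * (mon (e l) z * v l c).
  by rewrite mulr_sumr; apply: eq_bigr => l _; rewrite !mulrA.
have -> : \sum_i (- 4 * (z 0 i * z 0 (ordS i) / (z 0 i - z 0 (ordS i)) ^+ 2)) *
      (F z c - F z (swapc i (ordS i) c)) =
  - 4 * \sum_i (z 0 i * z 0 (ordS i) / (z 0 i - z 0 (ordS i)) ^+ 2) *
      (F z c - F z (swapc i (ordS i) c)).
  by rewrite [RHS]mulr_sumr; apply: eq_bigr => i _; rewrite !mulrA.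
apply: H2bar_comb_eq.
- have hJ : \sum_i z 0 i * zpartial i F z c = \sum_i D i by apply: eq_bigr => i _; exact: hD.
  have hT : \sum_i z 0 i ^+ 2 * zpartial i (zpartial i F) z c =
      \sum_i \sum_(l <- r) ((e l i)%:R ^+ 2 - (e l i)%:R) * (mon (e l) z * v l c).
    by apply: eq_bigr => i _; exact: zpartial2.
  apply: etrans hT _; apply: etrans _ (congr1 (fun t => _ - t) (esym hJ)).
  rewrite /D exchange_big [X in _ = _ - X]exchange_big -sumrB; apply: eq_bigr => l _ /=.
  by rewrite -!mulr_suml -mulrBl sumrB.
- have hJ : \sum_i z 0 i * zpartial i F z c = \sum_i D i by apply: eq_bigr => i _; exact: hD.
  apply: etrans _ (congr1 (fun t => _ + t) (esym hJ)).
  have hL : \sum_i (z 0 i - z 0 (ordS i))^-1 *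
      (z 0 i ^+ 2 * zpartial i F z c - z 0 (ordS i) ^+ 2 * zpartial (ordS i) F z c) =
      \sum_i (z 0 i - z 0 (ordS i))^-1 * (z 0 i * D i - z 0 (ordS i) * D (ordS i)).
    apply: eq_bigr => i _; congr (_ * (_ - _)); rewrite expr2 -mulrA; congr (_ * _); exact: hD.
  apply: etrans hL _.
  rewrite bond_sum //; congr (_ * _ + _); apply: eq_bigr => i _; congr (_ * _).
  by rewrite -sumrB; apply: eq_bigr => l _; rewrite mulrBl.
- by apply: eq_bigr => i _; congr (_ * (_ - _)); exact: FS.
Qed.

Lemma wave_mon (b : bool) e (x : 'rV[R]_N) :
  wave (fun k => (-1) ^+ b * (e k)%:R) x = mon e (expz b x).
Proof.
rewrite /wave /lin mulr_sumr cis_sum /mon; apply: eq_bigr => k _.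
by rewrite mxE cisX; congr cis; ring.
Qed.

Lemma H2bar_congr (A A' B B' D D' E E' : C) :
  A = A' -> B = B' -> D = D' -> E = E' -> A + B + D + E = A' + B' + D' + E'.
Proof. by move=> -> -> -> ->. Qed.

(** Both operators are already known explicitly on this finite sum, so the four groups of terms are
    matched one by one; the sign of the exponents occurs squared. *)
Lemma H2_of_H2bar a (b : bool) (I : Type) (r : seq I) (e : I -> 'I_N -> nat) (v : I -> spin) F (x : 'rV[R]_N) c : (0 < n)%N ->
  (forall z, zdomain z -> F z = mon_sum r e v z) -> domain x -> zdomain (expz b x) ->
  (forall i c, F (xcol i (ordS i) (expz b x)) c = F (expz b x) (swapc i (ordS i) c)) ->
  H2 a (fun y => (mu a y)%:C *: wsum r (fun l k => (-1) ^+ b * (e l k)%:R) v y) x c =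
  (mu a x)%:C * H2bar a F (expz b x) c.
Proof.
move=> n0 FE dx dz FS; have [_ _ d] := dx.
apply: etrans (H2_wsum a r _ v c n0 dx) _; congr (_ * _); apply: esym.
apply: etrans (H2bar_msum a FE dz (fun i => FS i c)) _.
have wE c' : wsum r (fun l k => (-1) ^+ b * (e l k)%:R) v x c' = F (expz b x) c'.
  rewrite FE // wsumE mon_sumE; apply: eq_bigr => l _; by rewrite wave_mon.
have e1 : \sum_(l <- r) (4 * \sum_i (e l i)%:R ^+ 2) * (mon (e l) (expz b x) * v l c) =
    \sum_(l <- r) (4 * \sum_i ((-1) ^+ b * (e l i)%:R) ^+ 2)%:C *
      (wave (fun k => (-1) ^+ b * (e l k)%:R) x * v l c).
  apply: eq_bigr => l _; rewrite wave_mon; congr (_ * _).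
  rewrite rmorphM rmorph_nat rmorph_sum; congr (_ * _); apply: eq_bigr => i _.
  by rewrite exprMn sqrr_sign mul1r rmorphXn rmorph_nat.
have e2 : 4 * a%:C * (\sum_i (expz b x 0 i + expz b x 0 (ordS i)) / (expz b x 0 i - expz b x 0 (ordS i)) *
      \sum_(l <- r) ((e l i)%:R - (e l (ordS i))%:R) * (mon (e l) (expz b x) * v l c)) =
    (4 * a)%:C * (\sum_i (- 'i * (cot (gap x i))%:C) *
        \sum_(l <- r) ((-1) ^+ b * (e l i)%:R - (-1) ^+ b * (e l (ordS i))%:R)%:C *
           (wave (fun k => (-1) ^+ b * (e l k)%:R) x * v l c)).
  rewrite [in RHS]rmorphM rmorph_nat; congr (_ * _); apply: eq_bigr => i _.
  rewrite (cot_expz b (d i)) !mulr_sumr; apply: eq_bigr => l _.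
  rewrite wave_mon -mulrBr rmorphM rmorphB !rmorph_nat.
  move: (v l c) (mon _ _) => u w.
  transitivity (((-1) ^+ b)%:C * ((-1) ^+ b)%:C * ((expz b x 0 i + expz b x 0 (ordS i)) /
     (expz b x 0 i - expz b x 0 (ordS i)) * (((e l i)%:R - (e l (ordS i))%:R) * (w * u)))).
    by rewrite signr_sq mul1r.
  by ring.
apply: (H2bar_congr e1 e2); first by congr (_ * _); exact: esym (wE c).
rewrite [in RHS]rmorphM rmorph_nat; congr (_ * _).
by apply: eq_bigr => i _; rewrite (csc2_expz b (d i)) !wE.
Qed.

End Monomials.

(** * The invariant spaces *)


Section Atoms.
Variables (R : realType) (n m : nat).
Local Notation N := n.+1.
Local Notation C := (R[i]).
Local Notation spin := (spin R n m).
Local Notation zfun := ('rV[C]_N -> spin).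
Implicit Types (c : config n m) (z : 'rV[C]_N) (s : spin) (F : zfun).

Definition zprod z : C := \prod_k z 0 k.
Definition zsum z : C := \sum_k z 0 k.
Definition zisum z : C := \sum_k (z 0 k)^-1.

(* With T = \prod_k z_k, the five kinds of homogeneous elements of the invariant
   spaces: T^k Lambda s, T^k \sum_i z_i s_i, T^(k+1) \sum_i s_i / z_i,
   T^(k+1) \sum_(i, j) (z_i / z_j) s_i and T^(k+1) \sum_(i, j) (z_j / z_i) s_i.
   Since sigma_1 Lambda s = \sum_i z_i (N Lambda s)_i and
   tau_(N-1) = T \sum_i 1 / z_i, they span. *)
Inductive kind := KA | KB | KC | KD | KE.

Definition atom := (kind * nat * spin)%type.

Definition prefactor (t : kind) (k : nat) z : C :=
  match t with
  | KA | KB => zprod z ^+ k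
  | KC => zprod z ^+ k.+1
  | KD => zprod z ^+ k.+1 * zisum z
  | KE => zprod z ^+ k.+1 * zsum z
  end.

Definition weight (t : kind) (u : C) : C :=
  match t with KA => 1 | KB | KD => u | KC | KE => u^-1 end.

Definition atom_val (al : atom) : zfun := fun z =>
  prefactor al.1.1 al.1.2 z *: \sum_i weight al.1.1 (z 0 i) *: spin_at al.2 i.

Definition atom_deg (al : atom) : nat :=
  match al.1.1 with
  | KA => N * al.1.2
  | KB => (N * al.1.2).+1
  | KC => N * al.1.2 + n
  | KD | KE => N * al.1.2.+1
  end.

(** An inverse 1/z_i is absorbed by one factor z_1 ... z_N, leaving the product of the other
    variables; all exponents are then natural numbers. *)
Definition atom_terms (al : atom) : seq (('I_N -> nat) * spin) :=
  let k := al.1.2 in let s := al.2 in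
  match al.1.1 with
  | KA => [:: (fun=> k, symm s)]
  | KB => [seq (fun l => k + (l == i), spin_at s i)%N | i <- index_enum 'I_N]
  | KC => [seq (fun l => k + (l != i), spin_at s i)%N | i <- index_enum 'I_N]
  | KD => [seq (fun l => k + ((l != p.2) + (l == p.1)), spin_at s p.1)%N
          | p <- index_enum ('I_N * 'I_N)%type]
  | KE => [seq (fun l => k + ((l != p.2) + (l == p.1)), spin_at s p.2)%N
          | p <- index_enum ('I_N * 'I_N)%type]
  end.

Lemma mon_const k z : mon (fun=> k) z = zprod z ^+ k.
Proof. by rewrite /mon prodrXl. Qed.

Lemma monD (e f : 'I_N -> nat) z : mon (fun l => e l + f l)%N z = mon e z * mon f z.
Proof. by rewrite /mon -big_split; apply: eq_bigr => l _; rewrite exprD. Qed.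

Lemma mon_delta i z : mon (fun l => (l == i) : nat) z = z 0 i.
Proof.
rewrite /mon (bigD1 i) //= eqxx big1 ?mulr1 // => l /negbTE ->.
by rewrite expr0.
Qed.

Lemma mon_codelta i z : z 0 i != 0 -> mon (fun l => (l != i) : nat) z = zprod z / z 0 i.
Proof.
move=> zi; rewrite /zprod (bigD1 i) //= mulrAC mulfV // mul1r.
rewrite /mon (bigD1 i) //= eqxx mul1r.
by apply: eq_bigr => l ->.
Qed.

Lemma atom_termsE al z : (forall i, z 0 i != 0) ->
  atom_val al z = \sum_(l <- atom_terms al) mon l.1 z *: l.2.
Proof.
move=> z0; case: al => -[t k] s; rewrite /atom_val /=; case: t => /=.
- rewrite big_seq1 mon_const; congr (_ *: _); apply: eq_bigr => i _.
  exact: scale1r.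
- rewrite big_map scaler_sumr; apply: eq_bigr => i _.
  by rewrite scalerA monD mon_const mon_delta.
- rewrite big_map scaler_sumr; apply: eq_bigr => i _.
  by rewrite scalerA monD mon_const mon_codelta // exprSr mulrA.
- rewrite big_map scaler_sumr.
  rewrite -(pair_bigA _ (fun i j => mon (fun l => k + ((l != j) + (l == i)))%N z *: spin_at s i)) /=.
  apply: eq_bigr => i _; rewrite scalerA -scaler_suml; congr (_ *: _).
  rewrite /zisum mulr_sumr mulr_suml; apply: eq_bigr => j _.
  by rewrite monD mon_const monD mon_codelta // mon_delta exprSr; ring.
- rewrite big_map scaler_sumr.
  rewrite -(pair_bigA _ (fun i j => mon (fun l => k + ((l != j) + (l == i)))%N z *: spin_at s j)) /=.
  rewrite exchange_big; apply: eq_bigr => j _ /=; rewrite scalerA -scaler_suml; congr (_ *: _).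
  rewrite /zsum mulr_sumr mulr_suml; apply: eq_bigr => i _.
  by rewrite monD mon_const monD mon_codelta // mon_delta exprSr; ring.
Qed.

Lemma sum_deltan (i : 'I_N) : (\sum_(l < N) (l == i) = 1)%N.
Proof. by rewrite (bigD1 i) //= eqxx big1 // => l /negbTE ->. Qed.

Lemma sum_codeltan (i : 'I_N) : (\sum_(l < N) (l != i) = n)%N.
Proof.
apply/eqP; rewrite -(eqn_add2r 1) -{1}(sum_deltan i) -big_split /=.
rewrite (eq_bigr (fun=> 1%N)) ?sum1_card ?card_ord ?addn1 // => l _.
by case: (l == i).
Qed.

(** All monomials of an element have the same degree. The weights f are arbitrary so that the result
    applies directly to the sums obtained from the momentum operator. *)
Lemma atom_termsD (al : atom) (f : ('I_N -> nat) * spin -> C) :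
  \sum_(l <- atom_terms al) (\sum_k (l.1 k)%:R : C) * f l =
  (atom_deg al)%:R * \sum_(l <- atom_terms al) f l.
Proof.
have sc k : (\sum_(l < N) k = N * k)%N by rewrite sum_nat_const card_ord.
case: al => -[t k] s; rewrite /atom_deg mulr_sumr /=; case: t => /=.
- by rewrite !big_seq1 /= -natr_sum sc.
- rewrite !big_map; apply: eq_bigr => i _ /=.
  by rewrite -natr_sum big_split /= sc sum_deltan addn1.
- rewrite !big_map; apply: eq_bigr => i _ /=.
  by rewrite -natr_sum big_split /= sc sum_codeltan.
- rewrite !big_map; apply: eq_bigr => p _ /=.
  by rewrite -natr_sum !big_split /= sc sum_deltan sum_codeltan addn1 mulnSr.
- rewrite !big_map; apply: eq_bigr => p _ /=.
  by rewrite -natr_sum !big_split /= sc sum_deltan sum_codeltan addn1 mulnSr.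
Qed.

Lemma atom_homog al (u : C) z : u != 0 ->
  atom_val al (u *: z) = u ^+ atom_deg al *: atom_val al z.
Proof.
move=> u0; case: al => -[t k] s; rewrite /atom_val /atom_deg /=.
have eP : zprod (u *: z) = u ^+ N * zprod z.
  transitivity (\prod_(i < N) (u * z 0 i)); first by apply: eq_bigr => i _; rewrite mxE.
  by rewrite big_split prodr_const card_ord.
have eS : zsum (u *: z) = u * zsum z.
  by rewrite /zsum mulr_sumr; apply: eq_bigr => i _; rewrite mxE.
have eI : zisum (u *: z) = u^-1 * zisum z.
  by rewrite /zisum mulr_sumr; apply: eq_bigr => i _; rewrite mxE invfM.
have eU : \sum_i (u *: z) 0 i *: spin_at s i = u *: \sum_i z 0 i *: spin_at s i.
  by rewrite scaler_sumr; apply: eq_bigr => i _; rewrite mxE scalerA.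
have eV : \sum_i ((u *: z) 0 i)^-1 *: spin_at s i = u^-1 *: \sum_i (z 0 i)^-1 *: spin_at s i.
  by rewrite scaler_sumr; apply: eq_bigr => i _; rewrite mxE scalerA invfM.
have uN : u ^+ N = u ^+ n * u by rewrite exprSr.
case: t => /=; rewrite ?eP ?eS ?eI ?eU ?eV !scalerA; congr (_ *: _).
- by rewrite exprMn exprM.
- by rewrite exprMn [u ^+ (_ * _).+1]exprSr exprM; ring.
- rewrite exprMn exprD exprM [(u ^+ N) ^+ k.+1]exprSr.
  have -> : forall x y : C, x * u ^+ N * y / u = x * (u ^+ N / u) * y by move=> *; ring.
  by rewrite [X in X / u]uN mulfK.
- rewrite exprMn exprM; set P := (_ ^+ k.+1); set Q := (_ ^+ k.+1).
  transitivity (P * Q * zisum z * (u^-1 * u)); first by ring.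
  by rewrite mulVf // mulr1 mulrA.
- rewrite exprMn exprM; set P := (_ ^+ k.+1); set Q := (_ ^+ k.+1).
  transitivity (P * Q * zsum z * (u * u^-1)); first by ring.
  by rewrite mulfV // mulr1 mulrA.
Qed.

(** The prefactor is symmetric in z, and in the sum the exchange of coordinates is undone by
    relabelling the s_i. *)
Lemma atom_swap al (i j : 'I_N) z c :
  atom_val al (xcol i j z) c = atom_val al z (swapc i j c).
Proof.
have xE k : xcol i j z 0 k = z 0 (tperm i j k) by rewrite mxE.
have sE (f : C -> C) : \sum_k f (xcol i j z 0 k) = \sum_k f (z 0 k).
  rewrite [RHS](reindex_inj (@perm_inj _ (tperm i j))) /=.
  by apply: eq_bigr => k _; rewrite xE.
have pE : zprod (xcol i j z) = zprod z.
  rewrite /zprod [RHS](reindex_inj (@perm_inj _ (tperm i j))) /=.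
  by apply: eq_bigr => k _; rewrite xE.
apply: etrans (scalE _ _ _) _; apply: etrans _ (esym (scalE _ _ _)).
congr (_ * _).
  by rewrite /prefactor /zsum /zisum (sE id) (sE (fun u => u^-1)) pE.
rewrite !sum_ffunE [RHS](reindex_inj (@perm_inj _ (tperm i j))) /=.
apply: eq_bigr => k _; apply: etrans (scalE _ _ _) _.
apply: etrans _ (esym (scalE _ _ _)); rewrite xE; congr (_ * _); apply: esym.
by apply: etrans (spin_at_swap _ _ _ _ _) _; rewrite tpermK.
Qed.

(** No coefficients are needed: scalars are absorbed by the spin states. *)
Definition atomic F := exists L : seq atom, forall z, (forall i, z 0 i != 0) ->
  F z = \sum_(al <- L) atom_val al z.

Lemma atom_valZ (k : C) t j s z : atom_val (t, j, k *: s) z = k *: atom_val (t, j, s) z.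
Proof.
rewrite /atom_val /= scalerA mulrC -scalerA; congr (_ *: _).
rewrite scaler_sumr; apply: eq_bigr => i _.
by rewrite spin_atZ !scalerA [_ * k]mulrC.
Qed.

Lemma atomic_eq F al : (forall z, (forall i, z 0 i != 0) -> F z = atom_val al z) -> atomic F.
Proof. by move=> FE; exists [:: al] => z z0; rewrite big_seq1 FE. Qed.

Lemma atomicZ (k : C) F : atomic F -> atomic (fun z => k *: F z).
Proof.
move=> [L FE]; exists [seq (al.1, k *: al.2) | al <- L] => z z0.
rewrite FE // big_map scaler_sumr; apply: eq_bigr => -[[t j] s] _.
by rewrite atom_valZ.
Qed.

Lemma atomic_sum (I : eqType) (r : seq I) (F : I -> zfun) :
  (forall i, i \in r -> atomic (F i)) -> atomic (fun z => \sum_(i <- r) F i z).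
Proof.
elim: r => [|i r IH] h; first by exists [::] => z _; rewrite !big_nil.
have [L1 h1] := h i (mem_head _ _).
have [|L2 h2] := IH; first by move=> j jr; apply: h; rewrite in_cons jr orbT.
by exists (L1 ++ L2) => z z0; rewrite big_cons big_cat h1 // h2.
Qed.

Lemma peval_sigma1 z : peval (sigma1 R n) z = zsum z.
Proof.
rewrite /peval /sigma1 raddf_sum; apply: eq_bigr => i _.
exact: mevalXU.
Qed.

Lemma peval_tauN z : peval (tau R n N) z = zprod z.
Proof.
rewrite /peval /tau mesymnnE rmorph_prod; apply: eq_bigr => i _.
exact: mevalXU.
Qed.

Lemma peval_tau_pred z : (forall i, z 0 i != 0) -> peval (tau R n N.-1) z = zprod z * zisum z.
Proof.
move=> z0; rewrite /peval /tau mesymE raddf_sum /=.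
(* The subsets of size N - 1 are the complements of single indices. *)
rewrite (eq_bigl (fun h => h \in [set ~: [set i] | i in [set: 'I_N]])); last first.
  move=> h; apply/idP/imsetP => [/eqP hn|[i _ ->]].
    have : #|~: h| == 1%N by rewrite -(eqn_add2l #|h|) cardsC card_ord hn addn1.
    by move=> /cards1P[i hi]; exists i; rewrite ?inE // -hi finset.setCK.
  by rewrite -(eqn_add2r #|[set i]|) [X in (X == _)%N]addnC cardsC card_ord cards1 addn1.
rewrite big_imset /=; last by move=> i j _ _ /finset.setC_inj /finset.set1_inj.
rewrite mulr_sumr big_mkcond /=; apply: eq_bigr => i _; rewrite inE mevalX.
rewrite -mon_codelta // /mon; apply: eq_bigr => k _; congr (_ ^+ _).
by rewrite mnmE !inE.
Qed.

(** The bounds on the exponents leave four products, each of a different kind. The state N Lambda s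
    absorbs a power sum into the s_i, by [spin_at_symm]. *)
Lemma atomic_symm (e0 e1 k : nat) (s : spin) : (e0 <= 1)%N -> (e1 <= 1)%N ->
  atomic (fun z => (zsum z ^+ e0 * (zprod z * zisum z) ^+ e1 * zprod z ^+ k) *: symm s).
Proof.
have sN f : \sum_i f i *: symm s = (\sum_i f i) *: symm s by rewrite scaler_suml.
have hN i : spin_at (N%:R *: symm s) i = symm s.
  by rewrite spin_atZ spin_at_symm scalerA mulfV ?scale1r // pnatr_eq0.
have w1 f z : \sum_i f (z 0 i) *: spin_at (N%:R *: symm s) i = (\sum_i f (z 0 i)) *: symm s.
  by rewrite -sN; apply: eq_bigr => i _; rewrite hN.
case: e0 => [|[|//]] _; case: e1 => [|[|//]] _.
- apply: (@atomic_eq _ (KA, k, s)) => z z0; rewrite /atom_val /= !expr0 !mul1r.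
  by congr (_ *: _); apply: eq_bigr => i _; rewrite scale1r.
- apply: (@atomic_eq _ (KC, k, N%:R *: symm s)) => z z0; rewrite /atom_val /=.
  rewrite (w1 (fun u => u^-1)) scalerA expr0 mul1r expr1 exprSr -/(zisum z); congr (_ *: _); ring.
- apply: (@atomic_eq _ (KB, k, N%:R *: symm s)) => z z0; rewrite /atom_val /=.
  rewrite (w1 id) scalerA expr0 mulr1 expr1 -/(zsum z); congr (_ *: _); ring.
- apply: (@atomic_eq _ (KD, k, N%:R *: symm s)) => z z0; rewrite /atom_val /=.
  rewrite (w1 id) scalerA !expr1 exprSr -/(zsum z); congr (_ *: _); ring.
Qed.

(** Expanding along the monomials of f, g or q, the exponents of sigma_1 and tau_(N-1) select the
    kind and that of tau_N gives k. The extra power of tau_N in the kinds with inverse z comes from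
    tau_(N-1), or from the explicit factor in front of q. *)
Lemma atomic_Hgen k F : Hgen k F -> atomic F.
Proof.
case=> {F} [f s p _ d0 d1|g s p _ d0|q s p _ d0].
- have h : atomic (fun z => \sum_(e <- msupp f) (mcoeff e f) *:
     ((zsum z ^+ fun_of_multinom e (inord 0) * (zprod z * zisum z) ^+ fun_of_multinom e (inord 1)
       * zprod z ^+ fun_of_multinom e (inord 2)) *: symm s)).
    apply: atomic_sum => e ef; apply: atomicZ; apply: atomic_symm; [exact: d0|exact: d1].
  have [L hL] := h; exists L => z z0; rewrite -hL // Lambda_cst.
  rewrite /p /peval comp_mpoly_meval mevalE scaler_suml; apply: eq_bigr => e _.
  rewrite scalerA; congr (_ *: _); congr (_ * _).
  rewrite !big_ord_recl big_ord0 mulr1 mulrA.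
  have i0 : inord 0 = ord0 :> 'I_3 by apply/val_inj; rewrite /= inordK.
  have i1 : inord 1 = lift ord0 ord0 :> 'I_3 by apply/val_inj; rewrite /= inordK.
  have i2 : inord 2 = lift ord0 (lift ord0 ord0) :> 'I_3 by apply/val_inj; rewrite /= inordK.
  rewrite i0 i1 i2; congr (_ ^+ _ * _ ^+ _ * _ ^+ _).
  + exact: peval_sigma1.
  + exact: peval_tau_pred.
  + exact: peval_tauN.
- have h : atomic (fun z => \sum_(e <- msupp g) (mcoeff e g) *:
     (((zprod z * zisum z) ^+ fun_of_multinom e (inord 0)
       * zprod z ^+ fun_of_multinom e (inord 1)) *: \sum_i z 0 i *: spin_at s i)).
    apply: atomic_sum => e ef; apply: atomicZ; have := d0 e ef.
    case: (fun_of_multinom e (inord 0)) => [|[|//]] _.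
      apply: (@atomic_eq _ (KB, fun_of_multinom e (inord 1), s)) => z z0.
      by rewrite expr0 mul1r.
    apply: (@atomic_eq _ (KD, fun_of_multinom e (inord 1), s)) => z z0.
    by rewrite /atom_val /= expr1 exprSr; congr (_ *: _); ring.
  have [L hL] := h; exists L => z z0; rewrite -hL // (Lambda_scal id).
  rewrite /p /peval comp_mpoly_meval mevalE scaler_suml; apply: eq_bigr => e _.
  rewrite scalerA; congr (_ *: _); congr (_ * _).
  rewrite !big_ord_recl big_ord0 mulr1.
  have i0 : inord 0 = ord0 :> 'I_2 by apply/val_inj; rewrite /= inordK.
  have i1 : inord 1 = lift ord0 ord0 :> 'I_2 by apply/val_inj; rewrite /= inordK.
  rewrite i0 i1; congr (_ ^+ _ * _ ^+ _).
  + exact: peval_tau_pred.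
  + exact: peval_tauN.
- have h : atomic (fun z => \sum_(e <- msupp q) (mcoeff e q) *:
     ((zprod z * (zsum z ^+ fun_of_multinom e (inord 0)
       * zprod z ^+ fun_of_multinom e (inord 1))) *: \sum_i (z 0 i)^-1 *: spin_at s i)).
    apply: atomic_sum => e ef; apply: atomicZ; have := d0 e ef.
    case: (fun_of_multinom e (inord 0)) => [|[|//]] _.
      apply: (@atomic_eq _ (KC, fun_of_multinom e (inord 1), s)) => z z0.
      by rewrite /atom_val /= expr0 mul1r exprS.
    apply: (@atomic_eq _ (KE, fun_of_multinom e (inord 1), s)) => z z0.
    by rewrite /atom_val /= expr1 exprS; congr (_ *: _); ring.
  have [L hL] := h; exists L => z z0; rewrite -hL // (Lambda_scal (fun u => u^-1)).
  rewrite peval_tauN /p /peval comp_mpoly_meval mevalE mulr_sumr scaler_suml; apply: eq_bigr => e _.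
  rewrite scalerA mulrCA; congr (_ *: _); congr (_ * (_ * _)).
  rewrite !big_ord_recl big_ord0 mulr1.
  have i0 : inord 0 = ord0 :> 'I_2 by apply/val_inj; rewrite /= inordK.
  have i1 : inord 1 = lift ord0 ord0 :> 'I_2 by apply/val_inj; rewrite /= inordK.
  rewrite i0 i1; congr (_ ^+ _ * _ ^+ _).
  + exact: peval_sigma1.
  + exact: peval_tauN.
Qed.

Lemma Hspace_atoms k F : Hspace k F -> exists L : seq atom, forall z, zdomain z ->
  F z = \sum_(al <- L) atom_val al z.
Proof.
move=> [r [d [G [hG FE]]]].
have [L hL] : atomic (fun z => \sum_(l <- index_enum 'I_r) d l *: G l z).
  by apply: atomic_sum => l _; apply: atomicZ; exact: atomic_Hgen (hG l).
by exists L => z dz; rewrite FE // hL //; case: dz.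
Qed.

End Atoms.

(** * Locality, phases and momentum *)


Section Locality.
Variables (R : realType) (n m : nat) (a : R).
Hypothesis n_gt0 : (0 < n)%N.
Local Notation N := n.+1.
Local Notation C := (R[i]).
Local Notation spin := (spin R n m).
Local Notation wavefun := ('rV[R]_N -> spin).
Implicit Types (s : spin) (c : config n m) (F G : wavefun) (x : 'rV[R]_N) (b : bool).

Lemma H2_congr (A A' X X' B B' P Q : C) : A = A' -> X = X' -> B = B' ->
  - A + P * X + Q * B = - A' + P * X' + Q * B'.
Proof. by move=> -> -> ->. Qed.

Lemma H2_ext F G x : (forall y, domain y -> F y = G y) -> domain x -> H2 a F x = H2 a G x.
Proof.
move=> FG dx; apply/spinP => c; apply: etrans (H2E a F x c) _; apply: etrans _ (esym (H2E a G x c)).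
apply: H2_congr.
- apply: eq_bigr => i _; apply: cpart_ext dx _ => y dy; apply: cpart_ext dy _ => w dw.
  by rewrite FG.
- by rewrite FG.
- by apply: eq_bigr => i _; rewrite FG.
Qed.

Lemma SmF_ext F G : (forall y, domain y -> F y = G y) -> SmF F -> SmF G.
Proof. by move=> FG sF c; apply: SmC_ext (sF c) => y /FG ->. Qed.

(** Supplies the continuity needed to extend the eigenvalue equation from generic points to the
    whole domain. *)
Lemma SmC_H2 F c : SmF F -> SmC (fun x => H2 a F x c).
Proof.
move=> sF; apply: (SmC_ext (fun x _ => esym (H2E a F x c))).
have sM (k : C) f : SmC f -> SmC (fun x : 'rV[R]_N => k * f x).
  by move=> sf; apply: SmCM => //; exact: SmC_cst.
have cot_pred i : Sm (fun x : 'rV[R]_N => cot (x 0 i - x 0 (ord_pred i))).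
  apply: Sm_ext (Sm_mul (Sm_cst n (-1)) (Sm_cot R (ord_pred i))) => x _.
  by rewrite mulN1r -cotN /gap ord_predK opprB.
have csc i : Sm (fun x : 'rV[R]_N => csc2 (gap x i)).
  apply: Sm_ext (Sm_mul (Sm_isin R i) (Sm_isin R i)) => x _.
  by rewrite /csc2 expr2 invfM.
apply: SmCD; [apply: SmCD|].
- apply: (@SmC_ext _ _ (fun x => (-1) * \sum_i cpart i (cpart i (fun y => F y c)) x)).
    by move=> x _; rewrite mulN1r.
  by apply: sM; apply: SmC_sum => i; do 2!apply: SmC_cpart; exact: sF.
- apply: SmCM; last exact: sF.
  apply: SmC_real; apply: Sm_mul; first exact: Sm_cst.
  by apply: Sm_sum => i; apply: Sm_mul => //; exact: Sm_cot.
- apply: (sM _ _); apply: SmC_sum => i; apply: SmCM; first by apply: SmC_real.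
  apply: (@SmC_ext _ _ (fun x => a%:C * F x c + (-1) * F x (swapc i (ordS i) c))).
    by move=> x _; rewrite mulN1r.
  by apply: SmCD; apply: sM; exact: sF.
Qed.

(** It makes the z_k pairwise distinct, so that exchanging two of them cannot bring equal ones next
    to each other. *)
Definition generic x := forall i j : 'I_N, i != j -> sin (x 0 i - x 0 j) != 0.

(** Zeros are isolated: if sin d = 0, then sin (d + u) = cos d sin u with cos d != 0, which is
    nonzero for 0 < |u| < pi. *)
Lemma near_sin_neq0 (d k : R) : k != 0 -> \forall t \near ((0 : R)^')%classic, sin (d + t * k) != 0.
Proof.
move=> k0; have [sd|sd] := eqVneq (sin d) 0; last first.
  have c : {for 0, continuous (fun t : R => sin (d + t * k))}.
    apply: (@continuous_comp _ _ _ (fun t : R => d + t * k) sin); last exact: continuous_sin.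
    by apply: continuousD; [exact: cvg_cst|apply: continuousM; [exact: cvg_id|exact: cvg_cst]].
  have sd' : sin (d + 0 * k) != 0 by rewrite mul0r addr0.
  exact: cvg_within (cvgr_neq0 _ c sd').
have c : {for 0, continuous (fun t : R => `|t * k|)}.
  apply: (@continuous_comp _ _ _ (fun t : R => t * k) (fun u : R => `|u|)); last exact: norm_continuous.
  by apply: continuousM; [exact: cvg_id|exact: cvg_cst].
have c0 : `|0 * k| < pi :> R by rewrite mul0r normr0 pi_gt0.
have h : \forall t \near (0 : R), `|t * k| < pi by exact: (cvgr_lt _ c _ c0).
have h' : \forall t \near ((0 : R)^')%classic, `|t * k| < pi by exact: cvg_within h.
have hn : \forall t \near ((0 : R)^')%classic, t != 0 by exact: nbhs_dnbhs_neq.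
apply: filterS2 h' hn => t tk t0.
have cd : cos d != 0.
  apply/eqP => cd; have := cos2Dsin2 d; rewrite sd cd expr0n /= addr0 => /eqP.
  by rewrite eq_sym oner_eq0.
rewrite sinD sd mul0r add0r mulf_neq0 //.
have u0 : t * k != 0 by rewrite mulf_neq0.
move: u0 tk; move: (t * k) => u u0; rewrite ltr_norml => /andP[u1 u2].
case: (ltrgt0P u) u0 => // [up|un] _.
  by rewrite gt_eqF // sin_gt0_pi // up u2.
by rewrite -oppr_eq0 -sinN gt_eqF // sin_gt0_pi // oppr_gt0 un /= ltrNl.
Qed.

Lemma generic_dense (P : 'rV[R]_N -> Prop) x :
  (\forall y \near x, P y) -> exists2 y, P y & generic y.
Proof.
(* In the direction (0, 1, ..., n) every difference x_i - x_j changes at the nonzero rate i - j. *)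
move=> Px; pose v : 'rV[R]_N := \row_k k%:R.
have c : {for 0, continuous (fun t : R => x + t *: v)}.
  apply: continuousD; first exact: cvg_cst.
  exact: scalel_continuous.
have Px' : \forall y \near x + 0 *: v, P y by rewrite scale0r addr0.
have h1 : \forall t \near ((0 : R)^')%classic, P (x + t *: v) .
  have h0 : \forall t \near (0 : R), P (x + t *: v) by exact: (c _ Px').
  exact: cvg_within h0.
have h2 : \forall t \near ((0 : R)^')%classic, generic (x + t *: v).
  have h i : \forall t \near ((0 : R)^')%classic, forall j : 'I_N, i != j -> sin ((x + t *: v) 0 i - (x + t *: v) 0 j) != 0.
    apply: filter_forall => j.
    have [ij|ij] := eqVneq i j; first by apply: (@filterE _ ((0 : R)^')%classic) => t.
    have k0 : i%:R - j%:R != 0 :> R by rewrite subr_eq0 eqr_nat.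
    apply: (@filterS _ ((0 : R)^')%classic _ _ _ _ (near_sin_neq0 (x 0 i - x 0 j) k0)) => t ht _.
    by rewrite !mxE; apply: etrans ht; congr (~~ (sin _ == 0)); ring.
  exact: (@filter_forall _ _ (fun (i : 'I_N) t => forall j : 'I_N, i != j -> sin ((x + t *: v) 0 i - (x + t *: v) 0 j) != 0) ((0 : R)^')%classic _ h).
have [t [t1 t2]] := filter_ex (filterI h1 h2).
by exists (x + t *: v).
Qed.

Lemma Sm_generic_eq0 (f : 'rV[R]_N -> R) x : Sm f ->
  (forall y, domain y -> generic y -> f y = 0) -> domain x -> f x = 0.
Proof.
move=> sf f0 dx; apply/eqP/negPn/negP => fx.
have c : {for x, continuous f} by exact: differentiable_continuous (Sm_diff sf dx).
have [y [dy fy] gy] := @generic_dense (fun y => domain y /\ f y != 0) x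
  (filterI (domain_nbhs dx) (cvgr_neq0 _ c fx)).
by rewrite f0 // eqxx in fy.
Qed.

Lemma SmC_generic_eq0 (f : 'rV[R]_N -> C) x : SmC f ->
  (forall y, domain y -> generic y -> f y = 0) -> domain x -> f x = 0.
Proof.
move=> [s1 s2] f0 dx; apply: complexP.
  by rewrite (Sm_generic_eq0 s1 _ dx) // => y dy gy; rewrite f0.
by rewrite (Sm_generic_eq0 s2 _ dx) // => y dy gy; rewrite f0.
Qed.

(** exp (2i k \sum_j x_j), a real power of tau_N. *)
Definition phase (k : R) x : C := wave (fun=> k) x.

Lemma cpart_phase (k : R) i (f : 'rV[R]_N -> C) x : SmC f -> domain x ->
  cpart i (fun y => phase k y * f y) x = phase k x * ((2 * k)%:C * 'i * f x + cpart i f x).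
Proof.
move=> sf dx; rewrite cpartM //; last exact: SmC_wave.
by rewrite cpart_wave /phase; ring.
Qed.

Lemma cpart2_phase (k : R) i (f : 'rV[R]_N -> C) x : SmC f -> domain x ->
  cpart i (cpart i (fun y => phase k y * f y)) x =
  phase k x * (- (4 * k ^+ 2)%:C * f x + (4 * k)%:C * 'i * cpart i f x + cpart i (cpart i f) x).
Proof.
move=> sf dx; have sp := SmC_cpart i sf.
apply: etrans (cpart_ext i dx (fun y dy => cpart_phase k i sf dy)) _.
have sk : SmC (fun y => (2 * k)%:C * 'i * f y) by apply: SmCM => //; exact: SmC_cst.
apply: etrans (cpart_phase k i (SmCD sk sp) dx) _; congr (_ * _).
rewrite cpartD // cpartM //; last exact: SmC_cst.
rewrite cpart_cst; move: (f x) (cpart i f x) (cpart i (cpart i f) x) => u w t.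
have -> : (4 * k ^+ 2)%:C = 4 * k%:C ^+ 2 :> C by apply: complexP => /=; ring.
have -> : (4 * k)%:C = 4 * k%:C :> C by apply: complexP => /=; ring.
have -> : (2 * k)%:C = 2 * k%:C :> C by apply: complexP => /=; ring.
transitivity (4 * k%:C ^+ 2 * ('i * 'i) * u + 4 * k%:C * 'i * w + t); first by ring.
by rewrite mulii; ring.
Qed.

Lemma SmF_phase k F : SmF F -> SmF (fun x => phase k x *: F x).
Proof.
move=> sF c; apply: (@SmC_ext _ _ (fun x => phase k x * F x c)).
  by move=> x _; rewrite scalE.
by apply: SmCM => //; exact: SmC_wave.
Qed.

Lemma phase_H2_algebra (w A S f P Q B B' E p k2 k : C) :
  - A + P * f + Q * B = E * f -> - 'i * S = p * f -> B' = w * B ->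
  - (w * (N%:R * (- k2 * f) + k * 'i * S + A)) + P * (w * f) + Q * B' =
  (E + N%:R * k2 + k * p) * (w * f).
Proof.
move=> h1 h2 ->.
transitivity (w * (- A + P * f + Q * B) + N%:R * k2 * (w * f) + k * w * (- 'i * S)); first by ring.
by rewrite h1 h2; ring.
Qed.

(** A Galilean boost: the second derivatives of the phase give 4 N k^2, and the mixed terms assemble
    into the total momentum, hence a constant because F has momentum p. *)
Lemma phase_H2 k F (E p : C) x c : SmF F -> domain x ->
  H2 a F x c = E * F x c -> momentum F x c = p * F x c ->
  H2 a (fun y => phase k y *: F y) x c =
  (E + N%:R * (4 * k ^+ 2)%:C + (4 * k)%:C * p) * (phase k x *: F x) c.
Proof.
move=> sF dx hE hp.
have hE' := etrans (esym (H2E a F x c)) hE.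
have hp' := etrans (esym (momentumE F x c)) hp.
apply: etrans (H2E a _ x c) _; rewrite scalE.
have e : \sum_i cpart i (cpart i (fun y => (phase k y *: F y) c)) x =
  phase k x * (N%:R * (- (4 * k ^+ 2)%:C * F x c) + (4 * k)%:C * 'i * (\sum_i cpart i (fun y => F y c) x)
    + \sum_i cpart i (cpart i (fun y => F y c)) x).
  have -> : (fun y => (phase k y *: F y) c) = (fun y => phase k y * F y c).
    by apply/funext => y; rewrite scalE.
  apply: etrans (eq_bigr _ (fun i _ => cpart2_phase k i (sF c) dx)) _.
  rewrite -mulr_sumr !big_split /= sumr_const card_ord -[_ *+ N]mulr_natl -mulr_sumr.
  by [].
rewrite e; apply: phase_H2_algebra hE' hp' _.
rewrite mulr_sumr; apply: eq_bigr => i _; rewrite !scalE.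
by move: (F x c) (F x _) => u u'; ring.
Qed.

End Locality.

(** * Separation of homogeneous degrees *)

Section Spectrum.
Variable R : realType.
Local Notation C := (R[i]).

Lemma poly_cis_eq0 (P : {poly C}) : (forall t : R, P.[cis t] = 0) -> P = 0.
Proof.
move=> h; apply/eqP/negPn/negP => P0.
(* The angles k / size P lie in [0, pi], where cos is injective, and so provide as many distinct
   roots as the size of P. *)
pose d : R := (size P)%:R^-1.
pose rs := [seq cis (k%:R * d) | k <- iota 0 (size P)].
have sP : 0 < (size P)%:R :> R by rewrite ltr0n lt0n size_poly_eq0.
have : (size rs < size P)%N.
  apply: max_poly_roots P0 _ _.
    by apply/allP => u /mapP[k _ ->]; apply/rootP.
  rewrite map_inj_in_uniq ?iota_uniq // => k l; rewrite !mem_iota !add0n /= => kP lP.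
  have inpi j : (j < size P)%N -> j%:R * d \in `[0, pi].
    move=> jP; rewrite in_itv /= mulr_ge0 ?ler0n ?invr_ge0 ?ler0n //=.
    apply: le_trans (_ : 1 <= _); last by apply: le_trans (pi_ge2 R); rewrite ler1n.
    by rewrite ler_pdivrMr // mul1r ler_nat ltnW.
  move=> /(congr1 (@complex.Re R)) /= /cos_inj; rewrite !inpi // => /(_ isT isT) e.
  have d0 : d != 0 by rewrite invr_eq0 gt_eqF.
  by move/eqP: (mulIf d0 e); rewrite eqr_nat => /eqP.
by rewrite size_map size_iota ltnn.
Qed.

(** Let W_d be the sum of the w i of degree d. The hypothesis is a polynomial in cis t with
    coefficients (ka d - p) W_d that vanishes on the unit circle, so W_d = 0 unless ka d = p. The
    single w i may be nonzero, so only sums are compared. *)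
Lemma sum_by_degree (I : Type) (r : seq I) (deg : I -> nat) (w : I -> C) (ka : nat -> C) (p : C) :
  (forall t : R, \sum_(i <- r) (ka (deg i) - p) * (cis t ^+ deg i * w i) = 0) ->
  \sum_(i <- r) w i = \sum_(i <- r | ka (deg i) == p) w i.
Proof.
move=> h.
pose P := \sum_(i <- r) ((ka (deg i) - p) * w i) *: 'X^(deg i) : {poly C}.
have P0 : P = 0.
  apply: poly_cis_eq0 => t; rewrite -[RHS](h t) horner_sum; apply: eq_bigr => i _.
  by rewrite hornerZ hornerXn; ring.
pose Q (pr : pred I) := \sum_(i <- r | pr i) w i *: 'X^(deg i) : {poly C}.
have Q1 pr : (Q pr).[1] = \sum_(i <- r | pr i) w i.
  by rewrite horner_sum; apply: eq_bigr => i _; rewrite hornerZ hornerXn expr1n mulr1.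
have -> : \sum_(i <- r) w i = (Q predT).[1] by rewrite Q1.
rewrite -(Q1 (fun i => ka (deg i) == p)); congr (_.[1]); apply/polyP => d.
rewrite !coef_sum big_mkcond [RHS]big_mkcond /=.
have [e|ne] := eqVneq (ka d) p.
  apply: eq_bigr => i _; rewrite coefZ coefXn.
  have [de|_] := eqVneq d (deg i); last by rewrite mulr0; case: ifP.
  by rewrite -de e eqxx.
rewrite [RHS]big1 => [|i _]; last first.
  case: ifP => // /eqP e; rewrite coefZ coefXn; case: (eqVneq d (deg i)) => [de|]; last by rewrite mulr0.
  by rewrite de e eqxx in ne.
have := congr1 (fun q : {poly C} => q`_d) P0; rewrite coef0 coef_sum => hP.
have ned : ka d - p != 0 by rewrite subr_eq0.
apply: (mulfI ned); rewrite mulr0 -[RHS]hP mulr_sumr; apply: eq_bigr => i _.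
rewrite !coefZ coefXn; case: (eqVneq d (deg i)) => [->|]; last by rewrite !mulr0.
by rewrite mulrA.
Qed.

End Spectrum.

(** * Algebraic eigenfunctions with well-defined momentum *)


Section Classification.
Variables (R : realType) (n m : nat) (a : R).
Hypotheses (n_gt0 : (0 < n)%N) (a_gt0 : 0 < a).
Local Notation N := n.+1.
Local Notation C := (R[i]).
Local Notation spin := (spin R n m).
Local Notation wavefun := ('rV[R]_N -> spin).
Implicit Types (s : spin) (c : config n m) (F G : wavefun) (x : 'rV[R]_N) (b : bool).

Lemma mu_neq0 x : domain x -> (mu a x)%:C != 0 :> C.
Proof.
move=> [_ _ d]; rewrite -(rmorph0 (@real_complex R)) (inj_eq (@complexI R)).
rewrite gt_eqF // /mu; apply: prodr_gt0 => i _; apply: powR_gt0.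
by rewrite normr_gt0.
Qed.

Lemma expz_zdomain b x : domain x -> zdomain (expz b x).
Proof.
by move=> [_ _ d]; split=> i; [exact: expz_neq0|exact: expz_neq].
Qed.

(** If the two values agreed, the cosine of the doubled angle would be 1, and 2 cos^2 - 1 = 1 forces
    sin (x_i - x_j) = 0. *)
Lemma expz_inj b x i j : generic x -> i != j -> expz b x 0 i != expz b x 0 j.
Proof.
move=> g ij; apply/eqP; rewrite !mxE => e.
have := congr1 (fun u => u * cis (- ((-1) ^+ b * (2 * x 0 j)))) e.
rewrite -!cisD subrr cis0 => /(congr1 (@complex.Re R)) /=.
have -> : (-1) ^+ b * (2 * x 0 i) - (-1) ^+ b * (2 * x 0 j) = ((-1) ^+ b * (x 0 i - x 0 j)) *+ 2.
  by rewrite -mulr_natl; ring.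
rewrite cos_mulr2n.
have -> : cos ((-1) ^+ b * (x 0 i - x 0 j)) = cos (x 0 i - x 0 j).
  by case: (b); rewrite ?expr0 ?expr1 ?mul1r ?mulN1r ?cosN.
move=> h; have := g i j ij; rewrite -sqrf_eq0.
have -> : sin (x 0 i - x 0 j) ^+ 2 = 1 - cos (x 0 i - x 0 j) ^+ 2.
  by rewrite -[X in _ = X - _](cos2Dsin2 (x 0 i - x 0 j)); ring.
have -> : 1 - cos (x 0 i - x 0 j) ^+ 2 = 0.
  by move: h; rewrite -mulr_natl => h; lra.
by rewrite eqxx.
Qed.

Lemma zdomain_xcol b x i j : generic x -> zdomain (xcol i j (expz b x)).
Proof.
move=> g; split=> k; rewrite !mxE; first exact: cis_neq0.
have := @expz_inj b x (tperm i j k) (tperm i j (ordS k)) g; rewrite !mxE; apply.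
by rewrite (inj_eq perm_inj) eq_sym ordS_neq.
Qed.

Definition all_terms (L : seq (atom R n m)) := flatten [seq atom_terms al | al <- L].

Lemma sum_all_terms (V : zmodType) L (f : ('I_N -> nat) * spin -> V) :
  \sum_(l <- all_terms L) f l = \sum_(al <- L) \sum_(l <- atom_terms al) f l.
Proof. by rewrite /all_terms big_flatten big_map. Qed.

Definition atom_wave b L : wavefun :=
  wsum (all_terms L) (fun l k => (-1) ^+ b * (l.1 k)%:R) (fun l => l.2).

Lemma msum_all_terms L (z : 'rV[C]_N) : (forall i, z 0 i != 0) ->
  \sum_(al <- L) atom_val al z = mon_sum (all_terms L) (fun l => l.1) (fun l => l.2) z.
Proof.
by move=> z0; rewrite /mon_sum sum_all_terms; apply: eq_bigr => al _; exact: atom_termsE.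
Qed.

Lemma atom_waveE b L x : atom_wave b L x = \sum_(al <- L) atom_val al (expz b x).
Proof.
rewrite msum_all_terms; last by move=> i; exact: expz_neq0.
by apply: eq_bigr => l _; rewrite wave_mon.
Qed.

Lemma momentum_atom_wave b L x c : domain x ->
  momentum (fun y => (mu a y)%:C *: atom_wave b L y) x c =
  (mu a x)%:C * \sum_(al <- L) (2 * (-1) ^+ b)%:C * (atom_deg al)%:R * atom_val al (expz b x) c.
Proof.
move=> dx; apply: etrans (momentum_wsum _ _ _ _ _ dx) _; congr (_ * _).
rewrite sum_all_terms; apply: eq_bigr => al _.
have -> : atom_val al (expz b x) c = \sum_(l <- atom_terms al) mon l.1 (expz b x) * l.2 c.
  rewrite atom_termsE; last by move=> i; exact: expz_neq0.
  by rewrite sum_ffunE; apply: eq_bigr => l _; rewrite scalE.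
rewrite -mulrA -(atom_termsD al (fun l => mon l.1 (expz b x) * l.2 c)) mulr_sumr.
apply: eq_bigr => l _; rewrite wave_mon [RHS]mulrA; congr (_ * _).
rewrite -mulr_sumr [2 * (_ * _)]mulrA rmorphM rmorph_sum; congr (_ * _).
by apply: eq_bigr => i _; rewrite rmorph_nat.
Qed.

(** A common translation rotates all z_k by the same phase and so provides the free parameter of
    [sum_by_degree]. *)
Lemma domain_shift x (t : R) : domain x -> domain (\row_k (x 0 k + t)).
Proof.
move=> [d1 d2 d3]; split.
- by move=> i j ij; rewrite !mxE ltrD2r d1.
- by move=> i ij; rewrite !mxE opprD addrACA subrr addr0 d2.
- by move=> i; rewrite /gap !mxE opprD addrACA subrr addr0; exact: d3.
Qed.

Lemma expz_shift b x (t : R) :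
  expz b (\row_k (x 0 k + t)) = cis ((-1) ^+ b * (2 * t)) *: expz b x.
Proof.
by apply/rowP => k; rewrite !mxE -cisD; congr cis; ring.
Qed.

Lemma momentum_selects b L (Psi : wavefun) (p : C) x :
  (forall y, domain y -> Psi y = (mu a y)%:C *: atom_wave b L y) ->
  (forall y c, domain y -> momentum Psi y c = p * Psi y c) -> domain x ->
  atom_wave b L x = \sum_(al <- L | (2 * (-1) ^+ b)%:C * (atom_deg al)%:R == p) atom_val al (expz b x).
Proof.
move=> PE mom dx; apply/spinP => c; rewrite atom_waveE !sum_ffunE.
apply: (@sum_by_degree _ _ L (@atom_deg R n m) (fun al => atom_val al (expz b x) c)
  (fun d => (2 * (-1) ^+ b)%:C * d%:R)) => t.
(* As z_k = exp(+-2i x_k), the shift by +- t/2 multiplies every z_k by exactly cis t. *)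
pose y : 'rV[R]_N := \row_k (x 0 k + (-1) ^+ b * (t / 2)).
have dy : domain y by exact: domain_shift.
have ey : expz b y = cis t *: expz b x.
  rewrite expz_shift; congr (cis _ *: _); rewrite [2 * _]mulrC -mulrA divfK ?pnatr_eq0 //.
  by rewrite mulrA -expr2 sqrr_sign mul1r.
have key : momentum (fun y => (mu a y)%:C *: atom_wave b L y) y c = p * ((mu a y)%:C * atom_wave b L y c).
  apply: etrans _ (etrans (mom y c dy) _); last by rewrite PE // scalE.
  apply: etrans (momentumE _ _ _) _; apply: etrans _ (esym (momentumE _ _ _)); congr (_ * _).
  by apply: eq_bigr => k _; apply: cpart_ext dy _ => w dw; rewrite PE.
have := etrans (esym (momentum_atom_wave b L c dy)) key.
rewrite [RHS]mulrCA => /(mulfI (mu_neq0 dy)) /eqP; rewrite -subr_eq0 => /eqP h.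
rewrite -[RHS]h atom_waveE sum_ffunE mulr_sumr -sumrB; apply: eq_bigr => al _.
have e : atom_val al (expz b y) c = cis t ^+ atom_deg al * atom_val al (expz b x) c.
  by rewrite ey atom_homog ?cis_neq0 //; exact: scalE.
apply: etrans _ (congr1 (fun w => (2 * (-1) ^+ b)%:C * (atom_deg al)%:R * w - p * w) (esym e)).
move: (atom_val al (expz b x) c) => u /=; ring.
Qed.

Lemma sum_spinE (I : Type) (r : seq I) (f : I -> spin) c :
  (\sum_(i <- r) f i) c = \sum_(i <- r) f i c.
Proof. by rewrite sum_ffunE. Qed.

(* The exchange terms of [H2bar] evaluate [Phi] at points that may leave
   [zdomain], where [Phi] is arbitrary. The equation is therefore read off at
   points with pairwise distinct z_i only, and extended by continuity. *)
Lemma H2_algebraic b L (Phi : 'rV[C]_N -> spin) (E : C) (Psi : wavefun) x c :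
  (forall z, zdomain z -> Phi z = \sum_(al <- L) atom_val al z) ->
  (forall z, zdomain z -> H2bar a Phi z = E *: Phi z) ->
  (forall y, domain y -> Psi y = (mu a y)%:C *: Phi (expz b y)) -> domain x ->
  H2 a Psi x c = E * Psi x c.
Proof.
move=> PhiE eig PsiE dx.
have z0 (z : 'rV[C]_N) : zdomain z -> forall i, z 0 i != 0 by case.
have We y : domain y -> Psi y = (mu a y)%:C *: atom_wave b L y.
  by move=> dy; rewrite PsiE // PhiE ?atom_waveE //; exact: expz_zdomain.
have sW : SmF (fun y => (mu a y)%:C *: atom_wave b L y) by apply: SmF_mu; exact: SmF_wsum.
have -> : H2 a Psi x c = H2 a (fun y => (mu a y)%:C *: atom_wave b L y) x c.
  by rewrite (H2_ext a We dx).
rewrite We //; apply/eqP; rewrite -subr_eq0; apply/eqP.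
have sh : SmC (fun x => H2 a (fun y => (mu a y)%:C *: atom_wave b L y) x c +
   (- E) * ((mu a x)%:C *: atom_wave b L x) c).
  by apply: SmCD; [exact: SmC_H2|apply: SmCM; [exact: SmC_cst|exact: sW]].
rewrite -mulNr; apply: (SmC_generic_eq0 sh _ dx) => y dy gy.
have dz := expz_zdomain b dy.
have FE z : zdomain z -> Phi z = mon_sum (all_terms L) (fun l => l.1) (fun l => l.2) z.
  by move=> dz'; rewrite PhiE // msum_all_terms //; exact: z0.
have FS i c' : Phi (xcol i (ordS i) (expz b y)) c' = Phi (expz b y) (swapc i (ordS i) c').
  rewrite !PhiE //; last exact: zdomain_xcol.
  apply: etrans (sum_spinE _ _ _) _; apply: etrans _ (esym (sum_spinE _ _ _)).
  by apply: eq_bigr => al _; exact: atom_swap.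
have h := H2_of_H2bar a c n_gt0 FE dy dz FS.
apply: etrans (congr1 (fun t => t + _) h) _.
rewrite eig // !scalE atom_waveE -PhiE //; ring.
Qed.

Lemma comb_scale (V : lmodType C) (k l1 l2 M : C) (u v : V) :
  l1 *: (M *: (k *: u)) + l2 *: (M *: (k *: v)) = k *: (l1 *: (M *: u) + l2 *: (M *: v)).
Proof. by rewrite scalerDr !scalerA; congr (_ *: _ + _ *: _); ring. Qed.

Lemma comb_scale1 (V : lmodType C) (k l1 l2 : C) (u v : V) :
  l1 *: (k *: u) + l2 *: (k *: v) = k *: (l1 *: u + l2 *: v).
Proof. by rewrite scalerDr !scalerA; congr (_ *: _ + _ *: _); ring. Qed.

Lemma comb_add (V : lmodType C) (l1 l2 : C) (u u' v v' : V) :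
  l1 *: (u + u') + l2 *: (v + v') = l1 *: u + l2 *: v + (l1 *: u' + l2 *: v').
Proof. by rewrite !scalerDr addrACA. Qed.

Lemma comb_add_scale (V : lmodType C) (l1 l2 M : C) (u u' v v' : V) :
  l1 *: (M *: (u + u')) + l2 *: (M *: (v + v')) =
  l1 *: (M *: u) + l2 *: (M *: v) + (l1 *: (M *: u') + l2 *: (M *: v')).
Proof. by rewrite !(scalerDr M) comb_add. Qed.

Lemma fam1Z b (k : C) s x : fam1 b (k *: s) x = k *: fam1 b s x.
Proof.
rewrite /fam1 /wsum scaler_sumr; apply: eq_bigr => j _.
by rewrite spin_atZ !scalerA [_ * k]mulrC.
Qed.

Lemma fam1D b s t x : fam1 b (s + t) x = fam1 b s x + fam1 b t x.
Proof.
by rewrite /fam1 /wsum -big_split; apply: eq_bigr => j _; rewrite spin_atD scalerDr.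
Qed.

Lemma fam2Z b (k : C) s x : fam2 b (k *: s) x = k *: fam2 b s x.
Proof.
rewrite /fam2 /wsum scaler_sumr; apply: eq_bigr => j _.
by rewrite spin_atZ !scalerA [_ * k]mulrC.
Qed.

Lemma fam2D b s t x : fam2 b (s + t) x = fam2 b s x + fam2 b t x.
Proof.
by rewrite /fam2 /wsum -big_split; apply: eq_bigr => j _; rewrite spin_atD scalerDr.
Qed.

Lemma pairstateZ b (k : C) s x : pairstate a b (k *: s) x = k *: pairstate a b s x.
Proof.
rewrite /pairstate /fam0 fam2Z symmZ; exact: comb_scale.
Qed.

Lemma pairstateD b s t x : pairstate a b (s + t) x = pairstate a b s x + pairstate a b t x.
Proof. rewrite /pairstate /fam0 fam2D symmD; exact: comb_add_scale. Qed.

Lemma Psi0D s t x : Psi0 a (s + t) x = Psi0 a s x + Psi0 a t x.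
Proof. rewrite !Psi0E /fam0 symmD; exact: scalerDr. Qed.

Lemma Psi1D s t x : Psi1 a (s + t) x = Psi1 a s x + Psi1 a t x.
Proof. rewrite !Psi1E !fam1D; exact: comb_add_scale. Qed.

Lemma Psi2D s t x : Psi2 a (s + t) x = Psi2 a s x + Psi2 a t x.
Proof. rewrite !Psi2E !fam1D; exact: comb_add_scale. Qed.

Lemma Psi3D s t x : Psi3 a (s + t) x = Psi3 a s x + Psi3 a t x.
Proof. rewrite !(Psi3E a_gt0) !pairstateD; exact: comb_add. Qed.

Lemma Psi4D s t x : Psi4 a (s + t) x = Psi4 a s x + Psi4 a t x.
Proof. rewrite !Psi4E !pairstateD; exact: comb_add. Qed.

Lemma Psi0_0 x : Psi0 a (0 : spin) x = 0.
Proof. by apply: (addrI (Psi0 a 0 x)); rewrite -Psi0D !addr0. Qed.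

Lemma Psi1_0 x : Psi1 a (0 : spin) x = 0.
Proof. by apply: (addrI (Psi1 a 0 x)); rewrite -Psi1D !addr0. Qed.

Lemma Psi2_0 x : Psi2 a (0 : spin) x = 0.
Proof. by apply: (addrI (Psi2 a 0 x)); rewrite -Psi2D !addr0. Qed.

Lemma Psi3_0 x : Psi3 a (0 : spin) x = 0.
Proof. by apply: (addrI (Psi3 a 0 x)); rewrite -Psi3D !addr0. Qed.

Lemma Psi4_0 x : Psi4 a (0 : spin) x = 0.
Proof. by apply: (addrI (Psi4 a 0 x)); rewrite -Psi4D !addr0. Qed.

(** Euler's formula cos + e i sin for the states: u and v are those with the two signs of the
    exponent, and e = +-1 selects one of them. *)
Lemma half_half (V : lmodType C) (u v : V) (e : C) : e * e = 1 ->
  (2^-1 *: u + 2^-1 *: v) + (e * 'i) *: ((- 'i * 2^-1) *: u + ('i * 2^-1) *: v) =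
  ((1 + e) / 2) *: u + ((1 - e) / 2) *: v.
Proof.
move=> _; rewrite scalerDr !scalerA addrACA -!scalerDl; congr (_ *: _ + _ *: _).
  transitivity (2^-1 - e * ('i * 'i) / 2 : C); first by ring.
  by rewrite mulii; ring.
transitivity (2^-1 + e * ('i * 'i) / 2 : C); first by ring.
by rewrite mulii; ring.
Qed.

Lemma half_sign (V : lmodType C) (b : bool) (f : bool -> V) :
  ((1 + ((-1) ^+ b)%:C) / 2) *: f false + ((1 - ((-1) ^+ b)%:C) / 2) *: f true = f b.
Proof.
have h2 : (1 + 1) / 2 = 1 :> C by rewrite divff // -[1 + 1]/(2 : C) pnatr_eq0.
case: b; rewrite ?expr0 ?expr1 ?rmorphN ?rmorph1 ?opprK subrr !mul0r scale0r ?add0r ?addr0 h2 scale1r //.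
Qed.

Lemma mu_fam1_Psi b s x : (mu a x)%:C *: fam1 b s x =
  Psi1 a s x + Psi2 a ((((-1) ^+ b)%:C * 'i) *: s) x.
Proof.
have -> : Psi2 a ((((-1) ^+ b)%:C * 'i) *: s) x = (((-1) ^+ b)%:C * 'i) *: Psi2 a s x.
  rewrite !Psi2E !fam1Z; exact: comb_scale.
rewrite Psi1E Psi2E half_half; last exact: signr_sq.
by rewrite (half_sign b (fun b' => (mu a x)%:C *: fam1 b' s x)).
Qed.

Lemma pairstate_Psi b s x : pairstate a b s x =
  Psi3 a s x + Psi4 a ((((-1) ^+ b)%:C * 'i) *: s) x.
Proof.
have -> : Psi4 a ((((-1) ^+ b)%:C * 'i) *: s) x = (((-1) ^+ b)%:C * 'i) *: Psi4 a s x.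
  rewrite !Psi4E !pairstateZ; exact: comb_scale1.
rewrite (Psi3E a_gt0) Psi4E half_half; last exact: signr_sq.
by rewrite (half_sign b (fun b' => pairstate a b' s x)).
Qed.

Lemma mu_fam2_Psi b s x : (mu a x)%:C *: fam2 b s x =
  Psi0 a ((1 / (2 * a + 1))%:C *: s) x + Psi3 a s x + Psi4 a ((((-1) ^+ b)%:C * 'i) *: s) x.
Proof.
apply: etrans _ (addrA _ _ _).
apply: etrans _ (congr1 (fun t => _ + t) (pairstate_Psi b s x)); rewrite Psi0E /pairstate /fam0 symmZ.
move: (fam2 b s x) (symm s) => f g.
by rewrite scale1r addrCA !scalerA mulNr scaleNr [_ * (mu a x)%:C]mulrC subrr addr0.
Qed.

(** Each Psi_i is linear in its spin state, so one state of each kind suffices and all coefficients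
    can be taken to be 1. *)
Definition spanned F := exists s0 s1 s2 s3 s4 : spin, forall x,
  F x = Psi0 a s0 x + Psi1 a s1 x + Psi2 a s2 x + Psi3 a s3 x + Psi4 a s4 x.

Lemma spanned_add F G : spanned F -> spanned G -> spanned (fun x => F x + G x).
Proof.
move=> [s0 [s1 [s2 [s3 [s4 FE]]]]] [t0 [t1 [t2 [t3 [t4 GE]]]]].
exists (s0 + t0), (s1 + t1), (s2 + t2), (s3 + t3), (s4 + t4) => x.
rewrite FE GE Psi0D Psi1D Psi2D Psi3D Psi4D.
move: (Psi0 a s0 x) (Psi1 a s1 x) (Psi2 a s2 x) (Psi3 a s3 x) (Psi4 a s4 x).
move: (Psi0 a t0 x) (Psi1 a t1 x) (Psi2 a t2 x) (Psi3 a t3 x) (Psi4 a t4 x) => u0 u1 u2 u3 u4 v0 v1 v2 v3 v4.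
rewrite addrACA; congr (_ + _); rewrite addrACA; congr (_ + _).
by rewrite addrACA; congr (_ + _); rewrite addrACA.
Qed.

Lemma spanned_sum (I : Type) (r : seq I) (P : pred I) (F : I -> wavefun) :
  (forall i, spanned (F i)) -> spanned (fun x => \sum_(i <- r | P i) F i x).
Proof.
move=> h; elim: r => [|i r IH].
  exists 0, 0, 0, 0, 0 => x; rewrite big_nil Psi0_0 Psi1_0 Psi2_0 Psi3_0 Psi4_0.
  by rewrite !addr0.
case Pi: (P i); last first.
  have [s0 [s1 [s2 [s3 [s4 FE]]]]] := IH; exists s0, s1, s2, s3, s4 => x.
  by rewrite big_cons Pi.
have [s0 [s1 [s2 [s3 [s4 FE]]]]] := spanned_add (h i) IH; exists s0, s1, s2, s3, s4 => x.
by rewrite big_cons Pi.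
Qed.

(** The element at coordinates of product 1, where powers of tau_N disappear and inverse coordinates
    mean the opposite sign of the exponent. [fam2] attaches the spin to the denominator; in [KD] it
    sits on the numerator, hence the flipped sign. *)
Definition reduced b (al : atom R n m) : wavefun :=
  match al.1.1 with
  | KA => fam0 al.2
  | KB => fam1 b al.2
  | KC => fam1 (~~ b) al.2
  | KD => fam2 (~~ b) al.2
  | KE => fam2 b al.2
  end.

Lemma reduced_spanned b al : spanned (fun x => (mu a x)%:C *: reduced b al x).
Proof.
case: al => -[t k] s; rewrite /reduced /=; case: t => /=.
- exists s, 0, 0, 0, 0 => x; rewrite Psi1_0 Psi2_0 Psi3_0 Psi4_0 !addr0.
  by rewrite Psi0E.
- exists 0, s, ((((-1) ^+ b)%:C * 'i) *: s), 0, 0 => x.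
  by rewrite Psi0_0 Psi3_0 Psi4_0 !addr0 add0r -mu_fam1_Psi.
- exists 0, s, ((((-1) ^+ (~~ b))%:C * 'i) *: s), 0, 0 => x.
  by rewrite Psi0_0 Psi3_0 Psi4_0 !addr0 add0r -mu_fam1_Psi.
- exists ((1 / (2 * a + 1))%:C *: s), 0, 0, s, ((((-1) ^+ (~~ b))%:C * 'i) *: s) => x.
  by rewrite Psi1_0 Psi2_0 !addr0 mu_fam2_Psi.
- exists ((1 / (2 * a + 1))%:C *: s), 0, 0, s, ((((-1) ^+ b)%:C * 'i) *: s) => x.
  by rewrite Psi1_0 Psi2_0 !addr0 mu_fam2_Psi.
Qed.

Lemma sign_negb b (t : R) : (-1) ^+ (~~ b) * t = - ((-1) ^+ b * t).
Proof. by case: b; rewrite ?expr0 ?expr1 ?mulN1r ?mul1r ?opprK. Qed.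

(* With z = u y, where u = exp (+-2i xbar), the product of the y_i is 1. *)
Lemma atom_reduced b al x :
  atom_val al (expz b x) = phase ((-1) ^+ b * ((atom_deg al)%:R / N%:R)) x *: reduced b al x.
Proof.
pose u : C := cis ((-1) ^+ b * (2 * xbar x)); pose y : 'rV[C]_N := u^-1 *: expz b x.
have u0 : u != 0 by exact: cis_neq0.
have ey : expz b x = u *: y by rewrite scalerA mulfV // scale1r.
have yE k : y 0 k = cis ((-1) ^+ b * (2 * (x 0 k - xbar x))).
  by rewrite !mxE -cisN -cisD; congr cis; ring.
have N0 : N%:R != 0 :> R by rewrite pnatr_eq0.
have py : zprod y = 1.
  rewrite /zprod (eq_bigr (fun k => cis ((-1) ^+ b * (2 * (x 0 k - xbar x))))); last first.
    by move=> k _; exact: yE.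
  rewrite -cis_sum -mulr_sumr -mulr_sumr sumrB sumr_const card_ord -[_ *+ N]mulr_natl /xbar.
  by rewrite [N%:R * (_ * _)]mulrA mulfV // mul1r subrr !mulr0 cis0.
rewrite ey atom_homog //; congr (_ *: _).
  rewrite /u cisX /phase /wave /lin -mulr_sumr /xbar; congr cis; field.
  by rewrite addrC natr1.
have f1 s : \sum_i y 0 i *: spin_at s i = fam1 b s x.
  apply/spinP => c; rewrite sum_ffunE fam1E; apply: eq_bigr => j _.
  by rewrite scalE yE.
have f1' s : \sum_i (y 0 i)^-1 *: spin_at s i = fam1 (~~ b) s x.
  apply/spinP => c; rewrite sum_ffunE fam1E; apply: eq_bigr => j _.
  by rewrite scalE yE -cisN sign_negb.
case: al => -[t k] s; rewrite /atom_val /reduced /=; case: t => /=; rewrite py expr1n ?mul1r ?scale1r.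
- by apply: eq_bigr => i _; rewrite scale1r.
- exact: f1.
- exact: f1'.
- apply/spinP => c; rewrite scalE fam2E sum_ffunE.
  have -> : zisum y = u * \sum_k expz (~~ b) x 0 k.
    rewrite /zisum mulr_sumr; apply: eq_bigr => k' _; rewrite yE !mxE -cisN -cisD; congr cis.
    by rewrite sign_negb; ring.
  rewrite [X in X * _]mulrC -mulrA; congr (_ * _); rewrite mulr_sumr; apply: eq_bigr => i _.
  rewrite scalE mulrA; congr (_ * _); rewrite yE !mxE -cisN -cisD; congr cis.
  by rewrite sign_negb; ring.
- apply/spinP => c; rewrite scalE fam2E sum_ffunE.
  have -> : zsum y = u^-1 * \sum_k expz b x 0 k.
    by rewrite /zsum mulr_sumr; apply: eq_bigr => k' _; rewrite mxE.
  rewrite [X in X * _]mulrC -mulrA; congr (_ * _); rewrite mulr_sumr; apply: eq_bigr => i _.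
  rewrite scalE mulrA; congr (_ * _); rewrite mxE invfM invrK mulrA mulVf ?mul1r //.
Qed.

Lemma scale1_5 (u0 u1 u2 u3 u4 : spin) :
  (1 : C) *: u0 + (1 : C) *: u1 + (1 : C) *: u2 + (1 : C) *: u3 + (1 : C) *: u4 =
  u0 + u1 + u2 + u3 + u4.
Proof. by rewrite !scale1r. Qed.

Lemma classification (Psi : wavefun) :
  algebraic_eigenfunction a Psi -> has_momentum Psi ->
  exists (c0 c1 c2 c3 c4 : C) (s0 s1 s2 s3 s4 : spin),
    equivalent a Psi (fun x =>
      c0 *: Psi0 a s0 x + c1 *: Psi1 a s1 x + c2 *: Psi2 a s2 x
      + c3 *: Psi3 a s3 x + c4 *: Psi4 a s4 x).
Proof.
move=> [b [k [E [Phi [HPhi [_ eig] PsiE]]]]] [p [smPsi [x0 dx0 Psi0x] mom]].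
have [L PhiE] := Hspace_atoms HPhi.
have PW y : domain y -> Psi y = (mu a y)%:C *: atom_wave b L y.
  by move=> dy; rewrite PsiE // PhiE ?atom_waveE //; exact: expz_zdomain.
have sPsi : SmF Psi.
  by apply: (SmF_ext (fun y dy => esym (PW y dy))); apply: SmF_mu; exact: SmF_wsum.
have momc y c : domain y -> momentum Psi y c = p * Psi y c.
  by move=> dy; rewrite mom // scalE.
have H2Psi y c : domain y -> H2 a Psi y c = E * Psi y c.
  exact: H2_algebraic PhiE eig PsiE.
pose sel (al : atom R n m) := (2 * (-1) ^+ b)%:C * (atom_deg al)%:R == p :> C.
have sel_eq y : domain y -> atom_wave b L y = \sum_(al <- L | sel al) atom_val al (expz b y).
  exact: momentum_selects PW momc.
(* At most one degree matches the momentum. If none does, the selection is empty and 0 serves as a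
   placeholder. *)
have [d0 hd0] : exists d0, forall al, sel al -> atom_deg al = d0.
  have [[d0 e0]|no] := pselect (exists d0 : nat, (2 * (-1) ^+ b)%:C * d0%:R = p); last first.
    by exists 0%N => al /eqP e; case: no; exists (atom_deg al).
  exists d0 => al /eqP; rewrite -e0 => /mulfI h; apply/eqP; rewrite -(eqr_nat C); apply/eqP; apply: h.
  by rewrite -(rmorph0 (@real_complex R)) (inj_eq (@complexI R)) mulf_neq0 ?signr_eq0 ?pnatr_eq0.
(* The exponent d0 / N, since exp(2i d0 xbar) = exp(2i (d0 / N) \sum_k x_k); the sign is that of the
   exponents. *)
pose la : R := (-1) ^+ b * (d0%:R / N%:R).
have Gsp : spanned (fun x => \sum_(al <- L | sel al) (mu a x)%:C *: reduced b al x).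
  by apply: spanned_sum => al; exact: reduced_spanned.
have [s0 [s1 [s2 [s3 [s4 GE]]]]] := Gsp.
exists 1, 1, 1, 1, 1, s0, s1, s2, s3, s4.
set G := fun x => _.
have GE' x : G x = \sum_(al <- L | sel al) (mu a x)%:C *: reduced b al x.
  by apply: etrans (scale1_5 _ _ _ _ _) _; exact: esym (GE x).
have PG x : domain x -> Psi x = phase la x *: G x.
  move=> dx; rewrite PW // sel_eq // GE' !scaler_sumr; apply: eq_bigr => al /hd0 e.
  by rewrite atom_reduced e !scalerA mulrC.
have GP x : domain x -> G x = phase (- la) x *: Psi x.
  move=> dx; rewrite PG // scalerA -waveD.
  have -> : wave (fun=> - la + la) x = 1.
    rewrite /wave /lin big1 ?mulr0 ?cis0 // => i _; by rewrite addNr mul0r.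
  by rewrite scale1r.
have sG : SmF G by apply: (SmF_ext (fun y dy => esym (GP y dy))); exact: SmF_phase.
split.
- exists E; split => //; first by exists x0.
  by move=> x dx; apply/spinP => c; rewrite scalE H2Psi.
(* The energy of Psi boosted by the phase with exponent - [la]. *)
- exists (E + N%:R * (4 * (- la) ^+ 2)%:C + (4 * - la)%:C * p); split.
  + exact: SmF_smooth.
  + exists x0 => //; apply: contraNneq Psi0x => G0; by rewrite PG // G0 scaler0.
  + move=> x dx; apply/spinP => c; rewrite (H2_ext a GP dx) (GP x dx).
    apply: etrans (phase_H2 _ sPsi dx (H2Psi x c dx) (momc x c dx)) _.
    by rewrite [RHS]scalE.
- exists la => x dx; rewrite PG //; congr (_ *: _).
  by rewrite /phase /wave /lin -mulr_sumr mulrA.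
Qed.

End Classification.

Theorem theorem4 (R : realType) (n m : nat) (a : R)
    (hN : (3 <= n.+1)%N) (ha : 1 / 2 < a) :
  (forall s : spin R n m,
     [/\ nonzero (Psi0 a s) ->
           eigenfunction (H2 a) (E0 n a)%:C (Psi0 a s) /\
           eigenfunction (@momentum R n m) 0 (Psi0 a s),
         nonzero (Psi1 a s) ->
           eigenfunction (H2 a) (E12 n a)%:C (Psi1 a s) /\
           eigenfunction (@momentum R n m) 0 (Psi1 a s),
         nonzero (Psi2 a s) ->
           eigenfunction (H2 a) (E12 n a)%:C (Psi2 a s) /\
           eigenfunction (@momentum R n m) 0 (Psi2 a s),
         nonzero (Psi3 a s) ->
           eigenfunction (H2 a) (E34 n a)%:C (Psi3 a s) /\
           eigenfunction (@momentum R n m) 0 (Psi3 a s) &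
         nonzero (Psi4 a s) ->
           eigenfunction (H2 a) (E34 n a)%:C (Psi4 a s) /\
           eigenfunction (@momentum R n m) 0 (Psi4 a s)])
  /\
  (forall Psi : 'rV[R]_n.+1 -> spin R n m,
     algebraic_eigenfunction a Psi -> has_momentum Psi ->
     exists (c0 c1 c2 c3 c4 : R[i]) (s0 s1 s2 s3 s4 : spin R n m),
       equivalent a Psi (fun x =>
         c0 *: Psi0 a s0 x + c1 *: Psi1 a s1 x + c2 *: Psi2 a s2 x
         + c3 *: Psi3 a s3 x + c4 *: Psi4 a s4 x)).
Proof.
have n_gt0 : (0 < n)%N by exact: ltnW (hN : (1 < n)%N).
have a_gt0 : 0 < a by apply: lt_trans ha; rewrite divr_gt0.
by split; [move=> s; exact: exact_states|move=> Psi; exact: classification].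
Qed.
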